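(* Let $\phi_1>0$ and $0<\phi_2<1$, let $X$ be the two-dimensional Gaussian power-law intrinsic random function of order $0$ with parameters $(\phi_1,\phi_2)$, observed on $\Lambda_n=\{0,\dots,n-1\}^2$, and put $N=n^2$. Let $Q^{(1)}_1,Q^{(1)}_2$ be the two quadratic variations defined in the context and $q^{(1)}_r=\mathbb E[Q^{(1)}_r]$. Define the $2\times 2$ matrix $\Sigma$ by $$\Sigma_{\ell m}=2\int_{\mathbb T^2} b_\ell(\lambda)\,b_m(\lambda)\,f_{D^{(1)}_{[1]}X}(\lambda)^2\,\mu(d\lambda),\qquad b_1\equiv 1,\quad b_2(\lambda)=16\cos^2(\lambda_1/2)\cos^2(\lambda_2/2).$$ Then, as $n\to\infty$, $$\sqrt N\begin{pmatrix}Q^{(1)}_1-q^{(1)}_1\\ Q^{(1)}_2-q^{(1)}_2\end{pmatrix}\Rightarrow \mathcal N(0,\Sigma).$$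
   Context: Field: $X=\{X(x):x\in\mathbb R^2\}$ is such that for all finitely supported real weights with $\sum_i w_i=0$ and $\sum_j v_j=0$, the variables $\sum_i w_iX(x_i)$ and $\sum_j v_jX(y_j)$ are jointly centered Gaussian with covariance $\sum_{i,j}w_iv_jK(x_i-y_j)$, where $K(h)=\phi_1\Gamma(-\phi_2)\|h\|^{2\phi_2}$. Write $X_t=X(t)$ for $t\in\mathbb Z^2$. Differences: with $e_1=(1,0)$, $e_2=(0,1)$ and $r\in\{1,2\}$, $(D^{(1)}_{[r]}X)_t=X_t-X_{t+re_1}-X_{t+re_2}+X_{t+re_1+re_2}$, with symbol $g^{[r]}_1(\lambda)=(1-e^{ir\lambda_1})(1-e^{ir\lambda_2})$. Quadratic variations: $Q^{(1)}_r=\frac{1}{|\Lambda_{n-2r}|}\sum_{t\in\Lambda_{n-2r}}\bigl((D^{(1)}_{[r]}X)_t\bigr)^2$, where $\Lambda_k=\{0,\dots,k-1\}^2$. Spectrum: $\mathbb T^2=(-\pi,\pi]^2$, $\mu(d\lambda)=(2\pi)^{-2}d\lambda$, $f_X(\lambda)=\sum_{l\in\mathbb Z^2}c\,\phi_1\|\lambda+2\pi l\|^{-(2+2\phi_2)}$ and $f_{D^{(1)}_{[1]}X}(\lambda)=|g^{[1]}_1(\lambda)|^2f_X(\lambda)$, where $c>0$ is the constant depending only on $\phi_2$ for which $f_{D^{(1)}_{[1]}X}$ is the spectral density with respect to $\mu$ of the stationary field $D^{(1)}_{[1]}X$ on $\mathbb Z^2$, i.e. $\mathrm{Cov}((D^{(1)}_{[1]}X)_t,(D^{(1)}_{[1]}X)_{t+h})=\int_{\mathbb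 T^2}e^{i\langle h,\lambda\rangle}f_{D^{(1)}_{[1]}X}(\lambda)\,\mu(d\lambda)$. *)

(* Defs.v *)
(* MathComp-Analysis over an abstract [R : realType]; [R[i]] is the type of
   complex numbers of mathcomp-real-closed. *)
From HB Require Import structures.
From mathcomp Require Import all_boot all_order all_algebra.
From mathcomp Require Import complex.
From mathcomp Require Import all_classical all_reals all_analysis.

Set Implicit Arguments.
Unset Strict Implicit.
Unset Printing Implicit Defensive.

Import Order.TTheory GRing.Theory Num.Theory.
Import numFieldNormedType.Exports.

Local Open Scope classical_set_scope.
Local Open Scope ring_scope.

Section Gamma.
Context {R : realType}.

Definition gamma_euler (x : R) : R :=
  \int[lebesgue_measure]_(t in `]0, +oo[%classic) (t `^ (x - 1) * expR (- t)).

(* Euler's integral for x > 0, extended to negative non-integers by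
   Gamma x = Gamma (x + n) / (x (x + 1) ... (x + n - 1)), where n is the least
   positive integer such that x + n > 0.  The value at a pole is 0. *)
Definition Gamma (x : R) : R :=
  if 0 < x then gamma_euler x
  else let n := (Num.truncn (- x)).+1 in
       gamma_euler (x + n%:R) / \prod_(i < n) (x + i%:R).

End Gamma.

Section Plane.
Context {R : realType}.

(* The norm [`|_|] of the library on [R * R] is the sup norm. *)
Definition enorm (x : R * R) : R := Num.sqrt (x.1 ^+ 2 + x.2 ^+ 2).

Definition site (t : int * int) : R * R := (t.1%:~R, t.2%:~R).

Definition inner (h : int * int) (l : R * R) : R :=
  h.1%:~R * l.1 + h.2%:~R * l.2.

Definition expi (x : R) : R[i] := (cos x +i* sin x)%C.

Definition torus : set (R * R) := `]- pi, pi] `*` `]- pi, pi].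

Definition torus_int (f : R * R -> R) : R :=
  ((2 * pi) ^+ 2)^-1 *
    \int[(lebesgue_measure \x lebesgue_measure)%E]_(l in torus) f l.

Definition torus_cint (f : R * R -> R[i]) : R[i] :=
  (torus_int (fun l => complex.Re (f l)) +i*
   torus_int (fun l => complex.Im (f l)))%C.

End Plane.

Section GaussianLaws.
Context {R : realType}.

(* Centred normal law with variance v >= 0.  The case v = 0 has to be separated
   because [normal_prob 0 0] is the uniform law on [0, 1]. *)
Definition normal_law (v : R) : set (measurableTypeR R) -> \bar R :=
  if v == 0 then \d_(0 : measurableTypeR R) else normal_prob 0 (Num.sqrt v).

Definition jointly_centered_gaussian d (T : measurableType d)
    (P : probability T R) (U V : T -> R) : Prop :=
  forall a b : R, exists2 v : R, 0 <= v &
    forall A : set (measurableTypeR R), measurable A ->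
      P [set w | A (a * U w + b * V w)] = normal_law v A.

(* nu = N(0, S) on R^2: each linear form z |-> u . z has law N(0, u S u^T). *)
Definition is_normal2 (S : 'M[R]_2)
    (nu : probability (measurableTypeR R * measurableTypeR R)%type R) : Prop :=
  forall (u : 'rV[R]_2) (A : set (measurableTypeR R)), measurable A ->
    nu [set z | A (u 0 0 * z.1 + u 0 1 * z.2)]
      = normal_law ((u *m S *m u^T) 0 0) A.

Definition cvg_in_law2 d (T : measurableType d) (P : probability T R)
    (Y : nat -> T -> R * R)
    (nu : probability (measurableTypeR R * measurableTypeR R)%type R) : Prop :=
  forall h : R * R -> R, continuous h ->
    (exists M : R, forall z, `|h z| <= M) ->
    'E_P[h \o Y n]%E @[n --> \oo] --> (\int[nu]_z (h z)%:E)%E.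

End GaussianLaws.

Section Field.
Context {R : realType} d (T : measurableType d) (P : probability T R).

Definition power_law (phi1 phi2 : R) (h : R * R) : R :=
  phi1 * Gamma (- phi2) * enorm h `^ (2 * phi2).

Definition gaussian_power_law_irf0 (phi1 phi2 : R)
    (X : R * R -> {RV P >-> R}) : Prop :=
  forall (p q : nat) (w : 'I_p -> R) (x : 'I_p -> R * R)
         (v : 'I_q -> R) (y : 'I_q -> R * R),
    \sum_i w i = 0 -> \sum_j v j = 0 ->
    let U o := \sum_i w i * X (x i) o in
    let V o := \sum_j v j * X (y j) o in
    jointly_centered_gaussian P U V /\
    covariance P U V =
      (\sum_i \sum_j w i * v j * power_law phi1 phi2 (x i - y j))%:E.

Definition e1 : int * int := (1, 0).
Definition e2 : int * int := (0, 1).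

Definition D1 (r : nat) (X : R * R -> {RV P >-> R}) (t : int * int) (o : T) :
    R :=
  X (site t) o - X (site (t + e1 *+ r)) o - X (site (t + e2 *+ r)) o
    + X (site (t + e1 *+ r + e2 *+ r)) o.

Definition g1 (r : nat) (l : R * R) : R[i] :=
  (1 - expi (r%:R * l.1)) * (1 - expi (r%:R * l.2)).

Definition Lambda (k : nat) : finType := ('I_k * 'I_k)%type.

(* The value is 0 when n <= 2 r, since Lambda 0 is empty. *)
Definition Q1 (r n : nat) (X : R * R -> {RV P >-> R}) (o : T) : R :=
  #|Lambda (n - 2 * r)|%:R^-1 *
    \sum_(t : Lambda (n - 2 * r)) D1 r X (Posz t.1, Posz t.2) o ^+ 2.

(* On the torus the series is infinite only at l = 0; there [0 `^ (- s) = 0]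
   makes the value finite but meaningless, and g1 1 0 = 0. *)
Definition fX (phi1 phi2 c : R) (l : R * R) : R :=
  fine (\esum_(k in [set: int * int])
    (c * phi1 * enorm (l.1 + 2 * pi * k.1%:~R, l.2 + 2 * pi * k.2%:~R)
       `^ (- (2 + 2 * phi2)))%:E).

Definition fD (phi1 phi2 c : R) (l : R * R) : R :=
  ComplexField.Normc.normc (g1 1 l) ^+ 2 * fX phi1 phi2 c l.

(* With respect to the measure (2 pi)^-2 dl on the torus. *)
Definition is_spectral_density (Z : int * int -> T -> R) (f : R * R -> R) :
    Prop :=
  forall t h : int * int,
    (fine (covariance P (Z t) (Z (t + h))))%:C%C
      = torus_cint (fun l => expi (inner h l) * (f l)%:C%C).

End Field.

Section LimitCovariance.
Context {R : realType}.

Definition bweight (i : 'I_2) (l : R * R) : R :=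
  if i == 0 then 1 else 16 * cos (l.1 / 2) ^+ 2 * cos (l.2 / 2) ^+ 2.

Definition Sigma (phi1 phi2 c : R) : 'M[R]_2 :=
  \matrix_(i, j)
    (2 * torus_int (fun l => bweight i l * bweight j l * fD phi1 phi2 c l ^+ 2)).

End LimitCovariance.

(* Main.v *)
Require Import Defs.
From HB Require Import structures.
From mathcomp Require Import all_boot all_order all_algebra.
From mathcomp Require complex.
From mathcomp Require Import all_classical all_reals all_analysis.
From mathcomp Require Import measurable_realfun ftc.
From mathcomp Require Import ring lra zify.

Import Order.TTheory GRing.Theory Num.Theory.
Import numFieldNormedType.Exports.
Local Open Scope classical_set_scope.
Local Open Scope ring_scope.

(** Write Z for the differences of step 1, rho for their covariance function, and f
    for their spectral density. The differences of step 2 are sums of Z over the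
    corners of a unit square ([D1_stencil]), so every linear combination of the two
    normalized variations is a centred quadratic form in Gaussian variables,
    with coefficients a i of order 1 / n and covariance matrix C. Its cumulants are
    governed by the traces of the powers of diag(a) C: if the trace of the square
    converges to v / 2 and those of the higher powers tend to 0, the moments
    converge to those of the normal law of variance v. This is proved by Gaussian
    integration by parts, which gives a closed recursion for the moments ([gmomS],
    [cvg_moments]) without counting pairings.

    The trace of the square is a normalized double sum over pairs of sites of
    squared covariances, and converges to a sum over the lattice of squares of
    combinations of rho ([cesaro_lattice]). By Parseval's identity that sum is the
    integral of b_l b_m f ^ 2 ([lattice_sum_stencil]). The higher traces tend to 0 by
    Cauchy-Schwarz and an estimate in terms of the sum of the squares of rho
    ([gtrace_bound], [cvg_trace_lattice]).

    The factor |g_1| ^ 2 of f is of order 4 at the origin, where the pole of f_X is of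
    order 2 + 2 phi2 < 4. Hence f is a uniform limit on the torus of continuous
    functions that are even in each variable, and then of cosine polynomials
    ([tapprox_fD]). For such functions Parseval's identity follows from the
    orthogonality of the cosines ([parseval]).

    The limit law is that of a vector made of two increments of the field
    itself: X(1,0) - X(-1,0) and X(0,1) - X(0,-1) are uncorrelated with the same
    variance, and a Cholesky factor of Sigma combines them ([limit_vector]).
    Convergence of the moments of all linear forms gives that of the
    characteristic functions, through Taylor's formula, then of the expectations of
    trigonometric polynomials, and then of bounded continuous functions, which
    Bernstein polynomials in the sines of the coordinates approximate on
    large squares ([cvg_Ex_continuous]). *)

(** * Variables with moments of every order *)

Lemma integrable_dom {R : realType} {d : measure_display} {T : measurableType d}
    (mu : {measure set T -> \bar R}) (D : set T) (f g : T -> R) :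
  measurable D -> measurable_fun D f -> (forall x, D x -> `|f x| <= g x) ->
  mu.-integrable D (EFin \o g) -> mu.-integrable D (EFin \o f).
Proof.
move=> mD mf fg; apply: le_integrable => //; first exact/measurable_EFinP.
move=> x Dx /=; rewrite lee_fin (ger0_norm (le_trans _ (fg x Dx)))//.
exact: fg.
Qed.

Section Moments.
Context {R : realType} {d : measure_display} {T : measurableType d}.
Variable P : probability T R.
Implicit Types f g : T -> R.

(** Every variable of the proof is a polynomial in Gaussian variables or bounded,
    so this class, which is closed under sums and products, makes integrability
    routine. *)
Definition has_moments f :=
  measurable_fun setT f /\
  forall k : nat, P.-integrable setT (EFin \o (fun x => f x ^+ k)).

Notation Ex f := (\int[P]_x (f x)).

Lemma has_moments_integrable {f} : has_moments f -> P.-integrable setT (EFin \o f).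
Proof. by case=> _ /(_ 1%N). Qed.

(** 2 |x y| <= x ^ 2 + y ^ 2. *)
Lemma has_moments_prod_pow f g i j : has_moments f -> has_moments g ->
  P.-integrable setT (EFin \o (fun x => f x ^+ i * g x ^+ j)).
Proof.
move=> [mf If] [mg Ig].
apply: (integrable_dom P _ _ (fun x => f x ^+ (i + i) + g x ^+ (j + j))) => //.
- by apply: measurable_funM; exact: measurable_funX.
- move=> x _; rewrite !exprD normrM.
  have : 0 <= (`|f x ^+ i| - `|g x ^+ j|) ^+ 2 by exact: sqr_ge0.
  have : 0 <= `|f x ^+ i| ^+ 2 by exact: sqr_ge0.
  have : 0 <= `|g x ^+ j| ^+ 2 by exact: sqr_ge0.
  rewrite -!expr2 -[X in _ -> _ -> _ -> _ <= X + _]real_normK ?num_real//.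
  by rewrite -[X in _ -> _ -> _ -> _ <= _ + X]real_normK ?num_real//; nra.
- exact: (integrableD measurableT (If _) (Ig _)).
Qed.

Lemma has_moments_cst (a : R) : has_moments (fun=> a).
Proof.
by split=> // k; exact: (finite_measure_integrable_cst P (a ^+ k)).
Qed.

Lemma has_momentsM f g : has_moments f -> has_moments g ->
  has_moments (fun x => f x * g x).
Proof.
move=> hf hg; split; first exact: (measurable_funM hf.1 hg.1).
move=> k; have := has_moments_prod_pow f g k k hf hg.
by congr (_.-integrable _ _); apply/funext=> x /=; rewrite exprMn.
Qed.

Lemma has_momentsX f k : has_moments f -> has_moments (fun x => f x ^+ k).
Proof.
move=> hf; split; first exact: (measurable_funX _ hf.1).
move=> j; have := hf.2 (k * j)%N.
by congr (_.-integrable _ _); apply/funext=> x /=; rewrite exprM.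
Qed.

Lemma has_momentsD f g : has_moments f -> has_moments g ->
  has_moments (fun x => f x + g x).
Proof.
move=> hf hg; split; first exact: (measurable_funD hf.1 hg.1).
move=> k.
have -> : (EFin \o (fun x => (f x + g x) ^+ k)) =
  (fun x => \sum_(i < k.+1) ('C(k, i)%:R%:E * (f x ^+ (k - i) * g x ^+ i)%:E)%E)%E.
  apply/funext=> x /=; rewrite exprDn -sumEFin; apply: eq_bigr => i _.
  by rewrite -EFinM mulr_natl.
apply: integrable_sum => //= i _; apply: integrableZl => //.
exact: has_moments_prod_pow.
Qed.

Lemma has_momentsZ (a : R) f : has_moments f -> has_moments (fun x => a * f x).
Proof. by move=> hf; exact: (has_momentsM _ _ (has_moments_cst a) hf). Qed.

Lemma has_momentsB f g : has_moments f -> has_moments g ->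
  has_moments (fun x => f x - g x).
Proof.
move=> hf hg.
have := has_momentsD _ _ hf (has_momentsZ (-1) _ hg).
by congr has_moments; apply/funext => x; rewrite mulN1r.
Qed.

Lemma has_moments_sum (I : Type) (s : seq I) (F : I -> T -> R) :
  (forall i, has_moments (F i)) -> has_moments (fun x => \sum_(i <- s) F i x).
Proof.
move=> hF; elim: s => [|i s ih].
  by under eq_fun do rewrite big_nil; exact: has_moments_cst.
by under eq_fun do rewrite big_cons; exact: has_momentsD.
Qed.

Lemma ExpD f g : has_moments f -> has_moments g ->
  Ex (fun x => f x + g x) = Ex f + Ex g.
Proof. by move=> hf hg; rewrite RintegralD//; exact: has_moments_integrable. Qed.

Lemma ExpB f g : has_moments f -> has_moments g ->
  Ex (fun x => f x - g x) = Ex f - Ex g.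
Proof. by move=> hf hg; rewrite RintegralB//; exact: has_moments_integrable. Qed.

Lemma ExpZ a f : has_moments f -> Ex (fun x => a * f x) = a * Ex f.
Proof. by move=> hf; rewrite RintegralZl//; exact: has_moments_integrable. Qed.

Lemma Exp_cst (a : R) : Ex (fun=> a) = a.
Proof. 
transitivity (a * fine (P setT)); first exact: Rintegral_cst.
by rewrite probability_setT mulr1. Qed.

Lemma Exp_sum (I : Type) (s : seq I) (F : I -> T -> R) :
  (forall i, has_moments (F i)) ->
  Ex (fun x => \sum_(i <- s) F i x) = \sum_(i <- s) Ex (F i).
Proof.
move=> hF; elim: s => [|i s ih].
  by rewrite big_nil; under eq_Rintegral do rewrite big_nil; exact: Exp_cst.
under eq_Rintegral do rewrite big_cons.
by rewrite big_cons -ih ExpD//; exact: has_moments_sum.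
Qed.

End Moments.
Notation Ex P f := (\int[P]_x (f x)).

Lemma Ex_ext {R : realType} {d : measure_display} {T : measurableType d}
    (P : probability T R) (f g : T -> R) : f =1 g -> Ex P f = Ex P g.
Proof. by move=> fg; apply: eq_Rintegral => x _; exact: fg. Qed.

(** * Moments of the centred normal law *)

Section NormalMoments.
Context {R : realType}.
Notation mu := (@lebesgue_measure R).
Implicit Types s : R.

(** The normal law is given by its density; identifying the latter with the
    Radon-Nikodym derivative gives the change of variables of the next lemmas. *)
Lemma normal_prob_density s :
  ae_eq mu setT (Radon_Nikodym_SigmaFinite.f (normal_prob 0 s) mu)
    (EFin \o normal_pdf 0 s).
Proof.
have nd : normal_prob 0 s `<< mu by exact: normal_prob_dominates.
apply: integral_ae_eq => //.
- exact: Radon_Nikodym_SigmaFinite.f_integrable.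
- by apply/measurable_EFinP; exact: measurable_normal_pdf.
- by move=> E _ mE; rewrite -Radon_Nikodym_SigmaFinite.f_integral.
Qed.

Lemma ge0_integral_normal_prob s (f : R -> \bar R) :
  measurable_fun setT f -> (forall x, 0 <= f x)%E ->
  (\int[normal_prob 0 s]_x f x = \int[mu]_x (f x * (normal_pdf 0 s x)%:E))%E.
Proof.
move=> mf f0.
have nd : normal_prob 0 s `<< mu by exact: normal_prob_dominates.
rewrite -(Radon_Nikodym_SigmaFinite.change_of_variables nd)//.
apply: ae_eq_integral => //.
- apply: emeasurable_funM => //; apply: (measurable_int mu).
  exact: Radon_Nikodym_SigmaFinite.f_integrable.
- apply: emeasurable_funM => //.
  by apply/measurable_EFinP; exact: measurable_normal_pdf.
- apply: ae_eqe_mul2l; exact: normal_prob_density.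
Qed.

Lemma integrable_normal_prob s (f : R -> R) : measurable_fun setT f ->
  mu.-integrable setT (EFin \o (fun x => f x * normal_pdf 0 s x)) ->
  (normal_prob 0 s).-integrable setT (EFin \o f).
Proof.
move=> mf /integrableP[_ fi]; apply/integrableP; split.
  exact/measurable_EFinP.
rewrite ge0_integral_normal_prob//; last first.
  by apply: measurableT_comp => //; exact/measurable_EFinP.
apply: le_lt_trans fi; rewrite le_eqVlt; apply/orP; left; apply/eqP.
apply: eq_integral => x _ /=.
by rewrite normrM EFinM (ger0_norm (normal_pdf_ge0 _ _ _)).
Qed.

Lemma Rintegral_normal_prob s (f : R -> R) : measurable_fun setT f ->
  mu.-integrable setT (EFin \o (fun x => f x * normal_pdf 0 s x)) ->
  \int[normal_prob 0 s]_x (f x) = \int[mu]_x (f x * normal_pdf 0 s x).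
Proof.
move=> mf fi; congr fine.
have nd : normal_prob 0 s `<< mu by exact: normal_prob_dominates.
rewrite -(Radon_Nikodym_change_of_variables nd)//; last first.
  exact: integrable_normal_prob.
under [RHS]eq_integral do rewrite EFinM.
apply: ae_eq_integral => //.
- apply: emeasurable_funM => //; first exact/measurable_EFinP.
- by under eq_fun do rewrite -EFinM; exact: (measurable_int mu fi).
- apply: ae_eqe_mul2l; apply: ae_eq_trans (normal_prob_density s).
  exact/ae_eq_sym/ae_eq_Radon_Nikodym_SigmaFinite.
Qed.

Lemma expR_ge_pow (k : nat) (y : R) : 0 <= y -> y ^+ k <= k`!%:R * expR y.
Proof.
case: k => [|k] y0; first by rewrite expr0 fact0 mul1r -expR0 ler_expR.
have := expR_ge1Dxn k y0; rewrite mulrC => h.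
rewrite -ler_pdivrMl ?ltr0n ?fact_gt0//; apply: le_trans h.
by rewrite lerDr.
Qed.

(** A power is absorbed by part of the exponent; what remains is, up to a constant,
    the density of standard deviation 2 s. *)
Lemma pow_normal_pdf_bound s (k : nat) : s != 0 -> exists C : R,
  forall x, `|x ^+ k * normal_pdf 0 s x| <= C * normal_pdf 0 (2 * s) x.
Proof.
move=> s0; have s20 : 2 * s != 0 by rewrite mulf_neq0.
have ss : 0 < s ^+ 2 by rewrite exprn_even_gt0.
pose c : R := s ^+ 2 *+ 4.
have c0 : 0 < c by rewrite /c; lra.
exists ((1 + c ^+ k * k`!%:R) * 2) => x.
rewrite !normal_pdfE// !normrM (ger0_norm (normal_peak_ge0 _)).
rewrite (ger0_norm (normal_fun_ge0 _ _ _)).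
have -> : normal_peak (2 * s) = normal_peak s / 2 :> R.
  rewrite /normal_peak; set p := s ^+ 2 * pi *+ 2.
  have -> : (2 * s) ^+ 2 * pi *+ 2 = 2 ^+ 2 * p by rewrite /p; ring.
  by rewrite sqrtrM ?sqr_ge0// sqrtr_sqr ger0_norm// invfM mulrC.
rewrite [leRHS](_ : _ = normal_peak s * ((1 + c ^+ k * k`!%:R) * normal_fun 0 (2 * s) x)); last by field.
rewrite mulrCA ler_wpM2l ?normal_peak_ge0//.
rewrite /normal_fun subr0.
have -> : - x ^+ 2 / (s ^+ 2 *+ 2) =
   - x ^+ 2 / ((2 * s) ^+ 2 *+ 2) + - (x ^+ 2 / c) - x ^+ 2 / (c * 2) .
  by rewrite /c; field.
set y := x ^+ 2 / c.
have y0 : 0 <= y by rewrite /y divr_ge0 ?sqr_ge0 ?ltW.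
rewrite expRD expRD mulrCA -mulrA [leRHS]mulrC.
rewrite ler_wpM2l ?expR_ge0//.
have e1 : expR (- (x ^+ 2 / (c * 2))) <= 1.
  by rewrite -[X in _ <= X]expR0 ler_expR oppr_le0 divr_ge0 ?sqr_ge0// ltW// mulr_gt0.
have xk : `|x ^+ k| <= 1 + c ^+ k * y ^+ k.
  have -> : c ^+ k * y ^+ k = `|x ^+ k| ^+ 2.
    rewrite -exprMn /y mulrC divfK ?gt_eqF// real_normK ?num_real//.
    by rewrite -!exprM mulnC.
  have := sqr_ge0 (`|x ^+ k| - 1); have := normr_ge0 (x ^+ k).
  move: (`|x ^+ k|) => z; nra.
have e2 : expR (- y) <= 1 by rewrite -[X in _ <= X]expR0 ler_expR oppr_le0.
have e3 : y ^+ k * expR (- y) <= k`!%:R.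
  by rewrite expRN ler_pdivrMr ?expR_gt0// expR_ge_pow.
have ck : 0 <= c ^+ k by rewrite exprn_ge0// ltW.
have := expR_ge0 (- y); have := normr_ge0 (x ^+ k).
have := expR_ge0 (- (x ^+ 2 / (c * 2))).
move: (expR _) e1 => a a1 a0 n0 b0.
apply: (@le_trans _ _ (`|x ^+ k| * expR (- y))).
  by rewrite mulrCA ler_wpM2l// ler_piMr.
apply: (@le_trans _ _ ((1 + c ^+ k * y ^+ k) * expR (- y))).
  by rewrite ler_wpM2r.
rewrite mulrDl mul1r -mulrA lerD// ler_wpM2l//.
Qed.

Lemma integrable_pow_normal_pdf s (k : nat) : s != 0 ->
  mu.-integrable setT (EFin \o (fun x => x ^+ k * normal_pdf 0 s x)).
Proof.
move=> s0; have [C hC] := pow_normal_pdf_bound s k s0.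
apply: (integrable_dom mu _ _ (fun x => C * normal_pdf 0 (2 * s) x)) => //.
- have : measurable_fun setT (fun x : R => x ^+ k * normal_pdf 0 s x).
    apply: measurable_funM; first exact: measurable_funX.
    exact: measurable_normal_pdf.
  exact.
- exact: (integrableZl measurableT C (integrable_normal_pdf 0 (2 * s))).
Qed.

Lemma cvg_integral_itv_sym (f : R -> R) : mu.-integrable setT (EFin \o f) ->
  (\int[mu]_(x in `[(- n%:R)%R, n%:R%R]) (f x)%:E @[n --> \oo] -->
   \int[mu]_x (f x)%:E)%E.
Proof.
move=> fi; have mf := measurable_int _ fi.
pose fn (n : nat) := (EFin \o f) \_ `[- n%:R, n%:R]%classic.
have := @dominated_convergence _ _ _ mu _ measurableT fn (EFin \o f)
  (abse \o (EFin \o f)).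
case.
- move=> n; apply/(measurable_restrict _ _ _).1 => //.
  by rewrite setTI; apply: measurable_funS mf.
- exact: mf.
- apply: aeW => x _; apply: cvg_near_cst.
  near=> n; rewrite /fn patchE ifT// inE/= in_itv/= -ler_norml.
  by near: n; exact: nbhs_infty_ger.
- exact: integrable_abse.
- apply: aeW => x n _; rewrite /fn patchE; case: ifP => //= _.
  by rewrite lee_fin normr0.
move=> _ _; apply: cvg_trans; apply: near_eq_cvg; apply: nearW => n.
by rewrite [RHS]integral_mkcond.
Unshelve. all: by end_near. Qed.

Lemma is_derive_normal_pdf s (x : R) : s != 0 ->
  is_derive x 1 (normal_pdf 0 s) (- x / s ^+ 2 * normal_pdf 0 s x).
Proof.
move=> s0; rewrite !normal_pdfE//.
have -> : (fun x => normal_peak s * normal_fun 0 s x) =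
  normal_peak s *: (expR \o (fun x => - (s ^+ 2 *+ 2)^-1 * x ^+ 2)).
  apply/funext => y; rewrite /normal_fun subr0 /=; congr (_ * expR _).
  by rewrite mulrC mulrN mulNr.
apply: is_derive_eq.
rewrite /normal_fun subr0.
have -> : - x ^+ 2 / (s ^+ 2 *+ 2) = - (s ^+ 2 *+ 2)^-1 * x ^+ 2 by ring.
rewrite -[LHS]/(normal_peak s * (expR (- (s ^+ 2 *+ 2)^-1 * x ^+ 2) *
  (- (s ^+ 2 *+ 2)^-1 * (x * 1 + x * 1)))).
by field.
Qed.

(** Both sides differ by the integral of the derivative of
    F x = - s ^ 2 x ^ j p x, where p is the density, and F vanishes at infinity. *)
Lemma normal_moment_rec s (j : nat) : s != 0 ->
  \int[mu]_x (x ^+ j.+1 * normal_pdf 0 s x) =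
  j%:R * s ^+ 2 * \int[mu]_x (x ^+ j.-1 * normal_pdf 0 s x).
Proof.
move=> s0.
pose p := normal_pdf (0 : R) s.
pose F (x : R) : R := - s ^+ 2 * (x ^+ j * p x).
pose f (x : R) : R := x ^+ j.+1 * p x - (j%:R * s ^+ 2) * (x ^+ j.-1 * p x).
have dF (x : R) : is_derive x 1 F (f x).
  have -> : F = - s ^+ 2 *: ((@GRing.exp R ^~ j) * p) by [].
  have dX : is_derive x 1 (@GRing.exp R ^~ j) (j%:R * x ^+ j.-1 * 1).
    have -> : (@GRing.exp R ^~ j) = (@id R) ^+ j.
      by apply/funext => y; rewrite exprfctE.
    exact: is_deriveX.
  have dp := is_derive_normal_pdf s x s0.
  apply: (is_derive_eq (is_deriveZ _ (is_deriveM dX dp))).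
  rewrite -[LHS]/(- s ^+ 2 * (x ^+ j * (- x / s ^+ 2 * p x) +
     p x * (j%:R * x ^+ j.-1 * 1))) /f (exprS x).
  by field.
have If : mu.-integrable setT (EFin \o f).
  have := integrableB measurableT (integrable_pow_normal_pdf s j.+1 s0)
   (integrableZl measurableT (j%:R * s ^+ 2) (integrable_pow_normal_pdf s j.-1 s0)).
  exact.
have : (\int[mu]_x (f x)%:E = 0)%E.
  apply: (cvg_unique _ (cvg_integral_itv_sym f If)) => //.
  have cf : continuous f.
    have cp : continuous p by exact: continuous_normal_pdf.
    move=> x; apply: (@cvgB _ R^o); first by apply: cvgM; [exact: exprn_continuous|exact: cp].
    apply: cvgM; first exact: cvg_cst.
    by apply: cvgM; [exact: exprn_continuous|exact: cp].
  have cF : continuous F.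
    move=> x; apply: differentiable_continuous; apply/derivable1_diffP.
    exact: ex_derive.
  have H (n : nat) : (\int[mu]_(x in `[(- n.+1%:R)%R, n.+1%:R%R]) (f x)%:E =
     (F n.+1%:R)%:E - (F (- n.+1%:R))%:E)%E.
    apply: continuous_FTC2.
    - by apply: (@lt_trans _ _ 0); rewrite ?oppr_lt0 ltr0n.
    - exact: continuous_subspaceT.
    - split; first by move=> x _; exact: ex_derive.
        by apply: cvg_at_right_filter; exact: cF.
      by apply: cvg_at_left_filter; exact: cF.
    - by move=> x _; rewrite derive1E; apply: derive_val.
  have [C hC] := pow_normal_pdf_bound s j.+1 s0.
  pose K := `|s ^+ 2| * (`|C| * normal_peak (2 * s)).
  have FK (x : R) : x != 0 -> `|F x| <= K / `|x|.
    move=> x0; rewrite ler_pdivlMr ?normr_gt0// -normrM.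
    rewrite /F /K -mulrA normrM normrN ler_wpM2l//.
    rewrite mulrAC -exprSr.
    apply: le_trans (hC x) _; apply: (le_trans (ler_norm _)).
    rewrite normrM ler_wpM2l// ger0_norm ?normal_pdf_ge0//.
    by apply: normal_pdf_ub; rewrite mulf_neq0.
  rewrite /= -(cvg_shiftS _ _).
  under eq_fun do rewrite H -EFinB.
  apply: cvg_EFin; first exact: nearW.
  apply/norm_cvg0P.
  apply: (@squeeze_cvgr _ _ _ _ (fun=> 0) (fun n => (K + K) * harmonic n)).
  - apply: nearW => n /=; rewrite normr_ge0/= mulrDl.
    have n0 : n.+1%:R != 0 :> R by rewrite pnatr_eq0.
    apply: (le_trans (ler_normB _ _)); apply: lerD.
      by apply: le_trans (FK _ n0) _; rewrite ger0_norm.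
    by rewrite (le_trans (FK _ _)) ?oppr_eq0// normrN ger0_norm.
  - exact: cvg_cst.
  - rewrite -[X in _ --> X](mulr0 (K + K)); apply: cvgM; first exact: cvg_cst.
    exact: cvg_harmonic.
have e := integrable_pow_normal_pdf s.
rewrite /f => e0.
have : \int[mu]_x f x = 0 by rewrite /Rintegral e0.
rewrite RintegralB// ?RintegralZl//.
- by move/eqP; rewrite subr_eq0 => /eqP.
- exact: e.
- exact: e.
- exact: (integrableZl measurableT (j%:R * s ^+ 2) (e _ s0)).
Qed.

End NormalMoments.

Section GaussianVariable.
Context {R : realType} {d : measure_display} {T : measurableType d}.
Variables (P : probability T R) (U : T -> R) (v : R).
Hypotheses (mU : measurable_fun setT U) (v0 : 0 <= v).
Hypothesis lawU : forall A : set (measurableTypeR R), measurable A ->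
  P [set w | A (U w)] = normal_law v A.

Let U' : T -> measurableTypeR R := U.

Let mU' : measurable_fun setT U'. Proof. exact: mU. Qed.

Let integral_law (nu : probability (measurableTypeR R) R)
    (g : measurableTypeR R -> \bar R) :
  (forall A : set (measurableTypeR R), measurable A -> P [set w | A (U w)] = nu A) ->
  (\int[pushforward P U']_y g y = \int[nu]_y g y)%E.
Proof. by move=> e; apply: eq_measure_integral => A mA _; exact: e. Qed.

Let integrable_comp (nu : probability (measurableTypeR R) R)
    (f : measurableTypeR R -> R) :
  (forall A : set (measurableTypeR R), measurable A -> P [set w | A (U w)] = nu A) ->
  measurable_fun setT f -> nu.-integrable setT (EFin \o f) ->
  P.-integrable setT (EFin \o (f \o U)).
Proof.
move=> e mf /integrableP[mf' fi]; apply/integrableP; split.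
  by apply/measurable_EFinP; exact: (measurableT_comp mf mU').
rewrite -(integral_law _ _ e) ge0_integral_pushforward// in fi.
exact: measurableT_comp.
Qed.

Let Ex_comp (nu : probability (measurableTypeR R) R)
    (f : measurableTypeR R -> R) :
  (forall A : set (measurableTypeR R), measurable A -> P [set w | A (U w)] = nu A) ->
  measurable_fun setT f -> nu.-integrable setT (EFin \o f) ->
  Ex P (f \o U) = \int[nu]_y f y.
Proof.
move=> e mf fi; congr fine.
rewrite -(integral_law _ _ e) integral_pushforward//.
- exact/measurable_EFinP.
- exact: integrable_comp e mf fi.
Qed.

(** The law is allowed to be degenerate: both sides of the recursion vanish then. *)
Lemma gaussian_moments : has_moments P U /\
  forall j, Ex P (fun x => U x ^+ j.+1) = j%:R * v * Ex P (fun x => U x ^+ j.-1).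
Proof.
have mX k : measurable_fun setT (fun x : measurableTypeR R => x ^+ k).
  have : measurable_fun setT (fun x : R => x ^+ k) by exact: measurable_funX.
  exact.
case: (eqVneq v 0) => [v_eq0|vn0].
  pose D0 : probability (measurableTypeR R) R := dirac (0 : measurableTypeR R).
  have e (A : set (measurableTypeR R)) : measurable A -> P [set w | A (U w)] = D0 A.
    by move=> mA; rewrite lawU// /normal_law v_eq0 eqxx.
  have iX k : D0.-integrable setT (EFin \o (fun x : measurableTypeR R => x ^+ k)).
    apply/integrableP; split; first exact/measurable_EFinP.
    rewrite integral_dirac//; last first.
      by apply: measurableT_comp => //; exact/measurable_EFinP.
    by rewrite diracT mul1e ltry.
  split.
    by split=> // k; exact: (integrable_comp _ _ e (mX k) (iX k)).
  move=> j; rewrite v_eq0 mulr0 mul0r.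
  rewrite (Ex_comp _ (fun x => x ^+ j.+1) e)// /Rintegral integral_dirac//.
    by rewrite diracT mul1e /= expr0n.
  exact/measurable_EFinP.
have s0 : Num.sqrt v != 0 by rewrite gt_eqF// sqrtr_gt0 lt_neqAle eq_sym vn0.
have e (A : set (measurableTypeR R)) : measurable A -> P [set w | A (U w)] = normal_prob 0 (Num.sqrt v) A.
  by move=> mA; rewrite lawU// /normal_law (negbTE vn0).
have iX k : (normal_prob 0 (Num.sqrt v)).-integrable setT (EFin \o (fun x : R => x ^+ k)).
  by apply: integrable_normal_prob => //; exact: integrable_pow_normal_pdf.
split.
  by split=> // k; exact: (integrable_comp _ _ e (mX k) (iX k)).
move=> j.
rewrite (Ex_comp _ (fun x => x ^+ j.+1) e)// (Ex_comp _ (fun x => x ^+ j.-1) e)//.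
rewrite !Rintegral_normal_prob//; try exact: integrable_pow_normal_pdf.
by rewrite normal_moment_rec// sqr_sqrtr.
Qed.

End GaussianVariable.

(** * Gaussian integration by parts and quadratic forms *)

(** Identities between expectations along L + s M hold for all s; comparing their
    coefficients in s is how they are differentiated below. *)
Lemma poly_eval_inj {R : numDomainType} (p q : {poly R}) :
  (forall s, p.[s] = q.[s]) -> p = q.
Proof.
move=> h; apply/eqP; rewrite -subr_eq0; apply/negPn/negP => n0.
have := @max_poly_roots _ (p - q) [seq i%:R | i <- iota 0 (size (p - q)%R)] n0.
rewrite size_map size_iota ltnn => F; apply/notF/F.
- by apply/allP => x _; rewrite rootE hornerD hornerN h subrr.
- rewrite map_inj_uniq ?iota_uniq// => i j /eqP.
  by rewrite eqr_nat => /eqP.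
Qed.

Section GaussianIBP.
Context {R : realType} {d : measure_display} {T : measurableType d}.
Variable P : probability T R.
(* a linear space of variables whose moments obey the recursion of centred
   normal laws, such as the increments of the field *)
Variable LL : set (T -> R).
Hypothesis LLlin : forall (a : R) f g, LL f -> LL g -> LL (fun x => f x + a * g x).
Hypothesis LLm : forall f, LL f -> has_moments P f.
Hypothesis LLg : forall f, LL f -> forall j,
  Ex P (fun x => f x ^+ j.+1) =
    j%:R * Ex P (fun x => f x ^+ 2) * Ex P (fun x => f x ^+ j.-1).

Local Notation C f g := (Ex P (fun x => f x * g x)).

(* the polynomial s |-> E[G (L + s M)^k] *)
Let pol (G L M : T -> R) (k : nat) : {poly R} :=
  \poly_(i < k.+1) ('C(k, i)%:R * Ex P (fun x => G x * L x ^+ (k - i) * M x ^+ i)).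

Let polE G L M k s : has_moments P G -> has_moments P L -> has_moments P M ->
  (pol G L M k).[s] = Ex P (fun x => G x * (L x + s * M x) ^+ k).
Proof.
move=> hG hL hM; rewrite horner_poly.
transitivity (Ex P (fun x => \sum_(i < k.+1)
   ('C(k, i)%:R * s ^+ i) * (G x * L x ^+ (k - i) * M x ^+ i))).
  have hm (i : nat) : has_moments P (fun x => G x * L x ^+ (k - i) * M x ^+ i).
    apply: has_momentsM; last exact: has_momentsX.
    by apply: has_momentsM => //; exact: has_momentsX.
  rewrite Exp_sum; last by move=> i; apply: has_momentsZ; exact: hm.
  by apply: eq_bigr => i _; rewrite ExpZ; [ring|exact: hm].
apply: Ex_ext => x; rewrite exprDn big_distrr/=; apply: eq_bigr => i _.
by rewrite exprMn -mulr_natl; ring.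
Qed.

Let pol0 G L M k : (pol G L M k)`_0 = Ex P (fun x => G x * L x ^+ k).
Proof.
rewrite coef_poly /= bin0 mul1r; apply: Ex_ext => x.
by rewrite subn0 expr0 mulr1.
Qed.

Let pol1 G L M k :
  (pol G L M k)`_1 = k%:R * Ex P (fun x => G x * L x ^+ k.-1 * M x).
Proof.
rewrite coef_poly; case: k => [|k] /=; first by rewrite mul0r.
by rewrite bin1 subn1.
Qed.

(** Comparing the coefficients of s in the moment recursion of L + s M, a member
    of the space for every s, polarizes it into the covariance with M. *)
Lemma gaussian_stein L M k : LL L -> LL M ->
  Ex P (fun x => M x * L x ^+ k) = k%:R * C M L * Ex P (fun x => L x ^+ k.-1).
Proof.
move=> hL hM.
have mL := LLm _ hL; have mM := LLm _ hM.
have m1 : has_moments P (fun=> 1) by exact: has_moments_cst.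
elim/ltn_ind: k => k IH.
have key : pol (fun=> 1) L M k.+1 =
   k%:R *: (pol (fun=> 1) L M 2 * pol (fun=> 1) L M k.-1).
  apply: poly_eval_inj => s; rewrite hornerZ hornerM !polE//.
  have E j : Ex P (fun x => 1 * (L x + s * M x) ^+ j) = Ex P (fun x => (L x + s * M x) ^+ j).
    by apply: Ex_ext => x; rewrite mul1r.
  by rewrite !E (LLg _ (LLlin s _ _ hL hM)) mulrA.
have := congr1 (fun p : {poly R} => p`_1) key.
rewrite coefZ coefM big_ord_recl big_ord1 /= !pol0 !pol1 /=.
have E0 j : Ex P (fun x => 1 * L x ^+ j) = Ex P (fun x => L x ^+ j).
  by apply: Ex_ext => x; rewrite mul1r.
have E1 j : Ex P (fun x => 1 * L x ^+ j * M x) = Ex P (fun x => M x * L x ^+ j).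
  by apply: Ex_ext => x; rewrite mul1r mulrC.
rewrite !E0 !E1.
have -> : C M L = Ex P (fun x => M x * L x ^+ 1) by apply: Ex_ext => x; rewrite expr1.
set CC := Ex P (fun x => M x * L x ^+ 1).
case: k IH key => [|[|k]] IH _ /=.
- by rewrite !mul0r mul1r => ->.
- rewrite mul1r => h; apply: (@mulfI _ 2); first by rewrite pnatr_eq0.
  rewrite h; ring.
- rewrite (IH k)// /= => h.
  have g := LLg _ hL k.
  apply: (@mulfI _ k.+3%:R); first by rewrite pnatr_eq0.
  rewrite h g -/CC.
  rewrite -[k.+3]addn3 -[k.+2]addn2 -[k.+1]addn1 !natrD; ring.
Qed.

(** DF L0 plays the part of the derivative of F in the direction L0: this is
    E[L0 G] = E[D_L0 G] for G = F L ^ k. Keeping the power of L in the identity is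
    what makes the class stable under multiplication by members of the space, see
    [ibpM], so that it contains all polynomials in Gaussian variables. *)
Definition ibp (F : T -> R) (DF : (T -> R) -> T -> R) : Prop :=
  [/\ has_moments P F, forall L0, LL L0 -> has_moments P (DF L0) &
    forall L0 L k, LL L0 -> LL L ->
      Ex P (fun x => L0 x * F x * L x ^+ k) =
      Ex P (fun x => DF L0 x * L x ^+ k) +
      k%:R * C L0 L * Ex P (fun x => F x * L x ^+ k.-1)].

Lemma ibp1 : ibp (fun=> 1) (fun _ _ => 0).
Proof.
split; [exact: has_moments_cst|by move=> *; exact: has_moments_cst|].
move=> L0 L k h0 hL.
transitivity (Ex P (fun x => L0 x * L x ^+ k)).
  by apply: Ex_ext => x; rewrite mulr1.
rewrite gaussian_stein//.
have -> : Ex P (fun x => 0 * L x ^+ k) = 0.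
  by transitivity (Ex P (fun=> 0)); [apply: Ex_ext => x; rewrite mul0r|exact: Exp_cst].
by rewrite add0r; congr (_ * _); apply: Ex_ext => x; rewrite mul1r.
Qed.

Lemma ibpD F DF G DG a : ibp F DF -> ibp G DG ->
  ibp (fun x => F x + a * G x) (fun L0 x => DF L0 x + a * DG L0 x).
Proof.
move=> [hF hDF eF] [hG hDG eG]; split.
- by apply: has_momentsD => //; exact: has_momentsZ.
- move=> L0 h0; apply: has_momentsD; first exact: hDF.
  by apply: has_momentsZ; exact: hDG.
move=> L0 L k h0 hL; have mL := LLm _ hL; have m0 := LLm _ h0.
have hmX (H : T -> R) j : has_moments P H -> has_moments P (fun x => H x * L x ^+ j).
  by move=> hH; apply: has_momentsM => //; exact: has_momentsX.
have lin (H1 H2 : T -> R) : has_moments P H1 -> has_moments P H2 ->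
    forall j, Ex P (fun x => (H1 x + a * H2 x) * L x ^+ j) =
    Ex P (fun x => H1 x * L x ^+ j) + a * Ex P (fun x => H2 x * L x ^+ j).
  move=> h1 h2 j.
  transitivity (Ex P (fun x => H1 x * L x ^+ j + a * (H2 x * L x ^+ j))).
    by apply: Ex_ext => x; ring.
  by rewrite ExpD ?ExpZ//; [exact: hmX|exact: hmX|apply: has_momentsZ; exact: hmX].
rewrite !lin//; [|exact: hDF|exact: hDG].
transitivity (Ex P (fun x => (L0 x * F x + a * (L0 x * G x)) * L x ^+ k)).
  by apply: Ex_ext => x; ring.
rewrite lin; [|exact: has_momentsM|exact: has_momentsM].
by rewrite eF// eG//; ring.
Qed.

(** The identity for F at L + s M is a polynomial identity in s, whose coefficient
    of degree 1 is the identity for F M at L. *)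
Lemma ibpM F DF M : ibp F DF -> LL M ->
  ibp (fun x => F x * M x) (fun L0 x => DF L0 x * M x + C L0 M * F x).
Proof.
move=> [hF hDF e] hM; have mM := LLm _ hM.
split.
- exact: has_momentsM.
- by move=> L0 h0; apply: has_momentsD; [apply: has_momentsM => //; exact: hDF|exact: has_momentsZ].
move=> L0 L k h0 hL; have mL := LLm _ hL; have m0 := LLm _ h0.
have hmX (G : T -> R) j : has_moments P G -> has_moments P (fun x => G x * L x ^+ j).
  by move=> hG; apply: has_momentsM => //; exact: has_momentsX.
have key : pol (fun x => L0 x * F x) L M k.+1 =
   pol (DF L0) L M k.+1 +
   k.+1%:R *: (((C L0 L)%:P + C L0 M *: 'X) * pol F L M k).
  apply: poly_eval_inj => s.
  rewrite hornerD hornerZ hornerM hornerD hornerC hornerZ hornerX !polE//; last 2 first.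
  - exact: hDF.
  - exact: has_momentsM.
  rewrite e//; last exact: LLlin.
  congr (_ + _); rewrite mulrA /=; congr (_ * _ * _).
  transitivity (Ex P (fun x => L0 x * L x + s * (L0 x * M x))).
    by apply: Ex_ext => x; ring.
  have hA := has_momentsM P _ _ m0 mL; have hB := has_momentsM P _ _ m0 mM.
  by rewrite ExpD// ?ExpZ//; [rewrite mulrC|exact: has_momentsZ].
have := congr1 (fun p : {poly R} => p`_1) key.
rewrite coefD coefZ coefM big_ord_recl big_ord1 /= !pol1 !coefD !coefZ.
rewrite !coefC !coefX /= pol0 mulr0 mulr1 addr0 add0r => h.
apply: (@mulfI _ k.+1%:R); first by rewrite pnatr_eq0.
transitivity (k.+1%:R * Ex P (fun x => L0 x * F x * L x ^+ k * M x)).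
  by congr (_ * _); apply: Ex_ext => x; ring.
rewrite h.
have -> : Ex P (fun x => (DF L0 x * M x + C L0 M * F x) * L x ^+ k) =
  Ex P (fun x => DF L0 x * L x ^+ k * M x) + C L0 M * Ex P (fun x => F x * L x ^+ k).
  transitivity (Ex P (fun x => DF L0 x * L x ^+ k * M x + C L0 M * (F x * L x ^+ k))).
    by apply: Ex_ext => x; ring.
  rewrite ExpD ?ExpZ//; first exact: hmX.
    by apply: has_momentsM => //; apply: hmX; exact: hDF.
  by apply: has_momentsZ; exact: hmX.
have -> : Ex P (fun x => F x * M x * L x ^+ k.-1) = Ex P (fun x => F x * L x ^+ k.-1 * M x).
  by apply: Ex_ext => x; ring.
ring.
Qed.

Lemma eq_ibp F F' DF DF' : F =1 F' -> (forall L0, LL L0 -> DF L0 =1 DF' L0) ->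
  ibp F DF -> ibp F' DF'.
Proof.
move=> /funext <- e [h1 h2 h3]; split => // [L0 h0|L0 L k h0 hL].
  by rewrite -(funext (e _ h0)); exact: h2.
by rewrite -(funext (e _ h0)); exact: h3.
Qed.

Lemma ibp_sum (I : Type) (s : seq I) (b : I -> R) F DF :
  (forall i, ibp (F i) (DF i)) ->
  ibp (fun x => \sum_(i <- s) b i * F i x)
      (fun L0 x => \sum_(i <- s) b i * DF i L0 x).
Proof.
move=> h; elim: s => [|i s ih].
  apply: eq_ibp (ibpD _ _ _ _ (-1) ibp1 ibp1) => [x|L0 _ x].
    by rewrite big_nil; ring.
  by rewrite big_nil; ring.
apply: eq_ibp (ibpD _ _ _ _ (b i) ih (h i)) => [x|L0 _ x];
  by rewrite big_cons addrC.
Qed.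

Section QuadraticForm.
Variables (I : finType) (Z : I -> T -> R) (a : I -> R).
Hypothesis LLZ : forall i, LL (Z i).

Definition cov i j : R := C (Z i) (Z j).

Definition quad x : R := \sum_i a i * (Z i x ^+ 2 - cov i i).

(** The derivative of quad in the direction L0 is twice the sum of
    a i Cov(L0, Z i) Z i. *)
Lemma quad_ibp k : ibp (fun x => quad x ^+ k)
  (fun L0 x => k%:R * quad x ^+ k.-1 * (2 * \sum_i a i * C L0 (Z i) * Z i x)).
Proof.
elim: k => [|k ih].
  by apply: eq_ibp ibp1 => [x|L0 _ x]; [rewrite expr0|rewrite !mul0r].
pose c := \sum_i a i * cov i i.
have quadE x : quad x = \sum_i a i * (Z i x * Z i x) - c.
  by rewrite /quad /c -sumrB; apply: eq_bigr => i _; ring.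
have h i := ibpM _ _ (Z i) (ibpM _ _ (Z i) ih (LLZ i)) (LLZ i).
apply: eq_ibp (ibpD _ _ _ _ (- c) (ibp_sum _ (index_enum I) a _ _ h) ih).
- move=> x; rewrite exprSr [X in _ = _ * X]quadE mulrBr mulr_sumr mulNr [c * _]mulrC.
  by congr (_ - _); apply: eq_bigr => i _; ring.
- move=> L0 h0 x /=.
  set V := \sum_i a i * C L0 (Z i) * Z i x; set K := k%:R * quad x ^+ k.-1; set q := quad x.
  transitivity (K * (2 * V) * (\sum_i a i * (Z i x * Z i x)) + q ^+ k * (2 * V) -
      c * (K * (2 * V))).
    rewrite mulNr; congr (_ - _).
    rewrite mulr_sumr [2 * V in X in _ = _ + X]mulr_sumr mulr_sumr -big_split /=.
    by apply: eq_bigr => i _; ring.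
  have -> : \sum_i a i * (Z i x * Z i x) = q + c by rewrite /q quadE subrK.
  have -> : K * (2 * V) * (q + c) + q ^+ k * (2 * V) - c * (K * (2 * V)) =
     (K * q + q ^+ k) * (2 * V) by ring.
  congr (_ * _); rewrite /K -/q; case: k {ih h V K} => [|k] /=.
    by rewrite !mul0r add0r mul1r.
  by rewrite -mulrA -exprSr -[k.+2]addn1 natrD; ring.
Qed.

Definition qform (B : I -> I -> R) x : R := \sum_i \sum_j B i j * (Z i x * Z j x).

(** Multiplication by the matrix diag(a) C, where C is the covariance matrix. *)
Definition mulg (B : I -> I -> R) i j : R := \sum_l a i * cov i l * B l j.

Lemma has_moments_quad k : has_moments P (fun x => quad x ^+ k).
Proof. by case: (quad_ibp k). Qed.

Lemma has_moments_qform B : has_moments P (qform B).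
Proof.
apply: has_moments_sum => i; apply: has_moments_sum => j.
by apply: has_momentsZ; apply: has_momentsM; exact: LLm.
Qed.

(** Integrating by parts the first factor Z i of each term of qform B leaves the
    trace of B C and, from the derivative of the power of quad, the form of the
    matrix diag(a) C B. *)
Lemma Ex_qform B k : Ex P (fun x => qform B x * quad x ^+ k) =
  (\sum_i \sum_j B i j * cov i j) * Ex P (fun x => quad x ^+ k) +
  (2 * k)%:R * Ex P (fun x => qform (mulg B) x * quad x ^+ k.-1).
Proof.
have mq := has_moments_quad.
have mZ i : has_moments P (Z i) by exact: LLm.
have mm i j n : has_moments P (fun x => Z i x * Z j x * quad x ^+ n).
  by apply: has_momentsM => //; exact: has_momentsM.
have ExB (A : I -> I -> R) n : Ex P (fun x => qform A x * quad x ^+ n) =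
    \sum_i \sum_j A i j * Ex P (fun x => Z i x * Z j x * quad x ^+ n).
  transitivity (Ex P (fun x => \sum_i \sum_j A i j * (Z i x * Z j x * quad x ^+ n))).
    apply: Ex_ext => x; rewrite /qform mulr_suml; apply: eq_bigr => i _.
    by rewrite mulr_suml; apply: eq_bigr => j _; ring.
  rewrite Exp_sum; last first.
    by move=> i; apply: has_moments_sum => j; apply: has_momentsZ.
  apply: eq_bigr => i _; rewrite Exp_sum; last by move=> j; apply: has_momentsZ.
  by apply: eq_bigr => j _; rewrite ExpZ.
have key i j : Ex P (fun x => Z i x * Z j x * quad x ^+ k) =
    cov i j * Ex P (fun x => quad x ^+ k) +
    (2 * k)%:R * \sum_l a l * cov i l * Ex P (fun x => Z l x * Z j x * quad x ^+ k.-1).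
  have [_ _ /(_ (Z i) (Z i) 0%N (LLZ i) (LLZ i))] := ibpM _ _ (Z j) (quad_ibp k) (LLZ j).
  rewrite !mul0r addr0 => h.
  transitivity (Ex P (fun x => Z i x * (quad x ^+ k * Z j x) * Z i x ^+ 0)).
    by apply: Ex_ext => x; rewrite expr0; ring.
  rewrite {}h.
  transitivity (Ex P (fun x => cov i j * quad x ^+ k +
     (2 * k)%:R * \sum_l a l * cov i l * (Z l x * Z j x * quad x ^+ k.-1))).
    apply: Ex_ext => x; rewrite expr0 mulr1 addrC; congr (_ + _).
    rewrite natrM !mulr_sumr mulr_suml; apply: eq_bigr => l _.
    by rewrite /cov; ring.
  have ms : has_moments P (fun x => \sum_l a l * cov i l * (Z l x * Z j x * quad x ^+ k.-1)).
    by apply: has_moments_sum => l; exact: has_momentsZ.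
  rewrite ExpD ?ExpZ//; try exact: has_momentsZ.
  rewrite Exp_sum; last by move=> l; exact: has_momentsZ.
  by congr (_ + _ * _); apply: eq_bigr => l _; rewrite ExpZ.
rewrite ExB [in RHS]ExB.
under eq_bigr do under eq_bigr do rewrite key mulrDr.
rewrite mulr_suml mulr_sumr.
under [X in _ = X + _]eq_bigr do rewrite mulr_suml.
under eq_bigr do rewrite big_split /=.
rewrite big_split /=; congr (_ + _).
  by apply: eq_bigr => i _; apply: eq_bigr => j _; ring.
rewrite exchange_big /=.
under [RHS]eq_bigr do rewrite mulr_sumr.
rewrite [RHS]exchange_big /=; apply: eq_bigr => j _.
transitivity (\sum_i \sum_l (2 * k)%:R * (B i j * (a l * cov i l *
   Ex P (fun x => Z l x * Z j x * quad x ^+ k.-1)))).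
  by apply: eq_bigr => i _; rewrite !mulr_sumr; apply: eq_bigr => l _; ring.
rewrite exchange_big /=; apply: eq_bigr => l _.
rewrite -mulr_sumr; congr (_ * _).
rewrite /mulg mulr_suml; apply: eq_bigr => i _.
have -> : cov l i = cov i l by apply: Ex_ext => x; rewrite mulrC.
ring.
Qed.

(** The matrix (diag(a) C) ^ m diag(a). *)
Fixpoint gform m : I -> I -> R :=
  if m is m'.+1 then mulg (gform m') else fun i j => a i * (i == j)%:R.

(** The trace of (diag(a) C) ^ m.+1. *)
Definition gtrace m : R := \sum_i \sum_j gform m i j * cov i j.

(** Joint moments of quad with the centred quadratic forms of the matrices
    gform m: [gmomS] makes them a closed system of recursions, which replaces an
    expansion into cumulants. *)
Definition gmom m k : R :=
  Ex P (fun x => (qform (gform m) x - gtrace m) * quad x ^+ k).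

Lemma qform_gform0 x : qform (gform 0) x - gtrace 0 = quad x.
Proof.
rewrite /qform /gtrace /quad -sumrB; apply: eq_bigr => i _ /=.
rewrite (bigD1 i)//= [X in _ - X](bigD1 i)//= !big1; last 2 first.
- by move=> j ji; rewrite eq_sym (negbTE ji) mulr0 mul0r.
- by move=> j ji; rewrite eq_sym (negbTE ji) mulr0 mul0r.
by rewrite eqxx /=; ring.
Qed.

Lemma gmomE m k : gmom m k =
  Ex P (fun x => qform (gform m) x * quad x ^+ k) - gtrace m * Ex P (fun x => quad x ^+ k).
Proof.
have mq := has_moments_quad k; have mf := has_moments_qform (gform m).
rewrite -(ExpZ P (gtrace m)) // -ExpB //; last 2 first.
- exact: has_momentsM.
- exact: has_momentsZ.
by apply: Ex_ext => x; ring.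
Qed.

Lemma gmom0 m : gmom m 0 = 0.
Proof. by rewrite gmomE Ex_qform muln0 mul0r addr0 -/(gtrace m) subrr. Qed.

Lemma gmomS m k : gmom m k.+1 =
  (2 * k.+1)%:R * (gmom m.+1 k + gtrace m.+1 * Ex P (fun x => quad x ^+ k)).
Proof.
rewrite gmomE Ex_qform -/(gtrace m) addrAC subrr add0r /= gmomE.
by rewrite -/(gform m.+1); ring.
Qed.

Lemma Ex_quad0 : Ex P (fun x => quad x ^+ 0) = 1.
Proof. by under eq_Rintegral do rewrite expr0; exact: Exp_cst. Qed.

Lemma Ex_quadS k : Ex P (fun x => quad x ^+ k.+1) = gmom 0 k.
Proof. by apply: Ex_ext => x; rewrite qform_gform0 exprS. Qed.

End QuadraticForm.
End GaussianIBP.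

(** The moments of the centred normal law of variance v. *)
Fixpoint nmoment {R : realType} (v : R) (k : nat) : R :=
  if k is k'.+1 then
    if k' is k''.+1 then k'%:R * v * nmoment v k'' else 0
  else 1.

Lemma nmomentS {R : realType} (v : R) (k : nat) : nmoment v k.+1 = k%:R * v * nmoment v k.-1.
Proof. by case: k => [|k] /=; rewrite ?mul0r. Qed.

(** When the traces of order at least 3 vanish in the limit, so do the mixed moments
    M n m.+1, and the recursion for the moments becomes the one of the normal law:
    2 (k + 1) (v / 2) = (k + 1) v. The index of tau is the order of the trace
    minus 1. *)
Lemma cvg_moments {R : realType} (v : R) (mom : nat -> nat -> R)
    (M : nat -> nat -> nat -> R) (tau : nat -> nat -> R) :
  (forall n m, M n m 0 = 0) ->
  (forall n m k, M n m k.+1 = (2 * k.+1)%:R * (M n m.+1 k + tau n m.+1 * mom n k)) ->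
  (forall n, mom n 0 = 1) -> (forall n k, mom n k.+1 = M n 0 k) ->
  tau ^~ 1 @ \oo --> v / 2 -> (forall m, tau ^~ m.+2 @ \oo --> (0 : R)) ->
  forall k, mom ^~ k @ \oo --> nmoment v k.
Proof.
move=> M0 MS mom0 momS t1 t2.
suff H k : mom ^~ k @ \oo --> nmoment v k /\
    (forall m, (fun n => M n m.+1 k) @ \oo --> (0 : R)).
  by move=> k; have [] := H k.
elim/ltn_ind: k => k IH.
have step (m j : nat) (t : R) : (j < k)%N -> tau ^~ m.+1 @ \oo --> t ->
    (fun n => M n m j.+1) @ \oo --> (2 * j.+1)%:R * (0 + t * nmoment v j).
  move=> jk ht; under eq_fun do rewrite MS.
  apply: cvgM; first exact: cvg_cst.
  have [h1 h2] := IH j jk.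
  by apply: (@cvgD _ R^o); [exact: h2|exact: (cvgM ht h1)].
split.
- case: k IH step => [|[|k]] IH step.
  + by under eq_fun do rewrite mom0; exact: cvg_cst.
  + by under eq_fun do rewrite momS M0; exact: cvg_cst.
  + under eq_fun do rewrite momS.
    have -> : nmoment v k.+2 = (2 * k.+1)%:R * (0 + v / 2 * nmoment v k).
      by rewrite /= natrM; field.
    exact: (step 0%N k (v / 2) (ltnW (ltnSn _)) t1).
- move=> m; case: k IH step => [|k] IH step.
    by under eq_fun do rewrite M0; exact: cvg_cst.
  have := step m.+1 k 0 (ltnSn _) (t2 m).
  by rewrite mul0r addr0 mulr0.
Qed.

(** * Bounds on traces *)

Lemma sum_sqr_ge0 {R : realDomainType} (I : Type) (s : seq I) (F : I -> R) :
  0 <= \sum_(i <- s) F i ^+ 2.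
Proof. by apply: sumr_ge0 => i _; exact: sqr_ge0. Qed.

Lemma cauchy_schwarz_sum {R : realDomainType} (I : Type) (s : seq I) (f g : I -> R) :
  (\sum_(i <- s) f i * g i) ^+ 2 <= (\sum_(i <- s) f i ^+ 2) * (\sum_(i <- s) g i ^+ 2).
Proof.
elim: s => [|i s ih]; first by rewrite !big_nil expr0n mulr0.
rewrite !big_cons.
have a0 := sum_sqr_ge0 I s f; have b0 := sum_sqr_ge0 I s g.
move: (\sum_(i <- s) f i ^+ 2) (\sum_(i <- s) g i ^+ 2) (\sum_(i <- s) f i * g i) ih a0 b0.
move=> A B c h a0 b0.
suff : 2 * (f i * g i) * c <= f i ^+ 2 * B + A * g i ^+ 2.
  by rewrite !expr2 in h *; move=> hh; nra.
have key : (2 * (f i * g i) * c) ^+ 2 <= (f i ^+ 2 * B + A * g i ^+ 2) ^+ 2.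
  have -> : (2 * (f i * g i) * c) ^+ 2 = 4 * (f i * g i) ^+ 2 * c ^+ 2 by ring.
  apply: (@le_trans _ _ (4 * (f i * g i) ^+ 2 * (A * B))).
    by rewrite ler_wpM2l// mulr_ge0// sqr_ge0.
  rewrite -subr_ge0; have -> : (f i ^+ 2 * B + A * g i ^+ 2) ^+ 2 - 4 * (f i * g i) ^+ 2 * (A * B) =
    (f i ^+ 2 * B - A * g i ^+ 2) ^+ 2 by ring.
  exact: sqr_ge0.
have h0 : 0 <= f i ^+ 2 * B + A * g i ^+ 2 by rewrite addr_ge0// mulr_ge0// sqr_ge0.
by rewrite (le_trans (ler_norm _))// -(ger0_norm h0) -ler_sqr ?nnegrE// !real_normK ?num_real.
Qed.

Section TraceBound.
Context {R : realType} {d : measure_display} {T : measurableType d}.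
Variables (P : probability T R) (I : finType) (Z : I -> T -> R) (a : I -> R) (al : R).
Hypothesis a_le : forall i, `|a i| <= al.

Local Notation C := (cov P I Z).
Local Notation B := (gform P I Z a).

Let fro (A : I -> I -> R) := \sum_i \sum_j A i j ^+ 2.

Let fro_ge0 A : 0 <= fro A.
Proof. by apply: sumr_ge0 => i _; exact: sum_sqr_ge0. Qed.

Let fro_mul (A D : I -> I -> R) : fro (fun i j => \sum_l A i l * D l j) <= fro A * fro D.
Proof.
rewrite /fro mulr_suml; apply: ler_sum => i _.
rewrite [X in _ * X]exchange_big mulr_sumr; apply: ler_sum => j _.
exact: cauchy_schwarz_sum.
Qed.

Let al0 i : a i ^+ 2 <= al ^+ 2.
Proof.
rewrite -(real_normK (num_real (a i))) ler_sqr ?nnegrE//.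
exact: le_trans (normr_ge0 _) (a_le i).
Qed.

Let fro_gform m : fro (B m.+1) <= (al ^+ 2 * fro C) ^+ m.+1 * al ^+ 2.
Proof.
have hg : fro (fun i l => a i * C i l) <= al ^+ 2 * fro C.
  rewrite /fro mulr_sumr; apply: ler_sum => i _; rewrite mulr_sumr.
  by apply: ler_sum => j _; rewrite exprMn ler_wpM2r// sqr_ge0.
elim: m => [|m ih].
  rewrite expr1 mulrAC -mulrA; apply: (@le_trans _ _ (\sum_i \sum_j al ^+ 2 * (al ^+ 2 * C i j ^+ 2))).
    apply: ler_sum => i _; apply: ler_sum => j _.
    rewrite /= /mulg (bigD1 j)//= big1; last by move=> l /negbTE lj; rewrite lj !mulr0.
    rewrite eqxx mulr1 addr0 mulrAC 2!exprMn mulrA.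
    by rewrite ler_wpM2r ?sqr_ge0// ler_pM ?sqr_ge0.
  rewrite /fro !mulr_sumr; apply: ler_sum => i _; rewrite !mulr_sumr.
  by apply: ler_sum => j _; rewrite mulrA.
apply: (le_trans (fro_mul (fun i l => a i * C i l) (B m.+1))).
by rewrite exprS -mulrA ler_pM.
Qed.

(** With G = diag(a) C, the trace of G ^ (m + 3) is the inner product of
    G ^ (m + 1) diag(a) with C diag(a) C, up to transposition, and is at most the
    product of their Frobenius norms; that norm is submultiplicative. When
    al is of order 1 / n, the first factor stays bounded and the second one tends
    to 0, see [cvg_gtrace2]. *)
Lemma gtrace_bound m : gtrace P I Z a m.+2 ^+ 2 <=
  (al ^+ 2 * \sum_i \sum_j C i j ^+ 2) ^+ m.+1 *
  (al ^+ 4 * \sum_j \sum_l (\sum_i `|C i j| * `|C i l|) ^+ 2).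
Proof.
pose D j l := \sum_i C i j * (a i * C i l).
have -> : gtrace P I Z a m.+2 = \sum_(p : I * I) B m.+1 p.1 p.2 * D p.2 p.1.
  rewrite /gtrace -(pair_bigA _ (fun l j => B m.+1 l j * D j l)) /=.
  transitivity (\sum_i \sum_j \sum_l a i * C i l * B m.+1 l j * C i j).
    by apply: eq_bigr => i _; apply: eq_bigr => j _; rewrite -mulr_suml.
  rewrite exchange_big [RHS]exchange_big /=; apply: eq_bigr => j _.
  rewrite exchange_big /=; apply: eq_bigr => l _.
  by rewrite /D mulr_sumr; apply: eq_bigr => i _; ring.
apply: (le_trans (cauchy_schwarz_sum _ _ _ _)).
rewrite -(pair_bigA _ (fun l j => B m.+1 l j ^+ 2)) -(pair_bigA _ (fun l j => D j l ^+ 2)) /=.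
have hD : \sum_l \sum_j D j l ^+ 2 <=
    al ^+ 2 * \sum_j \sum_l (\sum_i `|C i j| * `|C i l|) ^+ 2.
  rewrite exchange_big mulr_sumr; apply: ler_sum => j _; rewrite mulr_sumr.
  apply: ler_sum => l _; rewrite -exprMn -[X in X <= _](real_normK (num_real _)).
  have al_ge0 : 0 <= al by apply: le_trans (a_le j).
  have s0 : 0 <= \sum_i `|C i j| * `|C i l|.
    by apply: sumr_ge0 => i _; rewrite mulr_ge0.
  rewrite ler_sqr ?nnegrE ?mulr_ge0//.
  apply: (le_trans (ler_norm_sum _ _ _)).
  rewrite mulr_sumr; apply: ler_sum => i _; rewrite !normrM mulrCA.
  by rewrite ler_wpM2r// mulr_ge0.
apply: (le_trans (ler_pM _ _ (fro_gform m) hD)).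
- exact: fro_ge0.
- by rewrite exchange_big; exact: fro_ge0.
by rewrite le_eqVlt; apply/orP; left; apply/eqP; rewrite -/(fro C); ring.
Qed.

Lemma gtrace1E : gtrace P I Z a 1 = \sum_i \sum_j a i * a j * C i j ^+ 2.
Proof.
apply: eq_bigr => i _; apply: eq_bigr => j _.
rewrite /= /mulg (bigD1 j)//= big1; last by move=> l /negbTE lj; rewrite lj !mulr0.
by rewrite eqxx mulr1 addr0; ring.
Qed.

End TraceBound.

(** * Sums over the lattice *)

Lemma cvg_eps {R : realType} (u : nat -> R) (l : R) :
  (forall e : R, 0 < e -> \forall n \near \oo, `|l - u n| <= e) -> u @ \oo --> l.
Proof. by move=> h; apply/cvgrPdist_le => e e0; exact: h. Qed.

Section Lattice.
Implicit Types (n M : nat) (h x : int * int).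

Definition cube n : seq (int * int) :=
  [seq (Posz i, Posz j) | i <- iota 0 n, j <- iota 0 n].

Lemma mem_cube n h :
  (h \in cube n) = [&& 0 <= h.1, h.1 < n%:Z, 0 <= h.2 & h.2 < n%:Z].
Proof.
apply/idP/idP.
  case/allpairsP => -[i j] /=; rewrite !mem_iota !add0n => -[/andP[_ ni] /andP[_ nj] ->] /=.
  by rewrite !ltz_nat ni nj.
case: h => -[] // i [] // j /=; rewrite ?ltz_nat => //; last by rewrite !andbF.
move=> /andP[ni nj].
by apply/allpairsP; exists (i, j); rewrite !mem_iota !add0n.
Qed.

Lemma uniq_cube n : uniq (cube n).
Proof. by apply: allpairs_uniq; rewrite ?iota_uniq// => -[i j] [i' j'] _ _ [-> ->]. Qed.

Lemma size_cube n : size (cube n) = (n * n)%N.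
Proof. by rewrite size_allpairs size_iota. Qed.

(** Sums over sites become sums over lists of integer vectors, which can be
    translated and compared by inclusion. *)
Lemma sum_Lambda {V : nmodType} (k : nat) (F : int * int -> V) :
  \sum_(t : Lambda k) F (Posz t.1, Posz t.2) = \sum_(h <- cube k) F h.
Proof.
rewrite -(pair_bigA _ (fun i j : 'I_k => F (Posz i, Posz j))) /= /cube big_allpairs_dep /=.
rewrite -(big_mkord xpredT (fun i => \sum_(j < k) F (Posz i, Posz j))) /index_iota subn0.
apply: eq_bigr => i _.
by rewrite -(big_mkord xpredT (fun j => F (Posz i, Posz j))) /index_iota subn0.
Qed.

Definition box M : seq (int * int) :=
  [seq h - (M%:Z, M%:Z) | h <- cube M.*2.+1].

Lemma mem_box M h : (h \in box M) = (`|h.1| <= M%:Z) && (`|h.2| <= M%:Z).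
Proof.
transitivity (h + (M%:Z, M%:Z) \in cube M.*2.+1); last first.
  by rewrite mem_cube; case: h => a b /=; lia.
apply/mapP/idP => [[x xc ->]|hc]; first by rewrite subrK.
by exists (h + (M%:Z, M%:Z)); rewrite ?addrK.
Qed.

Lemma uniq_box M : uniq (box M).
Proof. by rewrite map_inj_uniq ?uniq_cube//; exact: addIr. Qed.

Lemma size_box M : size (box M) = (M.*2.+1 * M.*2.+1)%N.
Proof. by rewrite size_map size_cube. Qed.

Lemma sub_box (s : seq (int * int)) : exists M, {subset s <= box M}.
Proof.
elim: s => [|h s [M hM]]; first by exists 0%N.
exists (M + `|h.1| + `|h.2|)%N => x; rewrite inE => /orP[/eqP ->|/hM].
  by rewrite mem_box; case: h => a b /=; lia.
by rewrite !mem_box; case: h => a b /=; lia.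
Qed.

Context {R : realType}.

Lemma sum_cst_seq (I : Type) (s : seq I) (Q : pred I) (K : R) :
  \sum_(i <- s | Q i) K = (size [seq i <- s | Q i])%:R * K.
Proof. by rewrite big_const_seq iter_addr_0 -size_filter mulr_natl. Qed.

Lemma sum_subset (s1 s2 : seq (int * int)) (A : int * int -> R) :
  (forall h, 0 <= A h) -> uniq s1 -> {subset s1 <= s2} ->
  \sum_(h <- s1) A h <= \sum_(h <- s2) A h.
Proof.
move=> A0 u1 s12.
have -> : \sum_(h <- s1) A h = \sum_(h <- undup s2 | h \in s1) A h.
  rewrite -[RHS]big_filter; apply: perm_big; apply: uniq_perm => //.
    by rewrite filter_uniq ?undup_uniq.
  by move=> h; rewrite mem_filter mem_undup; case: (boolP (h \in s1)) => // /s12 ->.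
apply: (@le_trans _ _ (\sum_(h <- undup s2) A h)).
  by rewrite [X in _ <= X](bigID (fun h => h \in s1)) /= lerDl sumr_ge0.
elim: s2 {s12} => [|x s2 ih]; first by rewrite /= big_nil.
rewrite /= big_cons; case: ifP => _; first by rewrite (le_trans ih)// lerDr.
by rewrite big_cons lerD.
Qed.

Section Summable.
Variables (A : int * int -> R) (K : R).
Hypotheses (A0 : forall h, 0 <= A h) (AK : forall M, \sum_(h <- box M) A h <= K).

Let bs M := \sum_(h <- box M) A h.

(** The limit of the sums over boxes, meaningful for nonnegative functions with
    bounded box sums. *)
Definition lattice_sum : R := limn bs.

Let nd_bs : nondecreasing_seq bs.
Proof.
apply/nondecreasing_seqP => M; apply: sum_subset => //; first exact: uniq_box.
by move=> h; rewrite !mem_box; lia.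
Qed.

Lemma cvg_lattice_sum : bs @ \oo --> lattice_sum.
Proof.
apply: nondecreasing_is_cvgn => //; exists K => _ [M _ <-]; exact: AK.
Qed.

Lemma sum_le_lattice_sum (s : seq (int * int)) : uniq s ->
  \sum_(h <- s) A h <= lattice_sum.
Proof.
move=> us; have [M sM] := sub_box s.
apply: (@le_trans _ _ (bs M)); first exact: sum_subset.
apply: nondecreasing_cvgn_le => //; apply/cvg_ex; exists lattice_sum.
exact: cvg_lattice_sum.
Qed.

Lemma lattice_sum_ge0 : 0 <= lattice_sum.
Proof. by have := sum_le_lattice_sum [::] isT; rewrite big_nil. Qed.

Lemma lattice_sum_box (e : R) : 0 < e -> exists M, lattice_sum - e <= \sum_(h <- box M) A h.
Proof.
move=> e0; have /cvgrPdist_le/(_ _ e0) [M _ /(_ M (leqnn M))] := cvg_lattice_sum.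
by move=> /= h; exists M; have := le_trans (ler_norm _) h; rewrite -/(bs M); lra.
Qed.

Lemma lattice_sum_tail (e : R) : 0 < e -> exists M, forall s : seq (int * int),
  uniq s -> (forall h, h \in s -> h \notin box M) -> \sum_(h <- s) A h <= e.
Proof.
move=> e0; have [M hM] := lattice_sum_box e e0; exists M => s us sM.
have := sum_le_lattice_sum (box M ++ s).
rewrite cat_uniq uniq_box us andbT big_cat /= => h.
suff /h : ~~ has (in_mem^~ (mem (box M))) s by lra.
by apply/hasPn => x /sM.
Qed.

(** A translated box contains any fixed box, once large enough. *)
Lemma cvg_shift_lattice_sum x :
  (fun M => \sum_(h <- box M) A (h + x)) @ \oo --> lattice_sum.
Proof.
have ushift M : uniq [seq h + x | h <- box M].
  by rewrite map_inj_uniq ?uniq_box//; exact: addIr.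
apply: cvg_eps => e e0; have [M0 hM0] := lattice_sum_box e e0.
near=> M.
have hu := sum_le_lattice_sum _ (ushift M); rewrite big_map in hu.
suff : \sum_(h <- box M0) A h <= \sum_(h <- [seq h + x | h <- box M]) A h.
  by rewrite [X in _ <= X -> _]big_map => hl; rewrite ger0_norm; lra.
apply: sum_subset => //; first exact: uniq_box.
move=> h hM; apply/mapP; exists (h - x); last by rewrite subrK.
have hc : (M0 + `|x.1| + `|x.2| <= M)%N by near: M; exact: nbhs_infty_ge.
move: hM hc; rewrite !mem_box /=.
by move: (h.1) (h.2) (x.1) (x.2) => a b a' b'; lia.
Unshelve. all: by end_near. Qed.

End Summable.

Lemma cvg_ratio (k : nat) : (n - k)%:R / n%:R @[n --> \oo] --> (1 : R).
Proof.
have h : (fun n => 1 - k%:R * (n%:R : R)^-1) @ \oo --> (1 : R).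
  rewrite -[X in _ --> X](subr0 (1 : R)); apply: (@cvgB _ R^o); first exact: cvg_cst.
  rewrite -(mulr0 (k%:R : R)); apply: cvgM; first exact: cvg_cst.
  apply/gtr0_cvgV0; last exact: cvgr_idn.
  by near=> n; rewrite ltr0n; near: n; exact: nbhs_infty_gt.
apply: cvg_trans h; apply: near_eq_cvg; near=> n.
have kn : (k <= n)%N by near: n; exact: nbhs_infty_ge.
have n0 : (0 < n)%N by near: n; exact: nbhs_infty_gt.
by rewrite natrB// mulrBl divff// pnatr_eq0 -lt0n.
Unshelve. all: by end_near. Qed.

(** The sum over s is at most the sum over the lattice. Conversely, when t is at
    distance at least M from the boundary of both squares, the differences s - t
    cover the box of radius M, and the proportion of such t tends to 1. *)
Lemma cesaro_lattice (A : int * int -> R) (K : R) (p q : nat) :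
  (forall h, 0 <= A h) -> (forall M, \sum_(h <- box M) A h <= K) ->
  (n%:R ^+ 2)^-1 * (\sum_(t <- cube (n - p)) \sum_(s <- cube (n - q)) A (s - t))
    @[n --> \oo] --> lattice_sum A.
Proof.
move=> A0 AK; set L := lattice_sum A.
have L0 : 0 <= L by exact: lattice_sum_ge0 A K A0 AK.
have inner t (s : seq (int * int)) : uniq s -> \sum_(h <- s) A (h - t) <= L.
  move=> us; rewrite -(big_map (fun h => h - t) xpredT A).
  apply: sum_le_lattice_sum A0 AK _ _.
  by rewrite map_inj_uniq//; exact: addIr.
have upper n : (n%:R ^+ 2)^-1 * (\sum_(t <- cube (n - p)) \sum_(s <- cube (n - q)) A (s - t)) <= L.
  case: n => [|n]; first by rewrite expr0n invr0 mul0r.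
  rewrite ler_pdivrMl; last by rewrite exprn_gt0// ltr0n.
  apply: (@le_trans _ _ (\sum_(t <- cube (n.+1 - p)) L)).
    by apply: ler_sum => t _; apply: inner; exact: uniq_cube.
  rewrite sum_cst_seq filter_predT size_cube.
  by rewrite ler_wpM2r// -natrX ler_nat expnS expn1 leq_mul// leq_subr.
have lower M n : (((n - (p + q + M.*2))%:R / n%:R) ^+ 2) * \sum_(h <- box M) A h <=
    (n%:R ^+ 2)^-1 * (\sum_(t <- cube (n - p)) \sum_(s <- cube (n - q)) A (s - t)).
  rewrite exprMn exprVn [_ * _^-1]mulrC -mulrA ler_wpM2l// ?invr_ge0 ?exprn_ge0//.
  set m := (n - _)%N.
  pose s := [seq h + (M%:Z, M%:Z) | h <- cube m].
  have us : uniq s by rewrite map_inj_uniq ?uniq_cube//; exact: addIr.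
  have hs h : h \in s -> [&& M%:Z <= h.1, h.1 < M%:Z + m%:Z, M%:Z <= h.2 & h.2 < M%:Z + m%:Z].
    by case/mapP => x; rewrite mem_cube => + -> /=; case: x => a b /=; lia.
  apply: (@le_trans _ _ (\sum_(t <- s) \sum_(s <- cube (n - q)) A (s - t))); last first.
    apply: sum_subset => //; first by move=> t; apply: sumr_ge0.
    by move=> h /hs; rewrite mem_cube /m; case: h => a b /=; lia.
  have -> : m%:R ^+ 2 * \sum_(h <- box M) A h = \sum_(t <- s) \sum_(h <- box M) A h.
    by rewrite sum_cst_seq filter_predT size_map size_cube natrM expr2.
  rewrite big_seq [X in _ <= X]big_seq; apply: ler_sum => t /hs ht.
  rewrite -(big_map (fun h => h - t) xpredT A); apply: sum_subset => //; first exact: uniq_box.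
  move=> h hM; apply/mapP; exists (h + t); last by rewrite addrK.
  move: hM ht; rewrite mem_box mem_cube /m; case: h => a b; case: t => a' b' /=; lia.
apply: cvg_eps => e e0.
have e20 : 0 < e / 2 by rewrite divr_gt0.
have [M hM] := lattice_sum_box A K A0 AK (e / 2) e20.
have hlow : (fun n => ((n - (p + q + M.*2))%:R / n%:R) ^+ 2 * \sum_(h <- box M) A h) @ \oo
    --> (1 : R) ^+ 2 * \sum_(h <- box M) A h.
  apply: cvgM; last exact: cvg_cst.
  by apply: (@cvg_comp _ _ _ _ (fun x : R => x ^+ 2) _ _ _ (cvg_ratio _)); exact: exprn_continuous.
have hlt : L - e < (1 : R) ^+ 2 * \sum_(h <- box M) A h by rewrite expr1n mul1r; move: hM; rewrite -/L; lra.
near=> n.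
have h1 : L - e <= ((n - (p + q + M.*2))%:R / n%:R) ^+ 2 * \sum_(h <- box M) A h.
  by near: n; exact: cvgr_ge hlow _ hlt.
have := le_trans h1 (lower M n); have := upper n.
by rewrite ger0_norm ?subr_ge0//; lra.
Unshelve. all: by end_near. Qed.

(** The inner sum is a truncated autocorrelation of k at l - j. By Cauchy-Schwarz
    it is bounded, and it is small when l - j is outside of a large box: every i is
    then far from j or far from l. Only a bounded number of l is close to a given
    j, so the small terms dominate. *)
Lemma cvg_trace_lattice (k : int * int -> R) (K : R) :
  (forall h, 0 <= k h) -> (forall M, \sum_(h <- box M) k h ^+ 2 <= K) ->
  (n%:R ^+ 4)^-1 * (\sum_(j <- cube n) \sum_(l <- cube n)
     (\sum_(i <- cube n) k (i - j) * k (i - l)) ^+ 2) @[n --> \oo] --> (0 : R).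
Proof.
move=> k0 kK.
have K0 : 0 <= K by apply: le_trans (kK 0%N); exact: sum_sqr_ge0.
have kk h : 0 <= k h ^+ 2 by exact: sqr_ge0.
have tot (s : seq (int * int)) : uniq s -> \sum_(h <- s) k h ^+ 2 <= K.
  move=> us; have [M sM] := sub_box s.
  by apply: le_trans (kK M); exact: sum_subset.
have shift (s : seq (int * int)) j : uniq s -> uniq [seq i - j | i <- s].
  by move=> us; rewrite map_inj_uniq//; exact: addIr.
have cs (s : seq (int * int)) (j l : int * int) (e1 e2 : R) :
   \sum_(i <- s) k (i - j) ^+ 2 <= e1 -> \sum_(i <- s) k (i - l) ^+ 2 <= e2 ->
   (\sum_(i <- s) k (i - j) * k (i - l)) ^+ 2 <= e1 * e2.
  move=> h1 h2; apply: (le_trans (cauchy_schwarz_sum _ _ _ _)).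
  by apply: ler_pM => //; apply: sumr_ge0.
have csK (s : seq (int * int)) (j : int * int) : uniq s -> \sum_(i <- s) k (i - j) ^+ 2 <= K.
  move=> us; rewrite -(big_map (fun i => i - j) xpredT (fun i => k i ^+ 2)).
  by apply: tot; exact: shift.
apply: cvg_eps => e e0.
pose e1 := e / (8 * (K + 1)).
have e10 : 0 < e1 by rewrite divr_gt0// mulr_gt0//; lra.
have [M hM] := lattice_sum_tail _ K kk kK e1 e10.
pose G n (j l : int * int) := \sum_(i <- cube n) k (i - j) * k (i - l).
have near_diag n (j l : int * int) : G n j l ^+ 2 <= K ^+ 2.
  by rewrite [K ^+ 2]expr2; apply: cs => //; apply: csK; exact: uniq_cube.
have far n (j l : int * int) : l - j \notin box M.*2 -> G n j l ^+ 2 <= 4 * (e1 * K).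
  move=> far; rewrite /G (bigID (fun i => i - j \in box M)) /=.
  rewrite -[X in (X + _) ^+ 2]big_filter -[X in (_ + X) ^+ 2]big_filter.
  set s1 := seq.filter _ _; set s2 := seq.filter _ _.
  have u1 : uniq s1 by rewrite filter_uniq ?uniq_cube.
  have u2 : uniq s2 by rewrite filter_uniq ?uniq_cube.
  have H2 : (\sum_(i <- s2) k (i - j) * k (i - l)) ^+ 2 <= e1 * K.
    apply: cs => //; last exact: csK.
    rewrite -(big_map (fun i => i - j) xpredT (fun i => k i ^+ 2)).
    by apply: hM; [exact: shift|move=> h /mapP[i]; rewrite mem_filter => /andP[+ _] ->].
  have H1 : (\sum_(i <- s1) k (i - j) * k (i - l)) ^+ 2 <= e1 * K.
    rewrite mulrC; apply: cs => //; first exact: csK.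
    rewrite -(big_map (fun i => i - l) xpredT (fun i => k i ^+ 2)).
    apply: hM; first exact: shift.
    move=> h /mapP[i]; rewrite mem_filter => /andP[+ _] ->.
    move: far; rewrite !mem_box /=.
    by move: (i.1) (i.2) (j.1) (j.2) (l.1) (l.2) => ? ? ? ? ? ?; lia.
  move: H1 H2; set x := \sum_(i <- s1) _; set y := \sum_(i <- s2) _.
  by have := sqr_ge0 (x - y); rewrite !expr2; lra.
have bound n : (0 < n)%N -> \sum_(j <- cube n) \sum_(l <- cube n) G n j l ^+ 2 <=
   n%:R ^+ 4 * (4 * (e1 * K)) + n%:R ^+ 2 * ((M.*2.*2.+1 * M.*2.*2.+1)%:R * K ^+ 2).
  move=> n0.
  apply: (@le_trans _ _ (\sum_(j <- cube n) (n%:R ^+ 2 * (4 * (e1 * K)) +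
       (M.*2.*2.+1 * M.*2.*2.+1)%:R * K ^+ 2))); last first.
    rewrite sum_cst_seq filter_predT size_cube natrM.
    by rewrite le_eqVlt; apply/orP; left; apply/eqP; ring.
  apply: ler_sum => j _; rewrite (bigID (fun l => l - j \in box M.*2)) /= addrC lerD//.
    apply: (@le_trans _ _ (\sum_(l <- cube n) (4 * (e1 * K)))).
      rewrite [X in _ <= X](bigID (fun l => l - j \notin box M.*2)) /=.
      rewrite -[X in X <= _]addr0 lerD//; first by apply: ler_sum => l; exact: far.
      by apply: sumr_ge0 => *; rewrite mulr_ge0// mulr_ge0// ltW.
    by rewrite sum_cst_seq filter_predT size_cube natrM expr2.
  apply: (@le_trans _ _ (\sum_(l <- cube n | l - j \in box M.*2) K ^+ 2)).
    by apply: ler_sum => l _; exact: near_diag.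
  rewrite sum_cst_seq ler_wpM2r ?sqr_ge0// ler_nat.
  rewrite -size_box -(size_map (fun l => l - j)).
  apply: uniq_leq_size; first by rewrite shift// filter_uniq ?uniq_cube.
  by move=> h /mapP[l]; rewrite mem_filter => /andP[+ _] ->.
have h0 : (fun n => ((M.*2.*2.+1 * M.*2.*2.+1)%:R * K ^+ 2) * (n%:R ^+ 2)^-1) @ \oo --> (0 : R).
  rewrite -[X in _ --> X](mulr0 ((M.*2.*2.+1 * M.*2.*2.+1)%:R * K ^+ 2)).
  apply: cvgM; first exact: cvg_cst.
  have hV : (n%:R : R)^-1 @[n --> \oo] --> (0 : R).
    apply/gtr0_cvgV0; last exact: cvgr_idn.
    by near=> n; rewrite ltr0n; near: n; exact: nbhs_infty_gt.
  under eq_fun do rewrite expr2 invfM.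
  by rewrite -(mulr0 (0 : R)); exact: (cvgM hV hV).
have e20 : 0 < e / 2 by rewrite divr_gt0.
near=> n.
have n0 : (0 < n)%N by near: n; exact: nbhs_infty_gt.
have h1 : ((M.*2.*2.+1 * M.*2.*2.+1)%:R * K ^+ 2) * (n%:R ^+ 2)^-1 <= e / 2.
  by near: n; exact: cvgr_le h0 _ e20.
rewrite sub0r normrN ger0_norm; last first.
  rewrite mulr_ge0 ?invr_ge0 ?exprn_ge0//.
  by apply: sumr_ge0 => j _; exact: sum_sqr_ge0.
rewrite ler_pdivrMl ?exprn_gt0 ?ltr0n//; apply: (le_trans (bound n n0)).
have np : 0 < (n%:R : R) by rewrite ltr0n.
have hA : 4 * (e1 * K) <= e / 2.
  rewrite /e1; have -> : 4 * (e / (8 * (K + 1)) * K) = e / 2 * (K / (K + 1)).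
    by field; rewrite gt_eqF//; lra.
  have hK : K / (K + 1) <= 1 by rewrite ler_pdivrMr; lra.
  by apply: ler_piMr => //; exact: ltW.
apply: (@le_trans _ _ (n%:R ^+ 4 * (e / 2) + n%:R ^+ 4 * (e / 2))); last by lra.
apply: lerD; first by rewrite ler_wpM2l// exprn_ge0.
have -> : n%:R ^+ 2 * ((M.*2.*2.+1 * M.*2.*2.+1)%:R * K ^+ 2) =
   n%:R ^+ 4 * ((M.*2.*2.+1 * M.*2.*2.+1)%:R * K ^+ 2 * (n%:R ^+ 2)^-1).
  by field; rewrite gt_eqF.
by rewrite ler_wpM2l// exprn_ge0.
Unshelve. all: by end_near. Qed.

End Lattice.

(** * Bernstein and trigonometric polynomials *)

Section UniformContinuity.
Context {R : realType}.
Implicit Types (F : R * R -> R) (a b : R).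

(** The second point may lie outside of the square. *)
Lemma unif_cont_square F a b : continuous F ->
  forall e : R, 0 < e -> exists2 de : R, 0 < de &
    forall x y x' y', a <= x <= b -> a <= y <= b ->
      `|x - x'| < de -> `|y - y'| < de -> `|F (x, y) - F (x', y')| <= e.
Proof.
move=> cF e e0.
have cK : compact (`[a, b]%classic `*` `[a, b]%classic : set (R * R)).
  by apply: compact_setX; exact: segment_compact.
have e20 : 0 < e / 2 by rewrite divr_gt0.
pose P (de : R) (z : R * R) := forall z' : R * R,
  `|z.1 - z'.1| < de -> `|z.2 - z'.2| < de -> `|F z - F z'| <= e.
have : \forall de \near 0^'+, `[a, b]%classic `*` `[a, b]%classic `<=` P de.
  move/compact_near_coveringP : cK; apply => z _.
  have /cvgrPdist_le/(_ _ e20)/nbhs_ballP[r /= r0 hr] := cF z.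
  exists (ball z (r / 2), [set de | de < r / 2]).
    split; first by apply: nbhsx_ballx; rewrite divr_gt0.
    by apply: nbhs_right_lt; rewrite divr_gt0.
  move=> [w de] [/= [bw1 bw2] der] z' h1 h2.
  have zw : `|F z - F w| <= e / 2.
    apply: hr; split; apply: (@le_ball _ _ _ (r / 2)) => //; lra.
  have zz' : `|F z - F z'| <= e / 2.
    apply: hr; split.
      rewrite /ball/= in bw1 *; rewrite -[_ - _](subrKA w.1).
      by apply: (le_lt_trans (ler_normD _ _)); move: bw1 h1 der => /=; lra.
    rewrite /ball/= in bw2 *; rewrite -[_ - _](subrKA w.2).
    by apply: (le_lt_trans (ler_normD _ _)); move: bw2 h2 der => /=; lra.
  rewrite -[_ - _](subrKA (F z)); apply: (le_trans (ler_normD _ _)).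
  by rewrite distrC; lra.
move=> h; have [de [d0 hd]] : exists de : R, 0 < de /\
    `[a, b]%classic `*` `[a, b]%classic `<=` P de.
  near (0 : R)^'+ => de; exists de; split => //.
  by near: de; exact: h.
exists de => // x y x' y' hx hy h1 h2.
by apply: (hd (x, y)) => //; split => /=; rewrite in_itv.
Unshelve. all: by end_near. Qed.

Lemma bounded_square F a b : continuous F ->
  exists M : R, forall x y, a <= x <= b -> a <= y <= b -> `|F (x, y)| <= M.
Proof.
move=> cF.
have cK : compact (`[a, b]%classic `*` `[a, b]%classic : set (R * R)).
  by apply: compact_setX; exact: segment_compact.
have : compact (F @` (`[a, b]%classic `*` `[a, b]%classic)).
  by apply: continuous_compact => //; exact: continuous_subspaceT.
move/compact_bounded => [M [_ hM]]; exists (M + 1) => x y hx hy.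
apply: (hM (M + 1)); first by rewrite ltrDl.
by exists (x, y) => //; split => /=; rewrite in_itv.
Qed.

(** Uniform continuity for close points, boundedness for the others. In this
    form, the modulus is averaged by Bernstein operators through their variances. *)
Lemma quadratic_modulus F a b : continuous F ->
  forall e : R, 0 < e -> exists2 C : R, 0 <= C &
    forall x y x' y', a <= x <= b -> a <= y <= b -> a <= x' <= b -> a <= y' <= b ->
      `|F (x, y) - F (x', y')| <= e + C * ((x - x') ^+ 2 + (y - y') ^+ 2).
Proof.
move=> cF e e0; have [de d0 hd] := unif_cont_square F a b cF e e0.
have [M hM] := bounded_square F a b cF.
pose C : R := 2 * `|M| / de ^+ 2.
have C0 : 0 <= C by apply: divr_ge0; [exact: mulr_ge0|exact: sqr_ge0].
exists C => // x y x' y' hx hy hx' hy'.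
have sx := sqr_ge0 (x - x'); have sy := sqr_ge0 (y - y').
have far : de ^+ 2 <= (x - x') ^+ 2 + (y - y') ^+ 2 ->
   `|F (x, y) - F (x', y')| <= e + C * ((x - x') ^+ 2 + (y - y') ^+ 2).
  move=> hf; apply: (@le_trans _ _ (2 * `|M|)).
    apply: (le_trans (ler_normB _ _)); have := hM _ _ hx hy; have := hM _ _ hx' hy'.
    by have := ler_norm M; lra.
  have : 2 * `|M| = C * de ^+ 2 by rewrite /C divfK// gt_eqF// exprn_gt0.
  move=> ->; apply: (@le_trans _ _ (C * ((x - x') ^+ 2 + (y - y') ^+ 2))); last by lra.
  exact: ler_wpM2l.
have [h1|h1] := ltP `|x - x'| de; last first.
  apply: far; apply: (@le_trans _ _ ((x - x') ^+ 2)); last by rewrite lerDl.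
  by rewrite -(real_normK (num_real (x - x'))) ler_sqr ?nnegrE// ltW.
have [h2|h2] := ltP `|y - y'| de; last first.
  apply: far; apply: (@le_trans _ _ ((y - y') ^+ 2)); last by rewrite lerDr.
  by rewrite -(real_normK (num_real (y - y'))) ler_sqr ?nnegrE// ltW.
by apply: (le_trans (hd _ _ _ _ hx hy h1 h2)); rewrite lerDl mulr_ge0// addr_ge0.
Qed.

End UniformContinuity.

Section Bernstein.
Context {R : realType}.

Definition bern (n i : nat) (x : R) : R := 'C(n, i)%:R * x ^+ i * (1 - x) ^+ (n - i).

Lemma bern_ge0 n i x : 0 <= x <= 1 -> 0 <= bern n i x.
Proof.
by case/andP => x0 x1; rewrite !mulr_ge0 ?exprn_ge0 ?subr_ge0.
Qed.

Lemma sum_bern n x : \sum_(i < n.+1) bern n i x = 1.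
Proof.
rewrite -[RHS](expr1n R n) -[in RHS](subrK x 1) exprDn; apply: eq_bigr => i _.
by rewrite /bern -mulrA mulr_natl [x ^+ i * _]mulrC.
Qed.

(** A binomial variable of size n.+1 is one of size n plus an independent Bernoulli
    variable. *)
Lemma sum_bernS n (x : R) (c : nat -> R) :
  \sum_(i < n.+2) c i * bern n.+1 i x =
  \sum_(i < n.+1) ((1 - x) * c i + x * c i.+1) * bern n i x.
Proof.
under [RHS]eq_bigr do rewrite mulrDl.
rewrite big_split /= big_ord_recl /=.
rewrite [X in _ = X + _]big_ord_recl /= -[RHS]addrA; congr (_ + _).
  by rewrite /bern !bin0 !subn0 exprS; ring.
under eq_bigr do rewrite /bump leq0n add1n.
have E (i : nat) : (i < n.+1)%N -> c i.+1 * bern n.+1 i.+1 x =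
   (1 - x) * c i.+1 * bern n i.+1 x + x * c i.+1 * bern n i x.
  move=> ni; rewrite /bern binS natrD subSS [x ^+ i.+1]exprS.
  case: (ltnP i n) => h; first by rewrite -(subnSK h) [(1 - x) ^+ _.+1]exprS; ring.
  by rewrite bin_small; [ring|].
rewrite (eq_bigr _ (fun (i : 'I_n.+1) _ => E i (ltn_ord i))) big_split /=; congr (_ + _).
rewrite big_ord_recr /= {2}/bern bin_small// !mul0r mulr0 addr0.
by apply: eq_bigr => i _; rewrite /bump leq0n add1n.
Qed.

Lemma sum_bern1 n (x : R) : \sum_(i < n.+1) i%:R * bern n i x = n%:R * x.
Proof.
elim: n => [|n ih]; first by rewrite big_ord1 !mul0r.
rewrite (sum_bernS n x (fun i => i%:R)).
transitivity (\sum_(i < n.+1) (i%:R * bern n i x + x * bern n i x)).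
  by apply: eq_bigr => i _; rewrite -[i.+1]addn1 natrD; ring.
by rewrite big_split /= ih -mulr_sumr sum_bern -[n.+1]addn1 natrD; ring.
Qed.

Lemma sum_bern2 n (x : R) : \sum_(i < n.+1) (i%:R - n%:R * x) ^+ 2 * bern n i x =
  n%:R * x * (1 - x).
Proof.
have H : \sum_(i < n.+1) i%:R ^+ 2 * bern n i x = (n%:R * x) ^+ 2 + n%:R * x * (1 - x).
  elim: n => [|n ih]; first by rewrite big_ord1 expr0n /= !mul0r expr0n addr0.
  rewrite (sum_bernS n x (fun i => i%:R ^+ 2)).
  transitivity (\sum_(i < n.+1) (i%:R ^+ 2 * bern n i x + (2 * x) * (i%:R * bern n i x) +
     x * bern n i x)).
    by apply: eq_bigr => i _; rewrite -[i.+1]addn1 natrD; ring.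
  rewrite !big_split /= ih -!mulr_sumr sum_bern sum_bern1 -[n.+1]addn1 natrD; ring.
transitivity (\sum_(i < n.+1) (i%:R ^+ 2 * bern n i x + (- 2 * (n%:R * x)) * (i%:R * bern n i x) +
     (n%:R * x) ^+ 2 * bern n i x)).
  by apply: eq_bigr => i _; ring.
by rewrite !big_split /= H -!mulr_sumr sum_bern sum_bern1; ring.
Qed.

Lemma sum_bern_var n (x : R) : 0 <= x <= 1 ->
  \sum_(i < n.+2) (x - i%:R / n.+1%:R) ^+ 2 * bern n.+1 i x <= n.+1%:R^-1.
Proof.
move=> /andP[x0 x1].
have n0 : (n.+1%:R : R) != 0 by rewrite pnatr_eq0.
have -> : \sum_(i < n.+2) (x - i%:R / n.+1%:R) ^+ 2 * bern n.+1 i x =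
   (n.+1%:R ^+ 2)^-1 * \sum_(i < n.+2) (i%:R - n.+1%:R * x) ^+ 2 * bern n.+1 i x.
  by rewrite mulr_sumr; apply: eq_bigr => i _; field.
rewrite sum_bern2.
have -> : (n.+1%:R ^+ 2)^-1 * (n.+1%:R * x * (1 - x)) = n.+1%:R^-1 * (x * (1 - x)) by field.
rewrite ler_piMr ?invr_ge0//; nra.
Qed.

Definition bernstein2 (n : nat) (F : R -> R -> R) (x y : R) : R :=
  \sum_(i < n.+2) \sum_(j < n.+2)
    F (i%:R / n.+1%:R) (j%:R / n.+1%:R) * (bern n.+1 i x * bern n.+1 j y).

(** The operator averages F over two independent binomial proportions, whose
    variances are of order 1 / n; the hypothesis bounds the mean error. *)
Lemma bernstein2_approx (F : R -> R -> R) :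
  (forall e : R, 0 < e -> exists2 C : R, 0 <= C & forall x y x' y' : R,
    0 <= x <= 1 -> 0 <= y <= 1 -> 0 <= x' <= 1 -> 0 <= y' <= 1 ->
    `|F x y - F x' y'| <= e + C * ((x - x') ^+ 2 + (y - y') ^+ 2)) ->
  forall e : R, 0 < e -> exists n, forall x y : R, 0 <= x <= 1 -> 0 <= y <= 1 ->
    `|F x y - bernstein2 n F x y| <= e.
Proof.
move=> hF e e0; have e20 : 0 < e / 2 by rewrite divr_gt0.
have [C C0 hC] := hF _ e20.
pose n := Num.bound (4 * C / e).
have hn : 4 * C / e < n%:R.
  by apply: archi_boundP; rewrite divr_ge0 ?mulr_ge0// ltW.
exists n => x y hx hy.
have w (i : nat) : (i < n.+2)%N -> 0 <= (i%:R / n.+1%:R : R) <= 1.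
  by move=> h; rewrite divr_ge0//= ler_pdivrMr ?ltr0n// mul1r ler_nat.
have -> : F x y = \sum_(i < n.+2) \sum_(j < n.+2) F x y * (bern n.+1 i x * bern n.+1 j y).
  under eq_bigr do (under eq_bigr do rewrite mulrA; rewrite -mulr_sumr sum_bern mulr1).
  by rewrite -mulr_sumr sum_bern mulr1.
rewrite /bernstein2 -sumrB.
under eq_bigr do (rewrite -sumrB; under eq_bigr do rewrite -mulrBl).
apply: (@le_trans _ _ (\sum_(i < n.+2) \sum_(j < n.+2)
   (e / 2 + C * ((x - i%:R / n.+1%:R) ^+ 2 + (y - j%:R / n.+1%:R) ^+ 2)) *
      (bern n.+1 i x * bern n.+1 j y))).
  apply: (le_trans (ler_norm_sum _ _ _)); apply: ler_sum => i _.
  apply: (le_trans (ler_norm_sum _ _ _)); apply: ler_sum => j _.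
  have b0 : 0 <= bern n.+1 i x * bern n.+1 j y by rewrite mulr_ge0 ?bern_ge0.
  rewrite normrM (ger0_norm b0) ler_wpM2r//.
  by apply: hC => //; exact: w.
have -> : \sum_(i < n.+2) \sum_(j < n.+2)
   (e / 2 + C * ((x - i%:R / n.+1%:R) ^+ 2 + (y - j%:R / n.+1%:R) ^+ 2)) *
      (bern n.+1 i x * bern n.+1 j y) =
   e / 2 + C * (\sum_(i < n.+2) (x - i%:R / n.+1%:R) ^+ 2 * bern n.+1 i x) +
   C * (\sum_(j < n.+2) (y - j%:R / n.+1%:R) ^+ 2 * bern n.+1 j y).
  set Vy := \sum_(j < n.+2) (y - j%:R / n.+1%:R) ^+ 2 * bern n.+1 j y.
  transitivity (\sum_(i < n.+2) ((e / 2 + C * Vy) * bern n.+1 i x +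
     C * ((x - i%:R / n.+1%:R) ^+ 2 * bern n.+1 i x))).
    apply: eq_bigr => i _.
    transitivity (\sum_(j < n.+2) (bern n.+1 i x * (e / 2 + C * (x - i%:R / n.+1%:R) ^+ 2) *
       bern n.+1 j y + (bern n.+1 i x * C) * ((y - j%:R / n.+1%:R) ^+ 2 * bern n.+1 j y))).
      by apply: eq_bigr => j _; ring.
    by rewrite big_split /= -!mulr_sumr sum_bern -/Vy; ring.
  by rewrite big_split /= -!mulr_sumr sum_bern; ring.
have vx := sum_bern_var n x hx; have vy := sum_bern_var n y hy.
have hCn : C * n.+1%:R^-1 <= e / 4.
  rewrite ler_pdivrMr ?ltr0n// -ler_pdivrMl; last by rewrite divr_gt0.
  apply: ltW; apply: lt_trans (_ : n%:R < _); last by rewrite ltr_nat.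
  by rewrite (_ : (e / 4)^-1 * C = 4 * C / e)//; field; rewrite gt_eqF.
apply: (@le_trans _ _ (e / 2 + e / 4 + e / 4)); last by lra.
apply: lerD; last exact: le_trans (ler_wpM2l C0 vy) hCn.
by apply: lerD => //; exact: le_trans (ler_wpM2l C0 vx) hCn.
Qed.

End Bernstein.

Section TrigPolynomials.
Context {R : realType}.
(* admissible pairs of a frequency and a phase; products of waves are governed by
   sums and differences of these *)
Variable G : set (R * R * R).
Hypothesis G0 : G (0, 0, 0).
Hypothesis GD : forall g h, G g -> G h -> G (g + h).
Hypothesis GB : forall g h, G g -> G h -> G (g - h).

Definition wave (g : R * R * R) (z : R * R) : R :=
  cos (g.1.1 * z.1 + g.1.2 * z.2 + g.2).

Inductive trig : (R * R -> R) -> Prop :=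
| trig_wave g : G g -> trig (wave g)
| trig_lin (a : R) p q : trig p -> trig q -> trig (fun z => p z + a * q z).

Lemma trig_cst (a : R) : trig (fun=> a).
Proof.
have -> : (fun=> a) = (fun z => wave (0, 0, 0) z + (a - 1) * wave (0, 0, 0) z).
  by apply/funext => z; rewrite /wave /= !mul0r !addr0 cos0; ring.
by apply: trig_lin; exact: trig_wave.
Qed.

Lemma trigZ (a : R) p : trig p -> trig (fun z => a * p z).
Proof.
move=> tp; have -> : (fun z => a * p z) = (fun z => 0 + a * p z).
  by apply/funext => z; rewrite add0r.
by apply: trig_lin => //; exact: trig_cst.
Qed.

Lemma trigD p q : trig p -> trig q -> trig (fun z => p z + q z).
Proof.
move=> tp tq; have -> : (fun z => p z + q z) = (fun z => p z + 1 * q z).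
  by apply/funext => z; rewrite mul1r.
exact: trig_lin.
Qed.

Lemma trigM p q : trig p -> trig q -> trig (fun z => p z * q z).
Proof.
move=> tp tq; elim: tp => {p} [g Gg|a p p' tp ih tp' ih']; last first.
  have -> : (fun z => (p z + a * p' z) * q z) = (fun z => p z * q z + a * (p' z * q z)).
    by apply/funext => z; ring.
  exact: trig_lin.
elim: tq => {q} [h Gh|a q q' tq ih tq' ih']; last first.
  have -> : (fun z => wave g z * (q z + a * q' z)) =
     (fun z => wave g z * q z + a * (wave g z * q' z)).
    by apply/funext => z; ring.
  exact: trig_lin.
have -> : (fun z => wave g z * wave h z) =
   (fun z => 2^-1 * (wave (g + h) z + wave (g - h) z)).
  apply/funext => z; rewrite /wave /=.
  set a := g.1.1 * _ + _ + _; set b := h.1.1 * _ + _ + _.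
  rewrite (_ : _ + (g.2 + h.2) = a + b); last by rewrite /a /b; ring.
  rewrite (_ : _ + (g.2 - h.2) = a - b); last by rewrite /a /b; ring.
  by move: a b => a b; rewrite cosD cosB; field.
by apply: trigZ; apply: trigD; apply: trig_wave; [exact: GD|exact: GB].
Qed.

Lemma trigX p n : trig p -> trig (fun z => p z ^+ n).
Proof.
move=> tp; elim: n => [|n ih]; first exact: trig_cst.
by under eq_fun do rewrite exprS; exact: trigM.
Qed.

Lemma trig_sum (I : Type) (s : seq I) (p : I -> R * R -> R) :
  (forall i, trig (p i)) -> trig (fun z => \sum_(i <- s) p i z).
Proof.
move=> tp; elim: s => [|i s ih].
  by under eq_fun do rewrite big_nil; exact: trig_cst.
by under eq_fun do rewrite big_cons; exact: trigD.
Qed.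

Lemma trig_bern n i p : trig p -> trig (fun z => bern n i (p z)).
Proof.
move=> tp; apply: trigM; first by apply: trigZ; exact: trigX.
apply: trigX; apply: trigD; first exact: trig_cst.
by under eq_fun do rewrite -mulN1r; exact: trigZ.
Qed.

Lemma trig_bernstein2 n F p q : trig p -> trig q ->
  trig (fun z => bernstein2 n F (p z) (q z)).
Proof.
move=> tp tq; apply: trig_sum => i; apply: trig_sum => j; apply: trigZ.
by apply: trigM; exact: trig_bern.
Qed.

End TrigPolynomials.

(** * From moments to weak convergence *)

Lemma cvg_finsum {R : realType} (I : Type) (s : seq I) (u : I -> nat -> R) (l : I -> R) :
  (forall i, u i @ \oo --> l i) ->
  (fun n => \sum_(i <- s) u i n) @ \oo --> \sum_(i <- s) l i.
Proof.
move=> h; elim: s => [|i s ih].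
  by rewrite big_nil; under eq_fun do rewrite big_nil; exact: cvg_cst.
rewrite big_cons; under eq_fun do rewrite big_cons.
by apply: (@cvgD _ R^o); [exact: h|exact: ih].
Qed.

Section CosTaylor.
Context {R : realType}.

Definition cos_der (k : nat) (th : R) : R := cos (th + k%:R * (pi / 2)).

Definition cos_poly (n : nat) (th : R) : {poly R} :=
  \poly_(k < n) (cos_der k th / k`!%:R).

Let deriv_cos_poly n th : (cos_poly n.+1 th)^`() = cos_poly n (th + pi / 2).
Proof.
apply/polyP => k; rewrite coef_deriv !coef_poly ltnS; case: ifP => // _.
  have -> : cos_der k.+1 th = cos_der k (th + pi / 2).
    by rewrite /cos_der -[k.+1]addn1 natrD; congr cos; ring.
  rewrite factS natrM -mulr_natr; field.
  by rewrite nat1r !pnatr_eq0 -!lt0n fact_gt0.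
by rewrite mul0rn.
Qed.

Let taylor_pos n th (x : R) : 0 <= x ->
  `|cos (x + th) - (cos_poly n th).[x]| <= x ^+ n / n`!%:R.
Proof.
elim: n th x => [|n ih] th x x0.
  by rewrite /cos_poly poly_def big_ord0 horner0 subr0 fact0 divr1 cos_max.
suff H (e : R) : `|e| <= 1 ->
    0 <= x ^+ n.+1 / n.+1`!%:R - e * (cos (x + th) - (cos_poly n.+1 th).[x]).
  have := H 1; have := H (-1); rewrite normrN1 normr1 => /(_ (lexx _)) h1 /(_ (lexx _)) h2.
  by rewrite ler_norml; apply/andP; split; lra.
move=> e1.
pose p : {poly R} := (n.+1`!%:R^-1) *: 'X^(n.+1) + e *: cos_poly n.+1 th.
pose g (s : R) : R := p.[s] - e * cos (s + th).
have dg (s : R) : is_derive s 1 g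
    (s ^+ n / n`!%:R - e * (cos (s + (th + pi / 2)) - (cos_poly n (th + pi / 2)).[s])).
  have -> : g = horner p - e *: (cos \o (fun s => s + th)).
    by apply/funext => y.
  apply: is_derive_eq.
  rewrite /= addrA cosDpihalf /p derivD !derivZ derivXn deriv_cos_poly.
  rewrite hornerD !hornerZ hornerMn hornerXn.
  rewrite -[LHS]/(n.+1`!%:R^-1 * (s ^+ n *+ n.+1) + e * (cos_poly n (th + pi / 2)).[s] -
     e * ((- sin (s + th)) * (1 + 0))).
  rewrite factS natrM -[s ^+ n *+ _]mulr_natl; field.
  by rewrite nat1r !pnatr_eq0 -!lt0n fact_gt0.
have : g 0 <= g x.
  apply: (@ger0_derive1_ndecry _ g 0) => //.
  - move=> s; rewrite in_itv /= andbT => s0; have ds := dg s; rewrite derive1E derive_val.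
    have := ih (th + pi / 2) s (ltW s0); set w := _ - _ => hw.
    rewrite subr_ge0 (le_trans (ler_norm _))// normrM (le_trans _ hw)//.
    by rewrite ler_piMl.
  - apply: continuous_subspaceT => s; apply: differentiable_continuous.
    by apply/derivable1_diffP; exact: ex_derive.
rewrite /g /p !hornerD !hornerZ !hornerXn expr0n /= mulr0 add0r.
have -> : (cos_poly n.+1 th).[0] = cos th.
  rewrite horner_coef0 coef_poly /= /cos_der mul0r addr0.
  by rewrite fact0 divr1.
by rewrite add0r subrr => h; apply: le_trans h _; lra.
Qed.

(** Taylor's formula with the bound 1 on all derivatives, obtained by integrating
    the inequality of the previous order. The error in x is uniform in the
    phase th. *)
Lemma cos_taylor n th (x : R) :
  `|cos (x + th) - (cos_poly n th).[x]| <= `|x| ^+ n / n`!%:R.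
Proof.
have [x0|x0] := leP 0 x; first by rewrite (ger0_norm x0); exact: taylor_pos.
have -> : cos (x + th) = cos (- x + - th) by rewrite -cosN opprD.
have refl (k : nat) : cos_der k th = cos_der k (- th) * (-1) ^+ k.
  suff [] : cos_der k th = cos_der k (- th) * (-1) ^+ k /\
      sin (th + k%:R * (pi / 2)) = - (sin (- th + k%:R * (pi / 2)) * (-1) ^+ k) by [].
  rewrite /cos_der; elim: k => [|j [ihc ihs]].
    by rewrite mul0r !addr0 cosN sinN expr0 !mulr1 opprK.
  have E (a : R) : a + j.+1%:R * (pi / 2) = a + j%:R * (pi / 2) + pi / 2.
    by rewrite -[j.+1]addn1 natrD; ring.
  by rewrite !E !cosDpihalf !sinDpihalf exprS ihc ihs; split; ring.
have -> : (cos_poly n th).[x] = (cos_poly n (- th)).[- x].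
  rewrite /cos_poly !horner_poly; apply: eq_bigr => k _.
  by rewrite refl (exprNn x); ring.
by rewrite (ltr0_norm x0); apply: taylor_pos; lra.
Qed.

End CosTaylor.

Section WeakConvergence.
Context {R : realType}.

(** A left inverse of the sine near the origin that is continuous on the whole
    line: cutting the argument at the sines of -1/2 and 1/2 keeps asin away from
    the endpoints of its domain. *)
Definition fold_angle (s : R) : R := asin (Num.max (- sin 2^-1) (Num.min (sin 2^-1) s)).

Let half_bd : - (pi / 2) <= (2^-1 : R) <= pi / 2.
Proof. by have := pi_ge2 R; move: (pi : R) => p hp; apply/andP; split; lra. Qed.

Let sin_half : 0 < sin (2^-1 : R) < 1.
Proof.
have p2 := pi_ge2 R; apply/andP; split.
  by apply: sin_gt0_pi; apply/andP; split; lra.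
apply: (@lt_le_trans _ _ (sin 1)).
  rewrite ltr_sin ?in_itv //=; move: (pi : R) p2 => p p2; lra.
exact: le_trans (ler_norm _) (sin_max _).
Qed.

Lemma continuous_fold_angle : continuous fold_angle.
Proof.
have /andP[s0 s1] := sin_half.
move=> x; rewrite /fold_angle.
apply: (@continuous_comp _ _ _ (fun s => Num.max (- sin 2^-1) (Num.min (sin 2^-1) s)) asin).
  apply: (@continuous_max _ _ (fun=> - sin (2^-1 : R)) (fun s => Num.min (sin 2^-1) s)); first exact: cvg_cst.
  by apply: (@continuous_min _ _ (fun=> sin (2^-1 : R)) id); [exact: cvg_cst|exact: cvg_id].
apply: continuous_asin; rewrite lt_max gt_max gt_min; apply/andP; split.
  by apply/orP; left; lra.
by apply/andP; split; [lra|apply/orP; left].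
Qed.

Lemma fold_angle_sin (t : R) : `|t| <= 2^-1 -> fold_angle (sin t) = t.
Proof.
rewrite ler_norml => /andP[t1 t2]; have p2 := pi_ge2 R.
rewrite /fold_angle -sinN.
have tI : t \in `[- (pi / 2), pi / 2].
  by rewrite in_itv /=; move: (pi : R) p2 => p p2; lra.
have hI : 2^-1 \in `[- (pi / 2), (pi : R) / 2] by rewrite in_itv /=; exact: half_bd.
have hI' : - 2^-1 \in `[- (pi / 2), (pi : R) / 2].
  by rewrite in_itv /=; move: half_bd; move: (pi : R) => p; lra.
have mono (x y : R) : x \in `[- (pi / 2), pi / 2] -> y \in `[- (pi / 2), pi / 2] ->
    x <= y -> sin x <= sin y.
  by move=> hx hy; rewrite le_eqVlt => /orP[/eqP ->//|xy]; rewrite ltW// ltr_sin.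
rewrite min_r; last exact: mono.
by rewrite max_r; [exact: sinK|exact: mono].
Qed.

Lemma continuous_comp2 (h : R * R -> R) (f g : R -> R) :
  continuous h -> continuous f -> continuous g ->
  continuous (fun z : R * R => h (f z.1, g z.2)).
Proof.
move=> ch cf cg z.
apply: (@continuous_comp _ _ _ (fun z : R * R => (f z.1, g z.2)) h); last exact: ch.
have c1 : f z'.1 @[z' --> z] --> f z.1.
  by apply: (@continuous_comp _ _ _ (@fst R R) f); [exact: cvg_fst|exact: cf].
have c2 : g z'.2 @[z' --> z] --> g z.2.
  by apply: (@continuous_comp _ _ _ (@snd R R) g); [exact: cvg_snd|exact: cg].
exact: (cvg_pair c1 c2).
Qed.

Lemma continuous_affine (a b : R) : continuous (fun x : R => a * x + b).
Proof.
move=> x; apply: (@cvgD _ R^o); last exact: cvg_cst.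
by apply: cvgM; [exact: cvg_cst|exact: cvg_id].
Qed.

Context {d : measure_display} {T : measurableType d}.

(** The composite is a pointwise limit of Bernstein polynomials in truncated
    coordinates. *)
Lemma measurable_continuous2 (h : R * R -> R) (Y : T -> R * R) : continuous h ->
  measurable_fun setT (fun o => (Y o).1) -> measurable_fun setT (fun o => (Y o).2) ->
  measurable_fun setT (h \o Y).
Proof.
move=> ch m1 m2.
pose F (n : nat) (x y : R) : R := h (n%:R * 2 * x + - n%:R, n%:R * 2 * y + - n%:R).
have apx (n : nat) : {m | forall x y : R, 0 <= x <= 1 -> 0 <= y <= 1 ->
    `|F n x y - bernstein2 m (F n) x y| <= n.+1%:R^-1}.
  apply: cid; apply: bernstein2_approx; last by rewrite invr_gt0 ltr0n.
  apply: (quadratic_modulus (fun z => F n z.1 z.2)).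
  exact: (continuous_comp2 _ _ _ ch (continuous_affine _ _) (continuous_affine _ _)).
(* coordinates truncated to [-n, n] and rescaled to [0, 1] *)
pose c (n : nat) (x : R) : R := Num.max 0 (Num.min 1 ((x + n%:R) / (n%:R * 2))).
have mc n (f : T -> R) : measurable_fun setT f -> measurable_fun setT (fun o => c n (f o)).
  move=> mf; apply: measurable_maxr => //; apply: measurable_minr => //.
  by apply: measurable_funM => //; exact: measurable_funD.
have mb k i (f : T -> R) : measurable_fun setT f ->
    measurable_fun setT (fun o => bern k i (f o)).
  move=> mf; apply: measurable_funM; last first.
    by apply: measurable_funX; exact: measurable_funB.
  by apply: measurable_funM => //; exact: measurable_funX.
apply: (@measurable_fun_cvg _ _ _ _
  (fun n o => bernstein2 (sval (apx n)) (F n) (c n (Y o).1) (c n (Y o).2))).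
  move=> n; apply: measurable_sum => i; apply: measurable_sum => j.
  apply: measurable_funM => //; apply: measurable_funM.
    by apply: mb; exact: mc.
  by apply: mb; exact: mc.
move=> o _; apply: cvg_eps => e e0; near=> n.
have c01 x : 0 <= c n x <= 1.
  by rewrite /c le_max lexx /= ge_max ler01 /= ge_min lexx.
have n0 : (0 < n)%N by near: n; exact: nbhs_infty_gt.
have cE x : `|x| <= n%:R -> n%:R * 2 * c n x + - n%:R = x.
  rewrite ler_norml => /andP[x1 x2].
  have p : 0 < (n%:R : R) by rewrite ltr0n.
  have p2 : 0 < (n%:R * 2 : R) by lra.
  rewrite /c min_r; last by rewrite ler_pdivrMr//; lra.
  rewrite max_r; last by rewrite divr_ge0//; lra.
  by field; rewrite gt_eqF.
case: (apx n) => m hm /=.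
have := hm _ _ (c01 (Y o).1) (c01 (Y o).2).
rewrite {1}/F !cE; last 2 first.
- by near: n; exact: nbhs_infty_ger.
- by near: n; exact: nbhs_infty_ger.
rewrite -surjective_pairing => /le_trans; apply.
by apply: ltW; near: n; exact: near_infty_natSinv_lt (PosNum e0).
Unshelve. all: by end_near. Qed.

Variable P : probability T R.

Lemma Ex_bounded (f : T -> R) (M : R) : measurable_fun setT f ->
  (forall o, `|f o| <= M) -> P.-integrable setT (EFin \o f).
Proof.
move=> mf fM; apply: (integrable_dom P _ _ (fun=> M)) => //.
exact: finite_measure_integrable_cst.
Qed.

Lemma Ex_dist (f g b : T -> R) : measurable_fun setT f -> has_moments P g ->
  has_moments P b -> P.-integrable setT (EFin \o f) ->
  (forall o, `|f o - g o| <= b o) -> `|Ex P f - Ex P g| <= Ex P b.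
Proof.
move=> mf hg hb fi fgb.
have gi := has_moments_integrable _ hg; have bi := has_moments_integrable _ hb.
rewrite -RintegralB//; apply: (le_trans (le_normr_Rintegral _ _)) => //.
  exact: (integrableB measurableT fi gi).
apply: le_Rintegral => //.
exact: (integrable_abse (integrableB measurableT fi gi)).
Qed.

Lemma Ex_cos_poly (S : T -> R) (th : R) (m : nat) : has_moments P S ->
  `|Ex P (fun o => cos (S o + th)) -
    \sum_(k < m.*2) cos_der k th / k`!%:R * Ex P (fun o => S o ^+ k)| <=
  Ex P (fun o => S o ^+ m.*2) / m.*2`!%:R.
Proof.
move=> hS; have [mS _] := hS.
have hX k : has_moments P (fun o => S o ^+ k) by exact: has_momentsX.
have hp : has_moments P (fun o => \sum_(k < m.*2) cos_der k th / k`!%:R * S o ^+ k).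
  by apply: has_moments_sum => k; exact: has_momentsZ.
have -> : \sum_(k < m.*2) cos_der k th / k`!%:R * Ex P (fun o => S o ^+ k) =
    Ex P (fun o => \sum_(k < m.*2) cos_der k th / k`!%:R * S o ^+ k).
  rewrite Exp_sum; first by apply: eq_bigr => k _; rewrite ExpZ.
  by move=> k; exact: has_momentsZ.
have mc : measurable_fun setT (fun o => cos (S o + th)).
  have := continuous_measurable_fun (@continuous_cos R).
  by move/measurableT_comp; apply; exact: measurable_funD.
have -> : Ex P (fun o => S o ^+ m.*2) / m.*2`!%:R =
    Ex P (fun o => m.*2`!%:R^-1 * S o ^+ m.*2) by rewrite ExpZ// mulrC.
apply: Ex_dist => //; first exact: has_momentsZ.
  by apply: (Ex_bounded _ 1) => // o; exact: cos_max.
move=> o; have := cos_taylor m.*2 th (S o).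
rewrite /cos_poly horner_poly => /le_trans; apply.
by rewrite mulrC -normrX ger0_norm// -muln2 exprM sqr_ge0.
Qed.

(** Hence the Taylor remainders of order 2 m of the characteristic function tend to
    0 with m: the normal law is determined by its moments. *)
Lemma nmoment_even (v : R) (m : nat) :
  nmoment v m.*2 / m.*2`!%:R = exp_coeff (v / 2) m.
Proof.
rewrite /exp_coeff /=; elim: m => [|m ih]; first by rewrite expr0.
rewrite doubleS nmomentS /= !factS !natrM exprS.
have -> : nmoment v m.*2 = (v / 2) ^+ m / m`!%:R * m.*2`!%:R.
  by rewrite -ih divfK// pnatr_eq0 -lt0n fact_gt0.
rewrite -[m.*2.+2]addn2 -[m.*2.+1]addn1 -[m.+1]addn1 -muln2 !natrD natrM.
field.
have m0 := ler0n R m; rewrite !pnatr_eq0 -!lt0n !fact_gt0 /=.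
by apply/and3P; split; rewrite gt_eqF//; lra.
Qed.

Lemma measurable_trig (Z : T -> R * R) p : trig setT p ->
  measurable_fun setT (fun o => (Z o).1) -> measurable_fun setT (fun o => (Z o).2) ->
  measurable_fun setT (fun o => p (Z o)) /\ exists M : R, forall z, `|p z| <= M.
Proof.
move=> tp m1 m2; elim: tp => {p} [g _|a p q _ [mp [M hM]] _ [mq [N hN]]].
  split; last by exists 1 => z; exact: cos_max.
  have := continuous_measurable_fun (@continuous_cos R).
  move/measurableT_comp; apply; apply: measurable_funD => //.
  by apply: measurable_funD; exact: measurable_funM.
split; first by apply: measurable_funD => //; exact: measurable_funM.
exists (M + `|a| * N) => z; apply: (le_trans (ler_normD _ _)).
by rewrite lerD// normrM ler_wpM2l.
Qed.

Lemma has_moments_bounded (f : T -> R) (M : R) : measurable_fun setT f ->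
  (forall o, `|f o| <= M) -> has_moments P f.
Proof.
move=> mf fM; split=> // k; apply: (Ex_bounded _ (M ^+ k)).
  exact: measurable_funX.
by move=> o; rewrite normrX lerXn2r ?nnegrE// (le_trans _ (fM o)).
Qed.

Section Vectors.
Variables (Y : nat -> T -> R * R) (V : T -> R * R).
Hypotheses (mY1 : forall n, has_moments P (fun o => (Y n o).1))
  (mY2 : forall n, has_moments P (fun o => (Y n o).2))
  (mV1 : has_moments P (fun o => (V o).1)) (mV2 : has_moments P (fun o => (V o).2)).
Hypothesis cvg_mom : forall (a b : R) k,
  Ex P (fun o => (a * (Y n o).1 + b * (Y n o).2) ^+ k) @[n --> \oo] -->
  Ex P (fun o => (a * (V o).1 + b * (V o).2) ^+ k).
Hypothesis gaussV : forall a b : R, exists v, forall k,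
  Ex P (fun o => (a * (V o).1 + b * (V o).2) ^+ k) = nmoment v k.

(** The cosine is expanded at an order m such that the remainder, a moment of order
    2 m, is small for V and therefore for Y n with n large. *)
Lemma cvg_Ex_wave g :
  Ex P (fun o => wave g (Y n o)) @[n --> \oo] --> Ex P (fun o => wave g (V o)).
Proof.
case: g => -[a b] th; rewrite /wave /=.
have [v hv] := gaussV a b.
have hS n : has_moments P (fun o => a * (Y n o).1 + b * (Y n o).2).
  by apply: has_momentsD; exact: has_momentsZ.
have hSV : has_moments P (fun o => a * (V o).1 + b * (V o).2).
  by apply: has_momentsD; exact: has_momentsZ.
apply: cvg_eps => e e0; have e40 : 0 < e / 4 by rewrite divr_gt0.
have [m hm] : exists m, exp_coeff (v / 2) m < e / 4.
  have /cvgrPdist_lt/(_ _ e40) [m _ /(_ m (leqnn m))] := cvg_exp_coeff (v / 2).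
  rewrite sub0r normrN => h; exists m.
  exact: le_lt_trans (ler_norm _) h.
have Vm : Ex P (fun o => (a * (V o).1 + b * (V o).2) ^+ m.*2) / m.*2`!%:R < e / 4.
  by rewrite hv nmoment_even.
have cm : (fun n => Ex P (fun o => (a * (Y n o).1 + b * (Y n o).2) ^+ m.*2) / m.*2`!%:R) @ \oo -->
    Ex P (fun o => (a * (V o).1 + b * (V o).2) ^+ m.*2) / m.*2`!%:R.
  by apply: cvgM; [exact: cvg_mom|exact: cvg_cst].
have cs : (fun n => \sum_(k < m.*2) cos_der k th / k`!%:R *
      Ex P (fun o => (a * (Y n o).1 + b * (Y n o).2) ^+ k)) @ \oo -->
    \sum_(k < m.*2) cos_der k th / k`!%:R *
      Ex P (fun o => (a * (V o).1 + b * (V o).2) ^+ k).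
  by apply: cvg_finsum => k; apply: cvgM; [exact: cvg_cst|exact: cvg_mom].
have /cvgrPdist_le/(_ _ e40) cs' := cs.
have chain (x y s t p q : R) : `|x - s| <= p -> `|y - t| <= q -> p <= e / 4 ->
    `|t - s| <= e / 4 -> q <= e / 4 -> `|y - x| <= e.
  rewrite !ler_norml => /andP[? ?] /andP[? ?] ? /andP[? ?] ?.
  by apply/andP; split; lra.
near=> n.
have b1 := Ex_cos_poly _ th m (hS n); have b2 := Ex_cos_poly _ th m hSV.
have b3 : Ex P (fun o => (a * (Y n o).1 + b * (Y n o).2) ^+ m.*2) / m.*2`!%:R <= e / 4.
  by near: n; exact: cvgr_le cm _ Vm.
have b4 : `|\sum_(k < m.*2) cos_der k th / k`!%:R *
      Ex P (fun o => (a * (V o).1 + b * (V o).2) ^+ k) -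
   \sum_(k < m.*2) cos_der k th / k`!%:R *
      Ex P (fun o => (a * (Y n o).1 + b * (Y n o).2) ^+ k)| <= e / 4.
  by near: n.
exact: (chain _ _ _ _ _ _ b1 b2 b3 b4 (ltW Vm)).
Unshelve. all: by end_near. Qed.

Lemma cvg_Ex_trig p : trig setT p ->
  Ex P (fun o => p (Y n o)) @[n --> \oo] --> Ex P (fun o => p (V o)).
Proof.
have mom (Z : T -> R * R) q : has_moments P (fun o => (Z o).1) ->
    has_moments P (fun o => (Z o).2) -> trig setT q -> has_moments P (fun o => q (Z o)).
  move=> [m1 _] [m2 _] tq; have [mq [M hM]] := measurable_trig Z q tq m1 m2.
  by apply: (has_moments_bounded _ M).
elim=> {p} [g _|a p q tp ihp tq ihq]; first exact: cvg_Ex_wave.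
have E (Z : T -> R * R) : has_moments P (fun o => (Z o).1) ->
    has_moments P (fun o => (Z o).2) ->
    Ex P (fun o => p (Z o) + a * q (Z o)) = Ex P (fun o => p (Z o)) + a * Ex P (fun o => q (Z o)).
  move=> h1 h2; rewrite ExpD ?ExpZ//; try exact: mom.
  by apply: has_momentsZ; exact: mom.
rewrite E//; under eq_fun do rewrite E//.
by apply: (@cvgD _ R^o) => //; apply: cvgM => //; exact: cvg_cst.
Qed.

(** Beyond the scale A the second moments control all the laws; within it h is a
    continuous function of sin (z.1 / A) and sin (z.2 / A), because these determine
    z. A Bernstein polynomial in them is a trigonometric polynomial on the plane,
    close to h within the scale A and bounded beyond it. *)
Lemma cvg_Ex_continuous (h : R * R -> R) (M : R) : continuous h ->
  (forall z, `|h z| <= M) ->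
  Ex P (fun o => h (Y n o)) @[n --> \oo] --> Ex P (fun o => h (V o)).
Proof.
move=> ch hM.
have M0 : 0 <= M by exact: le_trans (hM 0).
pose sq (Z : T -> R * R) : T -> R := fun o => (Z o).1 ^+ 2 + (Z o).2 ^+ 2.
have msq (Z : T -> R * R) : has_moments P (fun o => (Z o).1) ->
    has_moments P (fun o => (Z o).2) -> has_moments P (sq Z).
  by move=> h1 h2; apply: has_momentsD; exact: has_momentsX.
have Esq (Z : T -> R * R) : has_moments P (fun o => (Z o).1) ->
    has_moments P (fun o => (Z o).2) ->
    Ex P (sq Z) = Ex P (fun o => (1 * (Z o).1 + 0 * (Z o).2) ^+ 2) +
      Ex P (fun o => (0 * (Z o).1 + 1 * (Z o).2) ^+ 2).
  move=> h1 h2; rewrite ExpD//; try exact: has_momentsX.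
  by congr (_ + _); apply: eq_Rintegral => o _; rewrite mul1r mul0r ?add0r ?addr0.
have csq : Ex P (sq (Y n)) @[n --> \oo] --> Ex P (sq V).
  rewrite Esq//; under eq_fun do rewrite Esq//.
  by apply: (@cvgD _ R^o); exact: cvg_mom.
apply: cvg_eps => e e0; have e60 : 0 < e / 6 by rewrite divr_gt0.
have L0 : 0 <= Ex P (sq V).
  by apply: Rintegral_ge0 => o _; rewrite addr_ge0// sqr_ge0.
set L := Ex P (sq V) in csq L0.
pose K : R := 8 * M * (L + 1).
have K0 : 0 <= K by rewrite !mulr_ge0//; lra.
have [A [A0 hA]] : exists A : R, 0 < A /\ K / A ^+ 2 <= e / 6.
  exists (1 + K / (e / 6)); have A1 : 1 <= 1 + K / (e / 6).
    by rewrite lerDl divr_ge0// ltW.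
  split; first by lra.
  rewrite ler_pdivrMr; last by rewrite exprn_gt0//; lra.
  apply: (@le_trans _ _ (e / 6 * (1 + K / (e / 6)))).
    have -> : e / 6 * (1 + K / (e / 6)) = e / 6 + K by field; rewrite gt_eqF.
    by rewrite lerDr ltW.
  by rewrite ler_wpM2l ?(ltW e60)// expr2 ler_peMl//; lra.
pose F (x y : R) : R := h (A * fold_angle (2 * x + -1), A * fold_angle (2 * y + -1)).
have cfa : continuous (fun x : R => A * fold_angle (2 * x + -1)).
  move=> x; apply: cvgM; first exact: cvg_cst.
  apply: (@continuous_comp _ _ _ (fun x : R => 2 * x + -1) fold_angle).
    exact: continuous_affine.
  exact: continuous_fold_angle.
have [m hm] := bernstein2_approx F
  (quadratic_modulus (fun z => F z.1 z.2) 0 1 (continuous_comp2 _ _ _ ch cfa cfa)) _ e60.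
pose s (x : R) : R := 2^-1 + 2^-1 * sin (A^-1 * x).
have s01 x : 0 <= s x <= 1.
  by have := sin_max (A^-1 * x); rewrite ler_norml /s => /andP[? ?]; apply/andP; split; lra.
pose p (z : R * R) := bernstein2 m F (s z.1) (s z.2).
have tp : trig setT p.
  have ts (f : R * R -> R) a b : (f = fun z => a * z.1 + b * z.2) ->
      trig setT (fun z => 2^-1 + 2^-1 * sin (f z)).
    move=> ->; have -> : (fun z : R * R => 2^-1 + 2^-1 * sin (a * z.1 + b * z.2)) =
       (fun z => 2^-1 + 2^-1 * wave (a, b, - (pi / 2)) z).
      by apply/funext => z; rewrite /wave /= cosBpihalf.
    by apply: trigD => //; [exact: trig_cst|apply: trigZ => //; exact: trig_wave].
  apply: trig_bernstein2 => //.
    by apply: (ts (fun z => A^-1 * z.1) A^-1 0); apply/funext => z; rewrite mul0r addr0.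
  by apply: (ts (fun z => A^-1 * z.2) 0 A^-1); apply/funext => z; rewrite mul0r add0r.
have pt z : `|h z - p z| <= e / 6 + 8 * M / A ^+ 2 * (z.1 ^+ 2 + z.2 ^+ 2).
  have hF : `|F (s z.1) (s z.2) - p z| <= e / 6 by exact: hm.
  have c0 : 0 <= 8 * M / A ^+ 2 by rewrite !mulr_ge0// invr_ge0 exprn_ge0// ltW.
  have cz : 0 <= z.1 ^+ 2 + z.2 ^+ 2 by rewrite addr_ge0 ?sqr_ge0.
  have far (x : R) : A / 2 < `|x| -> x ^+ 2 <= z.1 ^+ 2 + z.2 ^+ 2 ->
      `|h z - p z| <= e / 6 + 8 * M / A ^+ 2 * (z.1 ^+ 2 + z.2 ^+ 2).
    move=> xA xz.
    have b2 : `|h z - p z| <= 2 * M + e / 6.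
      rewrite -[_ - _](subrKA (F (s z.1) (s z.2))).
      apply: (le_trans (ler_normD _ _)); apply: lerD => //.
      apply: (le_trans (ler_normB _ _)).
      have -> : 2 * M = M + M by ring.
      by apply: lerD; exact: hM.
    apply: (le_trans b2); rewrite addrC lerD2l.
    apply: (@le_trans _ _ (8 * M / A ^+ 2 * x ^+ 2)); last by rewrite ler_wpM2l.
    have -> : 2 * M = 8 * M / A ^+ 2 * (A / 2) ^+ 2 by field; rewrite gt_eqF.
    rewrite ler_wpM2l// -[X in _ <= X]real_normK ?num_real//.
    have A2 : 0 <= A / 2 by lra.
    by rewrite ler_sqr ?nnegrE// ltW.
  have [h1|h1] := leP `|z.1| (A / 2); last by apply: (far z.1) => //; rewrite lerDl sqr_ge0.
  have [h2|h2] := leP `|z.2| (A / 2); last by apply: (far z.2) => //; rewrite lerDr sqr_ge0.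
  have fK (x : R) : `|x| <= A / 2 -> A * fold_angle (2 * s x + -1) = x.
    move=> hx; have -> : 2 * s x + -1 = sin (A^-1 * x) by rewrite /s; field.
    rewrite fold_angle_sin; first by rewrite mulrA divff ?mul1r// gt_eqF.
    rewrite normrM gtr0_norm ?invr_gt0// mulrC ler_pdivrMr// mulrC; lra.
  have -> : h z = F (s z.1) (s z.2) by rewrite /F !fK// -surjective_pairing.
  by apply: (le_trans hF); rewrite lerDl mulr_ge0.
have EZ (Z : T -> R * R) : has_moments P (fun o => (Z o).1) ->
    has_moments P (fun o => (Z o).2) ->
    `|Ex P (fun o => h (Z o)) - Ex P (fun o => p (Z o))| <= e / 6 + 8 * M / A ^+ 2 * Ex P (sq Z).
  move=> h1 h2.
  have mh : measurable_fun setT (fun o => h (Z o)).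
    by apply: measurable_continuous2 => //; [case: h1|case: h2].
  have [mp [N hN]] := measurable_trig Z p tp h1.1 h2.1.
  have -> : e / 6 + 8 * M / A ^+ 2 * Ex P (sq Z) =
      Ex P (fun o => e / 6 + 8 * M / A ^+ 2 * sq Z o).
    have hs := msq Z h1 h2.
    rewrite -(ExpZ P (8 * M / A ^+ 2) _ hs) ExpD; last exact: has_momentsZ.
      by rewrite Exp_cst.
    exact: has_moments_cst.
  apply: Ex_dist => //.
  - exact: (has_moments_bounded _ N).
  - by apply: has_momentsD; [exact: has_moments_cst|apply: has_momentsZ; exact: msq].
  - exact: (Ex_bounded _ M).
have cp := cvg_Ex_trig p tp.
have /cvgrPdist_le/(_ _ e60) cp' := cp.
have L1 : L < L + 1 by lra.
have chain (x y x' y' a b : R) : `|x - x'| <= e / 6 + a -> `|y - y'| <= e / 6 + b ->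
    `|y' - x'| <= e / 6 -> a <= e / 6 -> b <= e / 6 -> `|y - x| <= e.
  rewrite !ler_norml => /andP[? ?] /andP[? ?] /andP[? ?] ? ?.
  by apply/andP; split; lra.
near=> n.
have b1 := EZ _ (mY1 n) (mY2 n); have b2 := EZ _ mV1 mV2.
have b3 : `|Ex P (fun o => p (V o)) - Ex P (fun o => p (Y n o))| <= e / 6 by near: n.
have b4 : Ex P (sq (Y n)) <= L + 1 by near: n; exact: cvgr_le csq _ L1.
have c0 : 0 <= 8 * M / A ^+ 2 by rewrite !mulr_ge0// invr_ge0 exprn_ge0// ltW.
have b5 : 8 * M / A ^+ 2 * Ex P (sq (Y n)) <= e / 6.
  apply: le_trans hA; rewrite /K [_ * (L + 1) / _]mulrAC.
  by rewrite ler_wpM2l.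
have b6 : 8 * M / A ^+ 2 * Ex P (sq V) <= e / 6.
  apply: le_trans hA; rewrite /K [_ * (L + 1) / _]mulrAC -/L.
  by rewrite ler_wpM2l// ltW.
exact: (chain _ _ _ _ _ _ b1 b2 b3 b5 b6).
Unshelve. all: by end_near. Qed.

End Vectors.

End WeakConvergence.

(** * Integration on the torus *)

Section TorusIntegral.
Context {R : realType}.
Notation mu := (@lebesgue_measure R).
Notation mu2 := (lebesgue_measure \x lebesgue_measure)%E.
Notation TI := (@torus_int R).

Lemma measurable_torus : measurable (@torus R).
Proof. by apply: measurableX; exact: measurable_itv. Qed.

Lemma torus_measure : (mu2 (@torus R) = ((2 * pi) ^+ 2)%:E)%E.
Proof.
rewrite product_measure1E; [|exact: measurable_itv|exact: measurable_itv].
have p0 := pi_gt0 R.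
have e : (mu `](- pi)%R, pi%R]%classic = (2 * pi)%:E)%E.
  rewrite lebesgue_measure_itv /= lte_fin ifT; last by lra.
  by rewrite -EFinD; congr EFin; ring.
transitivity ((2 * pi)%:E * (2 * pi)%:E : \bar R)%E; last by rewrite -EFinM expr2.
by congr (_ * _)%E; exact: e.
Qed.

(** All the functions integrated on the torus are of this kind. *)
Definition tbounded (g : R * R -> R) :=
  measurable_fun (@torus R) g /\ exists M : R, forall l, torus l -> `|g l| <= M.

Lemma tboundedD g h : tbounded g -> tbounded h -> tbounded (fun l => g l + h l).
Proof.
move=> [mg [M hM]] [mh [N hN]]; split; first exact: measurable_funD.
exists (M + N) => l tl; apply: (le_trans (ler_normD _ _)).
by apply: lerD; [exact: hM|exact: hN].
Qed.

Lemma tboundedM g h : tbounded g -> tbounded h -> tbounded (fun l => g l * h l).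
Proof.
move=> [mg [M hM]] [mh [N hN]]; split; first exact: measurable_funM.
exists (M * N) => l tl; rewrite normrM.
by apply: ler_pM => //; [exact: hM|exact: hN].
Qed.

Lemma tbounded_cst (a : R) : tbounded (fun=> a).
Proof. by split=> //; exists `|a|. Qed.

Lemma tboundedZ (a : R) g : tbounded g -> tbounded (fun l => a * g l).
Proof. by move=> tg; apply: tboundedM => //; exact: tbounded_cst. Qed.

Lemma tbounded_sum (I : Type) (s : seq I) (g : I -> R * R -> R) :
  (forall i, tbounded (g i)) -> tbounded (fun l => \sum_(i <- s) g i l).
Proof.
move=> tg; elim: s => [|i s ih].
  by under eq_fun do rewrite big_nil; exact: tbounded_cst.
by under eq_fun do rewrite big_cons; exact: tboundedD.
Qed.

Lemma tbounded_integrable g : tbounded g -> mu2.-integrable (@torus R) (EFin \o g).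
Proof.
move=> [mg [M hM]]; apply: measurable_bounded_integrable => //.
- exact: measurable_torus.
- by rewrite [X in (X < _)%E]torus_measure ltry.
- exists M; split; first by rewrite num_real.
  by move=> x Mx l tl; apply: le_trans (ltW Mx); exact: hM.
Qed.

Let k0 : 0 < ((2 * pi : R) ^+ 2)^-1.
Proof. by rewrite invr_gt0 exprn_gt0// mulr_gt0// pi_gt0. Qed.

Lemma TID g h : tbounded g -> tbounded h -> TI (fun l => g l + h l) = TI g + TI h.
Proof.
move=> tg th; rewrite /torus_int RintegralD ?mulrDr//.
- exact: measurable_torus.
- exact: tbounded_integrable.
- exact: tbounded_integrable.
Qed.

Lemma TIZ a g : tbounded g -> TI (fun l => a * g l) = a * TI g.
Proof.
move=> tg; rewrite /torus_int [RHS]mulrCA; congr (_ * _).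
apply: RintegralZl; first exact: measurable_torus.
exact: tbounded_integrable.
Qed.

Lemma TI_cst a : TI (fun=> a) = a.
Proof.
rewrite /torus_int; transitivity (((2 * pi) ^+ 2)^-1 * (a * fine (mu2 (@torus R)))).
  by congr (_ * _); apply: Rintegral_cst; exact: measurable_torus.
rewrite [X in fine X]torus_measure /= mulrCA mulVf ?mulr1//.
by have := k0; rewrite invr_gt0 => /lt0r_neq0.
Qed.

Lemma TI_le g h : tbounded g -> tbounded h -> (forall l, torus l -> g l <= h l) ->
  TI g <= TI h.
Proof.
move=> tg th gh; rewrite /torus_int; apply: ler_wpM2l; first exact: ltW.
apply: le_Rintegral => //.
- exact: measurable_torus.
- exact: tbounded_integrable.
- exact: tbounded_integrable.
Qed.

Lemma eq_TI g h : (forall l, torus l -> g l = h l) -> TI g = TI h.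
Proof.
by move=> gh; congr (_ * _); apply: eq_Rintegral => l /set_mem /gh.
Qed.

Lemma TI_sum (I : Type) (s : seq I) (g : I -> R * R -> R) :
  (forall i, tbounded (g i)) -> TI (fun l => \sum_(i <- s) g i l) = \sum_(i <- s) TI (g i).
Proof.
move=> tg; elim: s => [|i s ih].
  by rewrite big_nil; under eq_fun do rewrite big_nil; exact: TI_cst.
under eq_fun do rewrite big_cons.
by rewrite TID// ?ih ?big_cons//; exact: tbounded_sum.
Qed.

Lemma tbounded_wave g : tbounded (wave g).
Proof.
split; last by exists 1 => l _; exact: cos_max.
apply: measurable_funTS.
have := continuous_measurable_fun (@continuous_cos R).
move/measurableT_comp; apply; apply: measurable_funD => //.
by apply: measurable_funD; apply: measurable_funM.
Qed.

(** The even waves that are periodic on the torus; frequencies form a group, as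
    products of waves require. *)
Definition ZG : set (R * R * R) := [set g | exists h : int * int, g = (h.1%:~R, h.2%:~R, 0)].

Lemma ZG_add g h : ZG g -> ZG h -> ZG (g + h).
Proof.
move=> [a ->] [b ->]; exists (a + b) => /=.
by congr (_, _, _); rewrite ?addr0 ?intrD.
Qed.

Lemma ZG_sub g h : ZG g -> ZG h -> ZG (g - h).
Proof.
move=> [a ->] [b ->]; exists (a - b) => /=.
by congr (_, _, _); rewrite ?subr0 ?intrB.
Qed.

Lemma ZG0 : ZG (0, 0, 0). Proof. by exists 0. Qed.

Definition cosw (h : int * int) (l : R * R) : R := cos (inner h l).

Lemma cosw_wave h : cosw h = wave (h.1%:~R, h.2%:~R, 0).
Proof. by apply/funext => l; rewrite /cosw /wave /= addr0. Qed.

Lemma tbounded_cosw h : tbounded (cosw h).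
Proof. by rewrite cosw_wave; exact: tbounded_wave. Qed.

Lemma coswN h : cosw (- h) = cosw h.
Proof.
apply/funext => l; rewrite /cosw /inner -[RHS]cosN; congr cos.
by rewrite /= !mulrNz; ring.
Qed.

Lemma coswM h k l : cosw h l * cosw k l = 2^-1 * (cosw (h + k) l + cosw (h - k) l).
Proof.
rewrite /cosw /inner /= !intrD !mulrNz.
rewrite (_ : (h.1%:~R + k.1%:~R) * l.1 + _ = h.1%:~R * l.1 + h.2%:~R * l.2 + (k.1%:~R * l.1 + k.2%:~R * l.2)); last by ring.
rewrite (_ : (h.1%:~R - k.1%:~R) * l.1 + _ = h.1%:~R * l.1 + h.2%:~R * l.2 - (k.1%:~R * l.1 + k.2%:~R * l.2)); last by ring.
move: (h.1%:~R * l.1 + _) (k.1%:~R * l.1 + _) => a b.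
by rewrite cosD cosB; field.
Qed.

(** The primitive takes the same value at both ends, since sin (k pi) = 0. *)
Lemma integral_cos_period (k : int) (th : R) : k != 0 ->
  (\int[mu]_(x in `](- pi)%R, pi%R]) (cos (k%:~R * x + th))%:E = 0)%E.
Proof.
move=> k0'; have kn : (k%:~R : R) != 0 by rewrite intr_eq0.
have p0 := pi_gt0 R.
have cf : continuous (fun x : R => cos (k%:~R * x + th)).
  move=> x; apply: (@continuous_comp _ _ _ (fun x : R => k%:~R * x + th) cos).
    exact: continuous_affine.
  exact: continuous_cos.
pose F (x : R) : R := (k%:~R)^-1 * sin (k%:~R * x + th).
have dF (x : R) : is_derive x 1 F (cos (k%:~R * x + th)).
  have -> : F = (k%:~R)^-1 *: (sin \o (fun x => k%:~R * x + th)) by [].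
  apply: is_derive_eq.
  rewrite -[LHS]/((k%:~R)^-1 * (cos (k%:~R * x + th) * (k%:~R * 1 + 0))).
  by rewrite addr0 mulr1 mulrCA mulVf// mulr1.
rewrite integral_itv_obnd_cbnd; last first.
  by apply/measurable_EFinP; apply: measurable_funTS; exact: continuous_measurable_fun.
rewrite (@continuous_FTC2 _ _ F); last first.
- by move=> x _; have := dF x => ?; rewrite derive1E derive_val.
- have cF : continuous F.
    by move=> x; apply: differentiable_continuous; apply/derivable1_diffP; exact: ex_derive.
  split; first by move=> x _; exact: ex_derive.
    by apply: cvg_at_right_filter; exact: cF.
  by apply: cvg_at_left_filter; exact: cF.
- exact: continuous_subspaceT.
- by lra.
rewrite -EFinB /F -mulrBr.
suff sk : sin (k%:~R * pi : R) = 0.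
  by rewrite mulrN !sinD sinN cosN sk oppr0 subrr mulr0.
have nk (n : nat) : sin (n%:R * pi : R) = 0.
  elim: n => [|n ih]; first by rewrite mul0r sin0.
  by rewrite -[n.+1]addn1 natrD mulrDl mul1r sinDpi ih oppr0.
case: k {k0' kn cf F dF} => n; first exact: nk.
by rewrite NegzE mulrNz mulNr sinN nk oppr0.
Qed.

Lemma TI_cosw h : h != 0 -> TI (cosw h) = 0.
Proof.
move=> h0; rewrite /torus_int /Rintegral; set J := (\int[_]_(_ in _) _)%E.
suff -> : J = 0%E by rewrite mulr0.
pose g := (EFin \o cosw h) \_ (@torus R).
have gi : mu2.-integrable setT g.
  rewrite /g; apply/integrable_restrict; [exact: measurable_torus|exact: measurableT|].
  by rewrite setTI; apply: tbounded_integrable; exact: tbounded_cosw.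
have -> : J = (\int[mu2]_l g l)%E by rewrite /J integral_mkcond.
case: (eqVneq h.2 0) => [h2|h2].
  have h1 : h.1 != 0 by apply: contra_neq h0 => h1; rewrite [h]surjective_pairing h1 h2.
  rewrite -integral21_prod_meas1//; apply: integral0_eq => y _; rewrite /fubini_G.
  have [yI|yI] := pselect (`](- pi)%R, pi%R]%classic y); last first.
    apply: integral0_eq => x _; rewrite /g patchE ifF//; apply/negP => /set_mem[_ yI'].
    exact: yI.
  rewrite -(integral_cos_period h.1 (h.2%:~R * y) h1) [RHS]integral_mkcond.
  apply: eq_integral => x _; rewrite /g !patchE.
  have -> : ((x, y) \in @torus R) = (x \in `](- pi)%R, pi%R]%classic).
    by apply/idP/idP => /set_mem xI; apply/mem_set => //; case: xI.
  by [].
rewrite -integral12_prod_meas1//; apply: integral0_eq => x _; rewrite /fubini_F.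
have [xI|xI] := pselect (`](- pi)%R, pi%R]%classic x); last first.
  apply: integral0_eq => y _; rewrite /g patchE ifF//; apply/negP => /set_mem[xI' _].
  exact: xI.
rewrite -(integral_cos_period h.2 (h.1%:~R * x) h2) [RHS]integral_mkcond.
apply: eq_integral => y _; rewrite /g !patchE.
have -> : ((x, y) \in @torus R) = (y \in `](- pi)%R, pi%R]%classic).
  by apply/idP/idP => /set_mem yI; apply/mem_set => //; case: yI.
by case: ifP => // _; rewrite /= /cosw /inner addrC.
Qed.

End TorusIntegral.

(** * Parseval's identity *)

Section Parseval.
Context {R : realType}.
Notation TI := (@torus_int R).
Notation trigZG := (trig (@ZG R)).

(** A cosine coefficient; for a function that is even on the torus, this is its
    Fourier coefficient. *)
Definition coefw (g : R * R -> R) (h : int * int) : R := TI (fun l => g l * cosw h l).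

(** Uniform limits of cosine polynomials on the torus. These functions are even,
    and the cosines are complete for them, so that no sine coefficients occur. *)
Definition tapprox (f : R * R -> R) := forall e : R, 0 < e ->
  exists2 p, trigZG p & forall l, torus l -> `|f l - p l| <= e.

Lemma tbounded_trig p : trigZG p -> tbounded p.
Proof.
elim=> {p} [g _|a p q _ tp _ tq]; first exact: tbounded_wave.
by apply: tboundedD => //; exact: tboundedZ.
Qed.

Lemma tbounded_tapprox f : tapprox f -> tbounded f.
Proof.
move=> af; split.
  have ex (n : nat) : exists p, trigZG p /\ forall l, torus l -> `|f l - p l| <= n.+1%:R^-1.
    have [|p tp hp] := af n.+1%:R^-1; first by rewrite invr_gt0.
    by exists p.
  have [p hp] := choice ex.
  apply: (@measurable_fun_cvg _ _ _ _ p).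
    by move=> n; exact: (tbounded_trig _ (hp n).1).1.
  move=> l tl; apply/cvgrPdist_le => e e0.
  have /cvgrPdist_le/(_ _ e0) [N _ hN] := @cvg_harmonic R.
  exists N => // n Nn; apply: (le_trans ((hp n).2 _ tl)).
  have := hN _ Nn; rewrite /= sub0r normrN; exact: le_trans (ler_norm _).
have [|p tp hp] := af 1; first exact: ltr01.
have [_ [M hM]] := tbounded_trig _ tp.
exists (M + 1) => l tl; rewrite -(subrK (p l) (f l)) addrC (le_trans (ler_normD _ _))//.
by apply: lerD; [exact: hM|exact: hp].
Qed.

Lemma tapproxD f g : tapprox f -> tapprox g -> tapprox (fun l => f l + g l).
Proof.
move=> af ag e e0; have e2 : 0 < e / 2 by rewrite divr_gt0.
have [p tp hp] := af _ e2; have [q tq hq] := ag _ e2.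
exists (fun l => p l + q l); first exact: trigD.
move=> l tl; rewrite (_ : f l + g l - _ = (f l - p l) + (g l - q l)); last by ring.
rewrite (le_trans (ler_normD _ _))// [leRHS]splitr.
by apply: lerD; [exact: hp|exact: hq].
Qed.

Lemma tapproxM f g : tapprox f -> trigZG g -> tapprox (fun l => f l * g l).
Proof.
move=> af tg e e0; have [_ [M hM]] := tbounded_trig _ tg.
have M1 : 0 < `|M| + 1 by rewrite ltr_wpDl.
have [|p tp hp] := af (e / (`|M| + 1)); first by rewrite divr_gt0.
exists (fun l => p l * g l).
  by apply: trigM => //; [exact: ZG0|exact: ZG_add|exact: ZG_sub].
move=> l tl; rewrite -mulrBl normrM.
apply: (@le_trans _ _ (e / (`|M| + 1) * (`|M| + 1))); last by rewrite divfK// gt_eqF.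
apply: ler_pM => //; first exact: hp.
by apply: (le_trans (hM _ tl)); have := ler_norm M; lra.
Qed.

Lemma tapproxZ a f : tapprox f -> tapprox (fun l => a * f l).
Proof.
move=> af; have := tapproxM _ _ af (trig_cst (@ZG R) (@ZG0 R) a).
by under eq_fun do rewrite mulrC.
Qed.

Lemma cvg_lin (a l m : R) (u v : nat -> R) : u @ \oo --> l -> v @ \oo --> m ->
  (fun n => u n + a * v n) @ \oo --> l + a * m.
Proof. by move=> ul vm; apply: (@cvgD _ R^o) => //; apply: cvgM => //; exact: cvg_cst. Qed.

Lemma TI_lin a f g : tbounded f -> tbounded g ->
  TI (fun l => f l + a * g l) = TI f + a * TI g.
Proof.
by move=> tf tg; rewrite (TID f (fun l => a * g l) tf (tboundedZ a g tg)) TIZ.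
Qed.

Lemma coefwN g h : coefw g (- h) = coefw g h.
Proof. by rewrite /coefw coswN. Qed.

Lemma coefw_lin f g a h : tbounded f -> tbounded g ->
  coefw (fun l => f l + a * g l) h = coefw f h + a * coefw g h.
Proof.
move=> tf tg; rewrite /coefw -TIZ; last by apply: tboundedM => //; exact: tbounded_cosw.
rewrite -TID.
- by congr TI; apply/funext => l; ring.
- by apply: tboundedM => //; exact: tbounded_cosw.
- by apply: tboundedZ; apply: tboundedM => //; exact: tbounded_cosw.
Qed.

Lemma TI_coswM h k : TI (fun l => cosw h l * cosw k l) =
  2^-1 * ((h == - k)%:R + (h == k)%:R).
Proof.
under eq_fun do rewrite coswM.
rewrite TIZ; last by apply: tboundedD; exact: tbounded_cosw.
rewrite TID; [|exact: tbounded_cosw|exact: tbounded_cosw].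
have e (x : int * int) : TI (cosw x) = (x == 0)%:R.
  have [->|x0] := eqVneq x 0; last by rewrite TI_cosw.
  have -> : @cosw R 0 = fun=> 1; last exact: TI_cst.
  by apply/funext => l; rewrite /cosw /inner !mul0r addr0 cos0.
by rewrite !e subr_eq0 addr_eq0.
Qed.

Lemma sum_eq_seq (s : seq (int * int)) (F : int * int -> R) k : uniq s -> k \in s ->
  \sum_(h <- s) F h * (h == k)%:R = F k.
Proof.
move=> us ks; rewrite (bigD1_seq k)//= eqxx mulr1 big1 ?addr0// => h hk.
by rewrite (negbTE hk) mulr0.
Qed.

Lemma oppr_box M (h : int * int) : (- h \in box M) = (h \in box M).
Proof. by rewrite !mem_box /= !normrN. Qed.

Lemma sum_box_sym (sg : int * int -> int * int) M (u : int * int -> R) :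
  involutive sg -> (forall h, (sg h \in box M) = (h \in box M)) ->
  \sum_(h <- box M) u (sg h) = \sum_(h <- box M) u h.
Proof.
move=> sgK sgM; rewrite -(big_map sg xpredT u); apply: perm_big.
apply: uniq_perm; [by rewrite map_inj_uniq ?uniq_box//; exact: inv_inj|exact: uniq_box|].
by move=> h; rewrite -[h in LHS]sgK mem_map ?sgM//; exact: inv_inj.
Qed.

Lemma sum_boxN M (F : int * int -> R) : \sum_(h <- box M) F (- h) = \sum_(h <- box M) F h.
Proof. by apply: (sum_box_sym -%R); [exact: opprK|exact: oppr_box]. Qed.

(** For a wave the sum is finite: both k and - k contribute one half of the
    coefficient of g. *)
Lemma cvg_coefw_trig g p : tbounded g -> trigZG p ->
  \sum_(h <- box M) coefw g h * coefw p h @[M --> \oo] --> TI (fun l => g l * p l).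
Proof.
move=> tg; elim=> {p} [_ [k ->]|a p q tp ihp tq ihq].
  rewrite -cosw_wave; have [M0 hM0] := sub_box [:: k].
  have kM M : (M0 <= M)%N -> k \in box M.
    move=> MM; have := hM0 k; rewrite inE eqxx => /(_ isT).
    by rewrite !mem_box; case: k {hM0} => x y /=; lia.
  apply: cvg_near_cst; exists M0 => // M /= /kM kb; rewrite -[RHS]/(coefw g k).
  transitivity (\sum_(h <- box M) (2^-1 * (coefw g h * (h == - k)%:R) +
     2^-1 * (coefw g h * (h == k)%:R))).
    by apply: eq_bigr => h _; rewrite [coefw (cosw _) _]/coefw; under eq_fun do rewrite mulrC;
       rewrite TI_coswM; ring.
  rewrite big_split /= -!mulr_sumr !sum_eq_seq ?uniq_box ?oppr_box// coefwN.
  by field.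
have -> : TI (fun l => g l * (p l + a * q l)) =
   TI (fun l => g l * p l) + a * TI (fun l => g l * q l).
  have bp := tbounded_trig _ tp; have bq := tbounded_trig _ tq.
  rewrite -(TI_lin a _ _ (tboundedM _ _ tg bp) (tboundedM _ _ tg bq)).
  by congr TI; apply/funext => l; ring.
have -> : (fun M => \sum_(h <- box M) coefw g h * coefw (fun l => p l + a * q l) h) =
   (fun M => \sum_(h <- box M) coefw g h * coefw p h +
     a * \sum_(h <- box M) coefw g h * coefw q h).
  apply/funext => M; rewrite mulr_sumr -big_split /=; apply: eq_bigr => h _.
  by rewrite (coefw_lin _ _ _ _ (tbounded_trig _ tp) (tbounded_trig _ tq)); ring.
exact: cvg_lin.
Qed.

(** The projection S of g on the waves of the box satisfies
    0 <= TI((g - S) ^ 2) = TI(g ^ 2) - TI(S ^ 2). *)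
Lemma bessel g M : tbounded g ->
  \sum_(h <- box M) coefw g h ^+ 2 <= TI (fun l => g l ^+ 2).
Proof.
move=> tg; pose S l := \sum_(h <- box M) coefw g h * cosw h l.
have tS : tbounded S by apply: tbounded_sum => h; apply: tboundedZ; exact: tbounded_cosw.
have TgS f : tbounded f -> TI (fun l => f l * S l) = \sum_(h <- box M) coefw g h * coefw f h.
  move=> tf; rewrite -[RHS]/(\sum_(h <- box M) coefw g h * TI (fun l => f l * cosw h l)).
  have tc h : tbounded (fun l => f l * cosw h l) by apply: tboundedM => //; exact: tbounded_cosw.
  transitivity (TI (fun l => \sum_(h <- box M) coefw g h * (f l * cosw h l))).
    by congr TI; apply/funext => l; rewrite mulr_sumr; apply: eq_bigr => h _; ring.
  rewrite TI_sum; last by move=> h; exact: tboundedZ.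
  by apply: eq_bigr => h _; exact: TIZ.
have cS h : h \in box M -> coefw S h = coefw g h.
  move=> hM; rewrite /coefw; under eq_fun do rewrite mulrC.
  rewrite (TgS _ (tbounded_cosw h)).
  transitivity (\sum_(k <- box M) (2^-1 * (coefw g k * (k == - h)%:R) +
     2^-1 * (coefw g k * (k == h)%:R))).
    apply: eq_bigr => k _; rewrite [coefw (cosw _) _]/coefw TI_coswM.
    by rewrite (eq_sym h k) -(eqr_oppLR k h) (eq_sym (- k) h) ; ring.
  rewrite big_split /= -!mulr_sumr !sum_eq_seq ?uniq_box ?oppr_box// coefwN.
  by rewrite -[RHS]/(coefw g h); field.
have h0 : 0 <= TI (fun l => (g l - S l) ^+ 2).
  rewrite -[leLHS](TI_cst 0); apply: TI_le.
  - exact: tbounded_cst.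
  - under eq_fun do rewrite expr2 -mulN1r.
    by apply: tboundedM; apply: tboundedD => //; exact: tboundedZ.
  - by move=> l _; exact: sqr_ge0.
have e : TI (fun l => (g l - S l) ^+ 2) =
   TI (fun l => g l ^+ 2) + (-2) * TI (fun l => g l * S l) + TI (fun l => S l * S l).
  rewrite -TI_lin -?TID.
  - by congr TI; apply/funext => l; ring.
  - by apply: tboundedD; [under eq_fun do rewrite expr2|apply: tboundedZ]; exact: tboundedM.
  - exact: tboundedM.
  - by under eq_fun do rewrite expr2; exact: tboundedM.
  - exact: tboundedM.
move: h0; rewrite e !TgS//.
have -> : \sum_(h <- box M) coefw g h * coefw S h = \sum_(h <- box M) coefw g h ^+ 2.
  by apply: eq_big_seq => h hM; rewrite cS.
under [X in -2 * X]eq_bigr do rewrite -expr2.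
lra.
Qed.

(** With p close to f, the inequality (x - y) ^ 2 >= 0 bounds the sum for f from
    below by sums involving p, which converge to TI(f ^ 2) - TI((f - p) ^ 2). *)
Lemma parseval f : tapprox f ->
  \sum_(h <- box M) coefw f h ^+ 2 @[M --> \oo] --> TI (fun l => f l ^+ 2).
Proof.
move=> af; have tf := tbounded_tapprox _ af.
apply/cvgrPdist_le => e e0.
have e2 : 0 < e / 2 by rewrite divr_gt0.
have s0 : 0 < Num.sqrt (e / 2) by rewrite sqrtr_gt0.
have [p tp hp] := af _ s0; have bp := tbounded_trig _ tp.
have c1 := cvg_coefw_trig _ _ tf tp.
have c2 := cvg_coefw_trig _ _ bp tp.
have c : (fun M => 2 * \sum_(h <- box M) coefw f h * coefw p h +
    (-1) * \sum_(h <- box M) coefw p h * coefw p h) @ \oo -->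
    2 * TI (fun l => f l * p l) + (-1) * TI (fun l => p l * p l).
  by apply: cvg_lin => //; apply: cvgM => //; exact: cvg_cst.
have /cvgrPdist_le/(_ _ e2) := c.
apply: filterS => M /= hM.
have lo : 2 * \sum_(h <- box M) coefw f h * coefw p h +
    (-1) * \sum_(h <- box M) coefw p h * coefw p h <= \sum_(h <- box M) coefw f h ^+ 2.
  rewrite !mulr_sumr -big_split /=; apply: ler_sum => h _.
  by rewrite -subr_ge0; apply: le_trans (sqr_ge0 (coefw f h - coefw p h)) _; rewrite le_eqVlt; apply/orP; left; apply/eqP; ring.
have up := bessel f M tf.
have d : TI (fun l => f l ^+ 2) - (2 * TI (fun l => f l * p l) + (-1) * TI (fun l => p l * p l)) <= e / 2.
  rewrite -[leRHS](TI_cst (e / 2)).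
  have tb : tbounded (fun l => 2 * (f l * p l) + -1 * (p l * p l)).
    by apply: tboundedD; apply: tboundedZ; exact: tboundedM.
  have tf2 : tbounded (fun l => f l ^+ 2) by under eq_fun do rewrite expr2; exact: tboundedM.
  rewrite (_ : _ - _ = TI (fun l => f l ^+ 2 + -1 * (2 * (f l * p l) + -1 * (p l * p l)))); last first.
    by rewrite TI_lin// TI_lin ?TIZ ?mulN1r//; [exact: tboundedM|apply: tboundedZ; exact: tboundedM|exact: tboundedM].
  apply: TI_le; [by apply: tboundedD => //; exact: tboundedZ|exact: tbounded_cst|].
  move=> l tl; rewrite (_ : _ + _ = `|f l - p l| ^+ 2); last by rewrite real_normK ?num_real//; ring.
  rewrite -[leRHS]sqr_sqrtr ?(ltW e2)// ler_sqr ?nnegrE ?(ltW s0)//; exact: hp.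
have {}hM := le_trans (ler_norm _) hM.
rewrite ger0_norm ?subr_ge0//; lra.
Qed.

Lemma parseval2 f g : tapprox f -> tapprox g ->
  \sum_(h <- box M) coefw f h * coefw g h @[M --> \oo] --> TI (fun l => f l * g l).
Proof.
move=> af ag; have tf := tbounded_tapprox _ af; have tg := tbounded_tapprox _ ag.
have P1 := parseval _ (tapproxD _ _ af (tapproxZ 1 _ ag)).
have P2 := parseval _ (tapproxD _ _ af (tapproxZ (-1) _ ag)).
have -> : TI (fun l => f l * g l) = 4^-1 * (TI (fun l => (f l + 1 * g l) ^+ 2) +
     (-1) * TI (fun l => (f l + -1 * g l) ^+ 2)).
  have ts a : tbounded (fun l => (f l + a * g l) ^+ 2).
    by under eq_fun do rewrite expr2; apply: tboundedM; apply: tboundedD => //; exact: tboundedZ.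
  rewrite -TI_lin// -TIZ; last by apply: tboundedD => //; exact: tboundedZ.
  by congr TI; apply/funext => l; field.
have -> : (fun M => \sum_(h <- box M) coefw f h * coefw g h) =
  (fun M => 4^-1 * (\sum_(h <- box M) coefw (fun l => f l + 1 * g l) h ^+ 2 +
     (-1) * \sum_(h <- box M) coefw (fun l => f l + -1 * g l) h ^+ 2)).
  apply/funext => M; rewrite [X in _ + X]mulr_sumr -big_split /= mulr_sumr.
  by apply: eq_bigr => h _; rewrite !coefw_lin//; field.
by apply: cvgM; [exact: cvg_cst|exact: cvg_lin].
Qed.

Lemma trig_cosw h : trigZG (cosw h).
Proof. by rewrite cosw_wave; apply: trig_wave; exists h. Qed.

Lemma coefw_cosw f z h : tbounded f ->
  coefw (fun l => f l * cosw z l) h = 2^-1 * (coefw f (h + z) + coefw f (h - z)).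
Proof.
move=> tf; rewrite /coefw -TID.
- rewrite -TIZ; last by apply: tboundedD; apply: tboundedM => //; exact: tbounded_cosw.
  by congr TI; apply/funext => l; rewrite -mulrA (mulrC (cosw z l)) coswM; ring.
- by apply: tboundedM => //; exact: tbounded_cosw.
- by apply: tboundedM => //; exact: tbounded_cosw.
Qed.

(** Multiplication by cosw z averages the translations of the coefficients by z and
    - z, and both have the same correlation since the coefficients are even. *)
Lemma parseval_lag f z : tapprox f ->
  \sum_(h <- box M) coefw f h * coefw f (h + z) @[M --> \oo] -->
    TI (fun l => f l ^+ 2 * cosw z l).
Proof.
move=> af; have tf := tbounded_tapprox _ af.
have := parseval2 _ _ af (tapproxM _ _ af (trig_cosw z)).
have -> : (fun l => f l * (f l * cosw z l)) = (fun l => f l ^+ 2 * cosw z l).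
  by apply/funext => l; ring.
have -> // : (fun M => \sum_(h <- box M) coefw f h * coefw (fun l => f l * cosw z l) h) =
  (fun M => \sum_(h <- box M) coefw f h * coefw f (h + z)).
apply/funext => M; under eq_bigr do rewrite coefw_cosw// mulrCA mulrDr.
rewrite -mulr_sumr big_split /=.
rewrite -(sum_boxN M (fun h => coefw f h * coefw f (h - z))).
under [X in _ + X]eq_bigr do rewrite coefwN -opprD coefwN.
by field.
Qed.

(** Translating both factors of the correlation sum does not change its limit: up
    to polarization, it is a difference of two sums of nonnegative terms, which do
    not depend on the origin. *)
Lemma parseval_shift f x y : tapprox f ->
  \sum_(h <- box M) coefw f (h + x) * coefw f (h + y) @[M --> \oo] -->
    TI (fun l => f l ^+ 2 * cosw (y - x) l).
Proof.
move=> af; have tf := tbounded_tapprox _ af.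
pose z := y - x; pose r := coefw f.
pose A (b : bool) h := (r h + (-1) ^+ b * r (h + z)) ^+ 2.
pose K := 2 * lattice_sum (fun h => r h ^+ 2) + 2 * lattice_sum (fun h => r h ^+ 2).
have r0 h : 0 <= r h ^+ 2 by exact: sqr_ge0.
have rK M : \sum_(h <- box M) r h ^+ 2 <= TI (fun l => f l ^+ 2) by exact: bessel.
have A0 b h : 0 <= A b h by exact: sqr_ge0.
have AK b M : \sum_(h <- box M) A b h <= K.
  apply: (@le_trans _ _ (2 * \sum_(h <- box M) r h ^+ 2 +
     2 * \sum_(h <- [seq h + z | h <- box M]) r h ^+ 2)).
    rewrite [X in _ + _ * X]big_map !mulr_sumr -big_split /=; apply: ler_sum => h _.
    have := sqr_ge0 (r h - (-1) ^+ b * r (h + z)).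
    rewrite /A !sqrrD !mulrN sqrrN !exprMn sqrr_sign; lra.
  apply: lerD; apply: ler_wpM2l => //; apply: (sum_le_lattice_sum _ _ r0 rK).
    exact: uniq_box.
  by rewrite map_inj_uniq ?uniq_box//; exact: addIr.
have cS b u := cvg_shift_lattice_sum (A b) K (A0 b) (AK b) u.
have := cvg_lin (-1) _ _ _ _ (cS false x) (cS true x).
have := cvg_lin (-1) _ _ _ _ (cS false 0) (cS true 0).
have -> u : (fun M => \sum_(h <- box M) A false (h + u) + -1 * \sum_(h <- box M) A true (h + u)) =
   (fun M => 4 * \sum_(h <- box M) r (h + u) * r (h + (u + z))).
  apply/funext => M; rewrite !mulr_sumr -big_split /=; apply: eq_bigr => h _.
  by rewrite /A -(addrA h u z) expr0 expr1; ring.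
have -> u : (fun M => \sum_(h <- box M) A false (h + u) + -1 * \sum_(h <- box M) A true (h + u)) =
   (fun M => 4 * \sum_(h <- box M) r (h + u) * r (h + (u + z))).
  apply/funext => M; rewrite !mulr_sumr -big_split /=; apply: eq_bigr => h _.
  by rewrite /A -(addrA h u z) expr0 expr1; ring.
rewrite (_ : x + z = y); last by rewrite /z addrC subrK.
set L := lattice_sum _ + _ => c0 cx.
have lag := parseval_lag f z af.
have eL : L = 4 * TI (fun l => f l ^+ 2 * cosw z l).
  apply: (cvg_unique _ c0) => //; apply: cvgM; first exact: cvg_cst.
  by under eq_fun do under eq_bigr do rewrite addr0 add0r; exact: lag.
have -> : TI (fun l => f l ^+ 2 * cosw (y - x) l) = 4^-1 * L by rewrite eL; field.
have -> : (fun M => \sum_(h <- box M) coefw f (h + x) * coefw f (h + y)) =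
  (fun M => 4^-1 * (4 * \sum_(h <- box M) r (h + x) * r (h + y))).
  by apply/funext => M; rewrite mulKf.
by apply: cvgM => //; exact: cvg_cst.
Qed.

End Parseval.

Section StencilWeights.
Context {R : realType}.
Notation TI := (@torus_int R).

(** The corners of the square of side r - 1, for r = 1 or 2: the difference with
    step r is the sum over them of the differences with step 1. *)
Definition stencil (r : nat) : seq (int * int) :=
  if r == 1%N then [:: 0] else [:: 0; (1, 0); (0, 1); (1, 1)].

(** The squared modulus of the sum of e^(i <a, l>) over the stencil. *)
Definition stencil_weight (r : nat) (l : R * R) : R :=
  if r == 1%N then 1 else 16 * cos (l.1 / 2) ^+ 2 * cos (l.2 / 2) ^+ 2.

(** The sines cancel in the double sum over a and b, by symmetry. *)
Lemma stencil_weightE r l x :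
  \sum_(a <- stencil r) \sum_(b <- stencil r) cos (x + (inner b l - inner a l)) =
  stencil_weight r l * cos x.
Proof.
rewrite /stencil_weight /stencil; case: eqP => _.
  by rewrite !big_seq1 subrr addr0 mul1r.
rewrite !(big_cons, big_nil) /inner /= !mul0r !mul1r !addr0 !add0r.
have c2 (t : R) : 2 * cos (t / 2) ^+ 2 = 1 + cos t.
  by rewrite [t in RHS](_ : t = t / 2 + t / 2); [rewrite cosD -!expr2 sin2cos2; ring|field].
have -> : 16 * cos (l.1 / 2) ^+ 2 * cos (l.2 / 2) ^+ 2 = 4 * (1 + cos l.1) * (1 + cos l.2).
  by rewrite -!c2; ring.
case: l {c2} => u v /=.
rewrite !(cosD, cosB, sinD, sinB, cosN, sinN, oppr0, subr0, cos0, sin0).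
have := sin2cos2 u; have := sin2cos2 v.
move: (cos u) (sin u) (cos v) (sin v) (cos x) (sin x) => cu su cv sv cx sx ev eu.
by ring: ev eu.
Qed.

End StencilWeights.

Section StencilParseval.
Context {R : realType}.
Notation TI := (@torus_int R).
Variable f : R * R -> R.
Hypothesis af : tapprox f.

(** The covariance between differences with steps r and s, when f is the spectral
    density of the differences with step 1. *)
Definition stencil_coefw (r s : nat) (h : int * int) : R :=
  \sum_(a <- stencil r) \sum_(b <- stencil s) coefw f (h + b - a).

(** Expanding the square gives correlations of the coefficients at lags
    b' - a' - (b - a), to which [parseval_shift] applies; the sum of the
    corresponding cosines factorizes. *)
Lemma cvg_stencil_parseval r s :
  \sum_(h <- box M) stencil_coefw r s h ^+ 2 @[M --> \oo] -->
    TI (fun l => stencil_weight r l * stencil_weight s l * f l ^+ 2).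
Proof.
have tf := tbounded_tapprox _ af.
pose lim a a' b b' := TI (fun l => f l ^+ 2 * cosw (b' - a' - (b - a)) l).
have -> : TI (fun l => stencil_weight r l * stencil_weight s l * f l ^+ 2) =
    \sum_(a <- stencil r) \sum_(a' <- stencil r) \sum_(b <- stencil s) \sum_(b' <- stencil s)
      lim a a' b b'.
  have tl z : tbounded (fun l => f l ^+ 2 * cosw z l).
    by apply: tboundedM; [under eq_fun do rewrite expr2; exact: tboundedM|exact: tbounded_cosw].
  transitivity (TI (fun l => \sum_(a <- stencil r) \sum_(a' <- stencil r) \sum_(b <- stencil s)
      \sum_(b' <- stencil s) f l ^+ 2 * cosw (b' - a' - (b - a)) l)); last first.
    rewrite TI_sum; last by move=> ?; do 3! (apply: tbounded_sum => ?).
    apply: eq_bigr => a _; rewrite TI_sum; last by move=> ?; do 2! (apply: tbounded_sum => ?).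
    apply: eq_bigr => a' _; rewrite TI_sum; last by move=> ?; apply: tbounded_sum => ?.
    by apply: eq_bigr => b _; rewrite TI_sum.
  congr TI; apply/funext => l.
  transitivity (\sum_(a <- stencil r) \sum_(a' <- stencil r)
     f l ^+ 2 * (stencil_weight s l * cos (0 + (inner a l - inner a' l)))).
    under eq_bigr do rewrite -mulr_sumr -mulr_sumr.
    rewrite -!mulr_sumr exchange_big /= stencil_weightE cos0; ring.
  apply: eq_bigr => a _; apply: eq_bigr => a' _.
  rewrite -stencil_weightE mulr_sumr; apply: eq_bigr => b _.
  rewrite mulr_sumr; apply: eq_bigr => b' _; rewrite /cosw; congr (_ * cos _).
  by rewrite /inner /= !(intrD, intrB, opprD, opprK); ring.
have -> : (fun M => \sum_(h <- box M) stencil_coefw r s h ^+ 2) = (fun M =>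
    \sum_(a <- stencil r) \sum_(a' <- stencil r) \sum_(b <- stencil s) \sum_(b' <- stencil s)
     \sum_(h <- box M) coefw f (h + (b - a)) * coefw f (h + (b' - a'))).
  apply/funext => M.
  under [RHS]eq_bigr do under eq_bigr do under eq_bigr do rewrite exchange_big /=.
  under [RHS]eq_bigr do under eq_bigr do rewrite exchange_big /=.
  under [RHS]eq_bigr do rewrite exchange_big /=.
  rewrite [RHS]exchange_big /=; apply: eq_bigr => h _.
  rewrite expr2 /stencil_coefw mulr_suml; apply: eq_bigr => a _.
  rewrite mulr_sumr; apply: eq_bigr => a' _.
  rewrite mulr_suml; apply: eq_bigr => b _.
  by rewrite mulr_sumr; apply: eq_bigr => b' _; rewrite !addrA.
do 4! (apply: cvg_finsum => ?).
exact: parseval_shift.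
Qed.

Lemma stencil_coefw_bound r s M : \sum_(h <- box M) stencil_coefw r s h ^+ 2 <=
  TI (fun l => stencil_weight r l * stencil_weight s l * f l ^+ 2).
Proof.
have c := cvg_stencil_parseval r s.
rewrite -(cvg_lim (@Rhausdorff R) c).
apply: (nondecreasing_cvgn_le (u_ := fun M => \sum_(h <- box M) stencil_coefw r s h ^+ 2)).
  apply/nondecreasing_seqP => N; apply: sum_subset; first by move=> h; exact: sqr_ge0.
    exact: uniq_box.
  by move=> h; rewrite !mem_box => /andP[h1 h2]; apply/andP; split;
     [apply: le_trans h1 _|apply: le_trans h2 _]; rewrite lez_nat.
by apply: cvgP c.
Qed.

Lemma lattice_sum_stencil r s : lattice_sum (fun h => stencil_coefw r s h ^+ 2) =
  TI (fun l => stencil_weight r l * stencil_weight s l * f l ^+ 2).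
Proof. by apply: cvg_lim => //; exact: cvg_stencil_parseval. Qed.

End StencilParseval.

(** * Even functions and cosine polynomials *)

Section EvenPeriodic.
Context {R : realType}.

Let der0 : cos_der 0 (0 : R) = 1.
Proof. by rewrite /cos_der mul0r addr0 cos0. Qed.

Let der1 : cos_der 1 (0 : R) = 0.
Proof. by rewrite /cos_der mul1r add0r cos_pihalf. Qed.

Let der2 : cos_der 2 (0 : R) = -1.
Proof. by rewrite /cos_der add0r mulrC divfK// cospi. Qed.

Let der3 : cos_der 3 (0 : R) = 0.
Proof.
rewrite /cos_der (_ : 0 + 3 * (pi / 2) = pi / 2 + pi); last by field.
by rewrite cosDpi cos_pihalf oppr0.
Qed.

Lemma one_cos_le (x : R) : 2 - 2 * cos x <= x ^+ 2.
Proof.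
have := cos_taylor 2 0 x; rewrite addr0 real_normK ?num_real//.
rewrite /cos_poly horner_poly !big_ord_recl big_ord0 /= der0 der1.
by rewrite ler_norml => /andP[+ _]; rewrite ?factS ?fact0; lra.
Qed.

Lemma one_cos_ge (x : R) : x ^+ 2 / 2 - x ^+ 4 / 24 <= 1 - cos x.
Proof.
have := cos_taylor 4 0 x; rewrite addr0 -normrX (ger0_norm (exprn_even_ge0 _ _))//.
rewrite /cos_poly horner_poly !big_ord_recl big_ord0 /= /bump /= der0 der1 der2 der3.
by rewrite ler_norml => /andP[_ +]; rewrite ?factS ?fact0 ?muln1 /=; lra.
Qed.

(** cos a - cos b = 2 sin ((a + b) / 2) sin ((b - a) / 2) is at least
    1 - cos (b - a), which is comparable to (b - a) ^ 2. *)
Lemma cos_separates : exists2 C : R, 0 <= C &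
  forall a b, 0 <= a <= pi -> 0 <= b <= pi -> (a - b) ^+ 2 <= C * `|cos a - cos b|.
Proof.
pose C : R := 24 / 11 * pi ^+ 2.
have p2 := pi_ge2 R.
have C0 : 0 <= C by rewrite mulr_ge0// sqr_ge0.
exists C => //.
have sq (v : R) : 0 <= v <= pi -> v ^+ 2 <= C * (1 - cos v).
  move=> /andP[v0 vp]; have [v1|v1] := leP v 1.
    have h := one_cos_ge v.
    have v2 : v ^+ 2 <= 1 by rewrite expr_le1.
    have v4 : v ^+ 4 <= v ^+ 2.
      by rewrite -[X in v ^+ X]/(2 + 2)%N exprD ler_piMr// sqr_ge0.
    have p4 : 1 <= pi ^+ 2 :> R by rewrite expr_ge1//; lra.
    have h2 : 11 / 24 * v ^+ 2 <= 1 - cos v by lra.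
    apply: (@le_trans _ _ (C * (11 / 24 * v ^+ 2))); last exact: ler_wpM2l.
    rewrite (_ : C * _ = pi ^+ 2 * v ^+ 2); last by rewrite /C; field.
    by rewrite ler_peMl// sqr_ge0.
  have : cos v < cos 1 by rewrite ltr_cos// in_itv /=; apply/andP; split; lra.
  have := one_cos_ge 1; rewrite !expr1n => h1 h2.
  apply: (@le_trans _ _ (pi ^+ 2)); first by rewrite ler_sqr ?nnegrE//; lra.
  apply: (@le_trans _ _ (C * (11 / 24))); last by apply: ler_wpM2l => //; lra.
  by rewrite le_eqVlt; apply/orP; left; apply/eqP; rewrite /C; field.
have ord a b : 0 <= a -> a <= b -> b <= pi -> (a - b) ^+ 2 <= C * `|cos a - cos b|.
  move=> a0 ab bp; rewrite -sqrrN opprB.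
  apply: (le_trans (sq (b - a) _)); first by apply/andP; split; lra.
  apply: ler_wpM2l => //; apply: le_trans (ler_norm _).
  pose m := (a + b) / 2; pose u := (b - a) / 2.
  have -> : a = m - u by rewrite /m /u; field.
  have eb : b = m + u by rewrite /m /u; field.
  rewrite [in X in _ <= X]eb (_ : b - _ = u + u); last by rewrite /m /u; field.
  have su : 0 <= sin u by apply: sin_ge0_pi; rewrite /u; apply/andP; split; lra.
  have sm : sin u <= sin m.
    rewrite -subr_ge0.
    have -> : sin m - sin u = 2 * cos ((m + u) / 2) * sin ((m - u) / 2).
      rewrite [X in sin X - _](_ : m = (m + u) / 2 + (m - u) / 2); last by field.
      rewrite [X in _ - sin X](_ : u = (m + u) / 2 - (m - u) / 2); last by field.
      by rewrite sinD sinB; ring.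
    apply: mulr_ge0; first apply: mulr_ge0 => //.
      by apply: cos_ge0_pihalf; rewrite -eb; apply/andP; split; lra.
    by apply: sin_ge0_pi; rewrite /m /u; apply/andP; split; lra.
  rewrite !cosD cosN sinN; have := cos2Dsin2 u.
  have : sin u * sin u <= sin m * sin u by exact: ler_wpM2r.
  by rewrite -!expr2; lra.
move=> a b /andP[a0 ap] /andP[b0 bp]; have [ab|ab] := leP a b; first exact: ord.
by rewrite -sqrrN opprB distrC; apply: ord => //; exact: ltW.
Qed.

(** In the variables (1 + cos l1) / 2 and (1 + cos l2) / 2 of the unit square, F has
    a modulus of continuity by [cos_separates], and Bernstein polynomials in these
    variables are cosine polynomials. *)
Lemma tapprox_even (F : R * R -> R) : continuous F ->
  (forall l, F (- l.1, l.2) = F l) -> (forall l, F (l.1, - l.2) = F l) -> tapprox F.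
Proof.
move=> cF F1 F2 e e0; have p0 := pi_gt0 R.
pose th (x : R) := acos (2 * x - 1).
have thI (x : R) : 0 <= x <= 1 -> 0 <= th x <= pi.
  by move=> hx; rewrite /th acos_ge0 ?acos_lepi//; lra.
have cth (x : R) : 0 <= x <= 1 -> cos (th x) = 2 * x - 1.
  by move=> hx; rewrite /th acosK// in_itv /=; lra.
have [C0 C00 hC0] := cos_separates.
have mod_th (e' : R) : 0 < e' -> exists2 C : R, 0 <= C & forall x x', 0 <= x <= 1 -> 0 <= x' <= 1 ->
    (th x - th x') ^+ 2 <= e' + C * (x - x') ^+ 2.
  move=> e'0; exists (C0 ^+ 2 / e'); first by rewrite divr_ge0 ?sqr_ge0// ltW.
  move=> x x' hx hx'; apply: (le_trans (hC0 _ _ (thI _ hx) (thI _ hx'))).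
  rewrite !cth//.
  rewrite (_ : 2 * x - 1 - _ = 2 * (x - x')); last by ring.
  rewrite normrM (ger0_norm (_ : (0 : R) <= 2))//.
  rewrite -(real_normK (num_real (x - x'))).
  move: (`|x - x'|) (normr_ge0 (x - x')) => t t0.
  rewrite -subr_ge0 (_ : _ - _ = (e' - C0 * t) ^+ 2 / e'); last by field; rewrite gt_eqF.
  by rewrite divr_ge0 ?sqr_ge0// ltW.
have mod_F (e1 : R) : 0 < e1 -> exists2 C : R, 0 <= C & forall x y x' y' : R,
    0 <= x <= 1 -> 0 <= y <= 1 -> 0 <= x' <= 1 -> 0 <= y' <= 1 ->
    `|F (th x, th y) - F (th x', th y')| <= e1 + C * ((x - x') ^+ 2 + (y - y') ^+ 2).
  move=> e10; have e12 : 0 < e1 / 2 by rewrite divr_gt0.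
  have [C1 C10 hC1] := quadratic_modulus F 0 pi cF _ e12.
  have e14 : 0 < e1 / 4 / (C1 + 1) by rewrite !divr_gt0// ltr_wpDl.
  have [C2 C20 hC2] := mod_th _ e14.
  exists (C1 * C2); first exact: mulr_ge0.
  move=> x y x' y' hx hy hx' hy'.
  apply: (le_trans (hC1 _ _ _ _ (thI _ hx) (thI _ hy) (thI _ hx') (thI _ hy'))).
  have h := ler_wpM2l C10 (lerD (hC2 _ _ hx hx') (hC2 _ _ hy hy')).
  have h' : C1 * (e1 / 4 / (C1 + 1)) <= e1 / 4.
    by rewrite mulrA ler_pdivrMr ?ltr_wpDl//; lra.
  by rewrite !mulrDr in h *; lra.
have [n hn] := bernstein2_approx (fun x y => F (th x, th y)) mod_F e e0.
exists (fun l => bernstein2 n (fun x y => F (th x, th y))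
   (2^-1 + 2^-1 * cosw (1, 0) l) (2^-1 + 2^-1 * cosw (0, 1) l)).
  have tc h : trig (@ZG R) (fun l => 2^-1 + 2^-1 * cosw h l).
    by apply: trig_lin; [apply: trig_cst; exact: ZG0|exact: trig_cosw].
  by apply: trig_bernstein2 => //; [exact: ZG0|exact: ZG_add|exact: ZG_sub].
move=> l [/=]; rewrite !in_itv /= => /andP[l1a l1b] /andP[l2a l2b].
have -> : cosw (1, 0) l = cos l.1 by rewrite /cosw /inner /= mul1r mul0r addr0.
have -> : cosw (0, 1) l = cos l.2 by rewrite /cosw /inner /= mul1r mul0r add0r.
have thc (x : R) : - pi < x -> x <= pi -> th (2^-1 + 2^-1 * cos x) = `|x|.
  move=> x1 x2; rewrite /th (_ : _ - 1 = cos x); last by field.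
  have [x0|x0] := leP 0 x.
    by rewrite ger0_norm//; apply: cosK; rewrite in_itv /= x0.
  by rewrite ltr0_norm//; apply: cosKN; apply/andP; split; exact: ltW.
have cI (x : R) : 0 <= 2^-1 + 2^-1 * cos x <= 1.
  by have := cos_geN1 x; have := cos_le1 x => h1 h2; apply/andP; split; lra.
have Fabs : F (`|l.1|, `|l.2|) = F l.
  rewrite [in RHS](surjective_pairing l).
  transitivity (F (l.1, `|l.2|)).
    have [x0|x0] := leP 0 l.1; first by rewrite ger0_norm.
    by rewrite [in LHS]ltr0_norm// (F1 (l.1, _)).
  have [x0|x0] := leP 0 l.2; first by rewrite ger0_norm.
  by rewrite ltr0_norm// (F2 (_, l.2)).
have := hn _ _ (cI l.1) (cI l.2).
by rewrite !thc// Fabs.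
Qed.

End EvenPeriodic.

(** * The spectral density is a uniform limit of trigonometric polynomials *)

Section Decay.
Context {R : realType}.
Variable phi : R.
Hypothesis phi0 : 0 < phi.

(** The terms of the folded density are C |x| ^ (- (2 + 2 phi)); they are written as
    functions of the squared norm. *)
Definition decay (x : R) : R := x `^ (- (1 + phi)).

Let exp0 : 0 < 1 + phi. Proof. by rewrite addr_gt0. Qed.

Lemma decay_ge0 x : 0 <= decay x. Proof. exact: powR_ge0. Qed.

Lemma le_decay x y : 0 < x -> x <= y -> decay y <= decay x.
Proof.
move=> x0 xy; rewrite /decay !powRN lef_pV2 ?posrE ?powR_gt0//; last exact: lt_le_trans xy.
by apply: ge0_ler_powR; rewrite ?nnegrE ?(ltW exp0) ?(ltW x0)// (le_trans (ltW x0)).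
Qed.

Lemma decayM x y : 0 <= x -> 0 <= y -> decay (x * y) = decay x * decay y.
Proof. exact: powRM. Qed.

(* the mean value inequality for x |-> x ^ (- phi), which makes the series of decay
   telescope *)
Let decay_step (x : R) : 1 <= x ->
  phi * decay (x + 1) <= x `^ (- phi) - (x + 1) `^ (- phi).
Proof.
move=> x1; have x0 : 0 < x by lra.
have y0 : 0 < x + 1 by lra.
have -> : decay (x + 1) = (x + 1) `^ (- phi) * (x + 1)^-1.
  rewrite /decay (_ : - (1 + phi) = - phi + -1); last by ring.
  rewrite powRD ?powR_inv1 ?(ltW y0)//.
  by apply/implyP => _; rewrite gt_eqF.
have -> : x `^ (- phi) = (x + 1) `^ (- phi) * (x / (x + 1)) `^ (- phi).
  by rewrite -powRM ?divr_ge0 ?(ltW x0) ?(ltW y0)// mulrC divfK// gt_eqF.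
have h : 1 + phi * (x + 1)^-1 <= (x / (x + 1)) `^ (- phi).
  rewrite /powR gt_eqF ?divr_gt0//; apply: (le_trans _ (expR_ge1Dx _)).
  rewrite lerD2l mulNr -mulrN ler_wpM2l ?(ltW phi0)// lerNr.
  rewrite (_ : x / (x + 1) = 1 + - (x + 1)^-1); last by field; rewrite gt_eqF.
  by apply: le_ln1Dx; rewrite ltrN2 invf_lt1//; lra.
have := ler_wpM2l (powR_ge0 (x + 1) (- phi)) h.
by rewrite mulrDr mulr1; lra.
Qed.

Lemma sum_decay n : \sum_(i < n) decay (1 + i%:R) <= 1 + phi^-1.
Proof.
suff h : \sum_(i < n.+1) decay (1 + i%:R) <= 1 + phi^-1 * (1 - (1 + n%:R) `^ (- phi)).
  have : \sum_(i < n) decay (1 + i%:R) <= \sum_(i < n.+1) decay (1 + i%:R).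
    by rewrite big_ord_recr /= lerDl decay_ge0.
  move/le_trans; apply; apply: (le_trans h); rewrite lerD2l ler_piMr ?invr_ge0 ?(ltW phi0)//.
elim: n => [|n ih].
  by rewrite big_ord1 addr0 /decay !powR1 subrr mulr0 addr0.
rewrite big_ord_recr /=; apply: (le_trans (lerD ih (lexx _))).
have -> : (1 + n.+1%:R : R) = 1 + n%:R + 1 by rewrite -addrA natr1.
have := decay_step (1 + n%:R); rewrite lerDl ler0n => /(_ isT) h.
have h' : decay (1 + n%:R + 1) <= phi^-1 * ((1 + n%:R) `^ (- phi) - (1 + n%:R + 1) `^ (- phi)).
  by rewrite ler_pdivlMl.
by move: h'; rewrite !mulrBr; lra.
Qed.

(** A product bound: u ^ 2 + v ^ 2 >= u v turns the decay of the plane into a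
    product of summable sequences. *)
Definition lattice_decay (k : int * int) : R :=
  decay ((1 + `|k.1%:~R|) * (1 + `|k.2%:~R|)).

(** A box is covered by four copies of a square of nonnegative integers. *)
Lemma sum_lattice_decay M : \sum_(k <- box M) lattice_decay k <= 4 * (1 + phi^-1) ^+ 2.
Proof.
have [m mE] : exists m, m = M.+1 by exists M.+1.
pose s := cube m ++ [seq (- h.1, h.2) | h <- cube m] ++ [seq (h.1, - h.2) | h <- cube m]
   ++ [seq (- h.1, - h.2) | h <- cube m].
have d0 k : 0 <= lattice_decay k by exact: decay_ge0.
apply: (le_trans (sum_subset _ s _ d0 (uniq_box M) _)).
  move=> [a b]; rewrite mem_box /= !ler_norml => /andP[/andP[a1 a2] /andP[b1 b2]].
  have inc u v : 0 <= u <= M%:Z -> 0 <= v <= M%:Z -> (u, v) \in cube m.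
    by move=> hu hv; rewrite mem_cube mE /=; lia.
  rewrite /s !mem_cat; have [a0|a0] := leP 0 a; have [b0|b0] := leP 0 b.
  - by rewrite inc//; lia.
  - have -> : ((a, b) \in [seq (h.1, - h.2) | h <- cube m]); last by rewrite !orbT.
    by apply/mapP; exists (a, - b); rewrite ?opprK// inc//; lia.
  - have -> : ((a, b) \in [seq (- h.1, h.2) | h <- cube m]); last by rewrite !orbT.
    by apply/mapP; exists (- a, b); rewrite ?opprK// inc//; lia.
  - have -> : ((a, b) \in [seq (- h.1, - h.2) | h <- cube m]); last by rewrite !orbT.
    by apply/mapP; exists (- a, - b); rewrite ?opprK// inc//; lia.
rewrite /s !big_cat /= !big_map /lattice_decay /=.
under [X in _ + (X + _)]eq_bigr do rewrite mulrNz normrN.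
under [X in _ + (_ + (X + _))]eq_bigr do rewrite mulrNz normrN.
under [X in _ + (_ + (_ + X))]eq_bigr do rewrite !mulrNz !normrN.
set S := \sum_(h <- _) _.
suff : S <= (1 + phi^-1) ^+ 2 by lra.
have -> : S = (\sum_(i < m) decay (1 + i%:R)) ^+ 2.
  rewrite /S -sum_Lambda.
  rewrite -(pair_bigA _ (fun i j : 'I_m => decay ((1 + `|(Posz i)%:~R|) * (1 + `|(Posz j)%:~R|)))) /=.
  rewrite expr2 mulr_suml; apply: eq_bigr => i _.
  rewrite mulr_sumr; apply: eq_bigr => j _.
  by rewrite decayM ?addr_ge0// !ger0_norm// ?ler0n.
rewrite ler_sqr ?nnegrE ?sum_decay//.
  by apply: sumr_ge0 => i _; exact: decay_ge0.
by rewrite addr_ge0// invr_ge0 ltW.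
Qed.

End Decay.

Section LatticeEsum.
Context {R : realType}.

(** Every finite set of indices is contained in a box. *)
Lemma esum_lattice (A : int * int -> R) (K : R) : (forall h, 0 <= A h) ->
  (forall M, \sum_(h <- box M) A h <= K) ->
  fine (\esum_(k in [set: int * int]) (A k)%:E) = lattice_sum A.
Proof.
move=> A0 AK; suff -> : (\esum_(k in [set: int * int]) (A k)%:E = (lattice_sum A)%:E)%E by [].
apply/eqP; rewrite eq_le; apply/andP; split.
  apply: ge_ereal_sup => _ [F [fF _] <-].
  rewrite fsbig_finite// sumEFin lee_fin.
  by apply: (sum_le_lattice_sum A K A0 AK); exact: finmap.fset_uniq.
apply/lee_addgt0Pr => e e0.
have [M hM] := lattice_sum_box A K A0 AK e e0.
apply: (@le_trans _ _ ((\sum_(h <- box M) A h)%:E + e%:E)%E).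
  by rewrite -EFinD lee_fin -lerBlDr.
rewrite leeD2r//; apply: esum_ge; exists [set` box M]; first by split=> //; exact: finite_seq.
by rewrite -fsbig_seq ?uniq_box// sumEFin.
Qed.

End LatticeEsum.

Section SpectralDensity.
Context {R : realType}.
Variables (phi C : R).
Hypotheses (phi0 : 0 < phi) (phi1 : phi < 1) (C0 : 0 <= C).

(** The factor |1 - e^(i l1)|^2 |1 - e^(i l2)|^2. *)
Definition gain (l : R * R) : R := (2 - 2 * cos l.1) * (2 - 2 * cos l.2).

Definition sqdist (k : int * int) (l : R * R) : R :=
  (l.1 + 2 * pi * k.1%:~R) ^+ 2 + (l.2 + 2 * pi * k.2%:~R) ^+ 2.

Lemma gain_ge0 l : 0 <= gain l.
Proof. by apply: mulr_ge0; [have := cos_le1 l.1|have := cos_le1 l.2]; lra. Qed.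

Lemma gain_le16 l : gain l <= 16.
Proof.
rewrite (_ : 16 = 4 * 4); last by ring.
by apply: ler_pM; have := cos_le1 l.1; have := cos_le1 l.2; have := cos_geN1 l.1;
  have := cos_geN1 l.2; lra.
Qed.

(** The gain vanishes at the origin to the order 4, beyond the order 2 + 2 phi of the
    pole. *)
Lemma gain_le l : gain l <= sqdist 0 l ^+ 2.
Proof.
apply: (@le_trans _ _ (l.1 ^+ 2 * l.2 ^+ 2)).
  by apply: ler_pM; rewrite ?one_cos_le//.
rewrite /sqdist /= mulr0 !addr0.
have := sqr_ge0 l.1; have := sqr_ge0 l.2; move: (l.1 ^+ 2) (l.2 ^+ 2) => a b b0 a0.
rewrite sqrrD; have := sqr_ge0 a; have := sqr_ge0 b; have := mulr_ge0 a0 b0; lra.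
Qed.

Lemma sqdist_ge0 k l : 0 <= sqdist k l.
Proof. by rewrite addr_ge0// sqr_ge0. Qed.

(** On the torus |x + 2 pi j| >= pi (2 |j| - 1) >= 1 + |j| for j != 0. *)
Lemma sqdist_ge k l : torus l -> k != 0 ->
  (1 + `|k.1%:~R|) * (1 + `|k.2%:~R|) <= sqdist k l.
Proof.
move=> [/=]; rewrite !in_itv /= => /andP[a1 a2] /andP[b1 b2] k0.
have p2 := pi_ge2 R.
have one (x : R) (j : int) : - pi < x -> x <= pi -> j != 0 ->
    2 <= 1 + `|j%:~R| :> R /\ 1 + `|j%:~R| <= `|x + 2 * pi * j%:~R|.
  move=> x1 x2 j0.
  have J1 : 1 <= `|j%:~R| :> R by rewrite -intr_norm ler1z -gtz0_ge1 normr_gt0.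
  split; first by lra.
  have := ler_normB (x + 2 * pi * j%:~R) x; rewrite addrAC subrr add0r normrM.
  rewrite (@ger0_norm _ (2 * pi)); last by lra.
  have : `|x| <= pi by rewrite ler_norml; apply/andP; split; lra.
  have : pi * (2 * `|j%:~R| - 1) >= 2 * (2 * `|j%:~R| - 1) :> R by apply: ler_wpM2r => //; lra.
  by lra.
have sq (u v : R) : 0 <= u -> u <= `|v| -> u ^+ 2 <= v ^+ 2.
  by move=> u0 uv; rewrite -(real_normK (num_real v)) ler_sqr ?nnegrE.
rewrite /sqdist; have [e1|n1] := eqVneq k.1 0.
  have n2 : k.2 != 0 by apply: contra_neq k0 => e2; rewrite (surjective_pairing k) e1 e2.
  have [g2 /sq h2] := one _ _ b1 b2 n2.
  rewrite e1 normr0 addr0 mul1r; apply: (@le_trans _ _ ((l.2 + 2 * pi * k.2%:~R) ^+ 2)).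
    by apply: le_trans (h2 _); rewrite ?expr2 ?ler_peMl//; lra.
  by rewrite lerDr sqr_ge0.
have [g1 /sq h1] := one _ _ a1 a2 n1.
have [e2|n2] := eqVneq k.2 0.
  rewrite e2 normr0 addr0 mulr1; apply: (@le_trans _ _ ((l.1 + 2 * pi * k.1%:~R) ^+ 2)).
    by apply: le_trans (h1 _); rewrite ?expr2 ?ler_peMl//; lra.
  by rewrite lerDl sqr_ge0.
have [g2 /sq h2] := one _ _ b1 b2 n2.
apply: (le_trans _ (lerD (h1 _) (h2 _))); try lra.
move: (1 + `|k.1%:~R|) (1 + `|k.2%:~R|) g1 g2 => a b ga gb.
have ab0 : 0 <= a * b by apply: mulr_ge0; lra.
by have := sqr_ge0 (a - b); rewrite sqrrB; lra.
Qed.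

Definition fold_term (k : int * int) (l : R * R) : R := C * decay phi (sqdist k l).

Lemma fold_term_ge0 k l : 0 <= fold_term k l.
Proof. by rewrite mulr_ge0// decay_ge0. Qed.

Lemma fold_term_le k l : torus l -> k != 0 -> fold_term k l <= C * lattice_decay phi k.
Proof.
move=> tl k0; apply: ler_wpM2l => //; apply: le_decay => //; last exact: sqdist_ge.
Qed.

Let Kd := 4 * (1 + phi^-1) ^+ 2.

Lemma sum_fold_term M l : torus l ->
  \sum_(k <- box M) fold_term k l <= fold_term 0 l + C * Kd.
Proof.
move=> tl; rewrite (bigD1_seq 0) ?uniq_box//=; last by rewrite mem_box /=; lia.
rewrite lerD2l; apply: (@le_trans _ _ (C * \sum_(k <- box M) lattice_decay phi k)).
  rewrite mulr_sumr [leRHS](bigD1_seq 0) ?uniq_box//=; last by rewrite mem_box /=; lia.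
  apply: ler_wpDl; first by rewrite mulr_ge0// decay_ge0.
  by apply: ler_sum => k k0; exact: fold_term_le.
by apply: ler_wpM2l => //; exact: sum_lattice_decay.
Qed.

Definition folded (l : R * R) : R := lattice_sum (fun k => fold_term k l).

(** The terms outside of a box are dominated uniformly on the torus. *)
Lemma folded_tail (e : R) : 0 < e -> exists M, forall l, torus l ->
  `|folded l - \sum_(k <- box M) fold_term k l| <= e.
Proof.
move=> e0; have e1 : 0 < e / (C + 1) by rewrite divr_gt0// ltr_wpDl.
have [M hM] := lattice_sum_tail (lattice_decay phi) Kd (fun=> decay_ge0 _ _)
   (sum_lattice_decay phi phi0) _ e1.
exists M => l tl; have b0 k := fold_term_ge0 k l.
have bK N := sum_fold_term N l tl.
have lo := sum_le_lattice_sum _ _ b0 bK (box M) (uniq_box M).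
rewrite ger0_norm ?subr_ge0// lerBlDl.
apply: limr_le; first by apply: cvgP (cvg_lattice_sum _ _ b0 bK).
apply: nearW => N.
rewrite (bigID (fun k => k \in box M)) /=; apply: lerD.
  rewrite -big_filter; apply: sum_subset => //; first by rewrite filter_uniq// uniq_box.
  by move=> k; rewrite mem_filter => /andP[].
apply: (@le_trans _ _ (C * \sum_(k <- [seq k <- box N | k \notin box M]) lattice_decay phi k)).
  rewrite mulr_sumr big_filter; apply: ler_sum => k kM; apply: fold_term_le => //.
  by apply: contraNneq kM => ->; rewrite mem_box /=; lia.
apply: (@le_trans _ _ (C * (e / (C + 1)))).
  apply: ler_wpM2l => //; apply: hM; first by rewrite filter_uniq// uniq_box.
  by move=> k; rewrite mem_filter => /andP[].
by rewrite mulrA ler_pdivrMr ?ltr_wpDl//; lra.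
Qed.

(** Partial sums, made continuous at the origin by cutting the pole of the term
    k = 0. *)
Definition truncated (M : nat) (de : R) (l : R * R) : R :=
  gain l * \sum_(k <- box M) C * decay phi (Num.max (sqdist k l) de).

Lemma continuous_truncated M de : 0 < de -> continuous (truncated M de).
Proof.
move=> de0.
have c1 : continuous (fun l : R * R => l.1) by move=> l; exact: cvg_fst.
have c2 : continuous (fun l : R * R => l.2) by move=> l; exact: cvg_snd.
have cc (p : R * R -> R) : continuous p -> continuous (fun l => 2 - 2 * cos (p l)).
  move=> cp l; apply: (@cvgB _ R^o); first exact: cvg_cst.
  apply: cvgM; first exact: cvg_cst.
  by apply: (@continuous_comp _ _ _ p cos); [exact: cp|exact: continuous_cos].
have cq k : continuous (sqdist k).
  have sq (p : R * R -> R) (a : R) : continuous p -> continuous (fun l => (p l + a) ^+ 2).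
    move=> cp; rewrite (_ : (fun l => _) = (fun l => (p l + a) * (p l + a))); last first.
      by apply/funext => z; rewrite expr2.
    by move=> l; apply: cvgM; apply: (@cvgD _ R^o); [exact: cp|exact: cvg_cst|exact: cp|exact: cvg_cst].
  by move=> l; apply: (@cvgD _ R^o); exact: sq.
pose g k (l : R * R) := C * decay phi (Num.max (sqdist k l) de).
have cg k : continuous (g k).
  have mx0 z : 0 < Num.max (sqdist k z) de by rewrite lt_max de0 orbT.
  have -> : g k = (fun z => C * expR (- (1 + phi) * ln (Num.max (sqdist k z) de))).
    by apply/funext => z; rewrite /g /decay /powR gt_eqF.
  have cl : continuous (fun z => ln (Num.max (sqdist k z) de)).
    move=> l; apply: (@continuous_comp _ _ _ (fun z => Num.max (sqdist k z) de) (@ln R)).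
      by apply: (@continuous_max _ _ (fun z => sqdist k z) (fun=> de)); [exact: cq|exact: cvg_cst].
    exact: continuous_ln.
  move=> l; apply: cvgM; first exact: cvg_cst.
  apply: (@continuous_comp _ _ _ (fun z => - (1 + phi) * ln (Num.max (sqdist k z) de)) expR);
    last exact: continuous_expR.
  by apply: cvgM; [exact: cvg_cst|exact: cl].
have cs s : continuous (fun l => \sum_(k <- s) g k l).
  elim: s => [|k s ih].
    have -> : (fun l => \sum_(k <- [::]) g k l) = (fun=> 0).
      by apply/funext => l; rewrite big_nil.
    by move=> l; exact: cvg_cst.
  have -> : (fun l => \sum_(k0 <- k :: s) g k0 l) = (fun l => g k l + \sum_(k0 <- s) g k0 l).
    by apply/funext => l; rewrite big_cons.
  by move=> l; apply: (@cvgD _ R^o); [exact: cg|exact: ih].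
by move=> l; apply: cvgM; [apply: cvgM; exact: cc|exact: cs].
Qed.

Lemma tapprox_truncated M de : 0 < de -> tapprox (truncated M de).
Proof.
move=> de0; apply: tapprox_even; first exact: continuous_truncated.
  move=> l; rewrite /truncated /gain /= cosN; congr (_ * _).
  rewrite -(sum_box_sym (fun h => (- h.1, h.2))).
  - apply: eq_bigr => k _; congr (_ * decay _ (Num.max _ _)).
    by rewrite /sqdist /= mulrNz; ring.
  - by move=> h; rewrite /= opprK -surjective_pairing.
  - by move=> h; rewrite !mem_box /= normrN.
move=> l; rewrite /truncated /gain /= cosN; congr (_ * _).
rewrite -(sum_box_sym (fun h => (h.1, - h.2))).
- apply: eq_bigr => k _; congr (_ * decay _ (Num.max _ _)).
  by rewrite /sqdist /= mulrNz; ring.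
- by move=> h; rewrite /= opprK -surjective_pairing.
- by move=> h; rewrite !mem_box /= normrN.
Qed.

(** Only the term k = 0 is affected, where the squared distance x is less than de:
    there the gain is at most x ^ 2, and x ^ 2 x ^ (- (1 + phi)) <= de ^ (1 - phi). *)
Lemma truncated_dist M de l : torus l -> 0 < de -> de <= 1 ->
  `|gain l * \sum_(k <- box M) fold_term k l - truncated M de l| <= C * de `^ (1 - phi).
Proof.
move=> tl de0 de1.
have f0 k : k != 0 -> fold_term k l - C * decay phi (Num.max (sqdist k l) de) = 0.
  move=> k0; rewrite max_l ?subrr//; apply: (le_trans de1).
  apply: (le_trans _ (sqdist_ge _ _ tl k0)).
  by rewrite -[leLHS]mulr1; apply: ler_pM => //; rewrite lerDl.
rewrite /truncated -mulrBr -sumrB (bigD1_seq 0) ?uniq_box//=; last by rewrite mem_box /=; lia.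
rewrite big1 ?addr0//.
have [h|h] := leP de (sqdist 0 l).
  by rewrite /fold_term subrr mulr0 normr0 mulr_ge0// powR_ge0.
rewrite /fold_term -mulrBr mulrCA normrM (ger0_norm C0); apply: ler_wpM2l => //.
have := sqdist_ge0 0 l; rewrite le_eqVlt => /orP[/eqP q0|q0].
  have := gain_le l; rewrite -q0 expr0n /= => g0.
  by have -> : gain l = 0; [apply/le_anti; rewrite g0 gain_ge0|rewrite mul0r normr0 powR_ge0].
have dd : decay phi de <= decay phi (sqdist 0 l) by apply: le_decay => //; exact: ltW.
rewrite ger0_norm; last by rewrite mulr_ge0 ?gain_ge0// subr_ge0.
apply: (@le_trans _ _ (sqdist 0 l ^+ 2 * decay phi (sqdist 0 l))).
  apply: ler_pM; rewrite ?gain_ge0 ?gain_le ?subr_ge0//.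
  by rewrite lerBlDr lerDl decay_ge0.
rewrite -powR_mulrn ?(ltW q0)// /decay -powRD; last by apply/implyP => _; rewrite gt_eqF.
rewrite (_ : 2%:R + _ = 1 - phi); last by ring.
apply: ge0_ler_powR; rewrite ?nnegrE; [by rewrite subr_ge0 ltW|exact: ltW|exact: ltW|exact: ltW].
Qed.

Lemma tapprox_folded : tapprox (fun l => gain l * folded l).
Proof.
move=> e e0; have e3 : 0 < e / 3 by rewrite divr_gt0.
have [|M hM] := folded_tail (e / 3 / 16); first by rewrite !divr_gt0.
(* de is at most 1 and such that C de ^ (1 - phi) <= e / 3 *)
pose x := Num.min 1 (e / 3 / (C + 1)).
have C1 : 0 < C + 1 by rewrite ltr_wpDl.
have x0 : 0 < x by rewrite lt_min ltr01 !divr_gt0.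
pose de := x `^ ((1 - phi)^-1).
have p1 : 0 < 1 - phi by rewrite subr_gt0.
have de0 : 0 < de by rewrite powR_gt0.
have de1 : de <= 1.
  rewrite [leRHS](_ : 1 = 1 `^ ((1 - phi)^-1)); last by rewrite powR1.
  apply: ge0_ler_powR; rewrite ?nnegrE.
  - by rewrite invr_ge0 ltW.
  - exact: ltW.
  - exact: ler01.
  - by rewrite /x ge_min lexx.
have ed : C * de `^ (1 - phi) <= e / 3.
  rewrite /de -powRrM mulVf ?gt_eqF// powRr1 ?(ltW x0)//.
  apply: (@le_trans _ _ (C * (e / 3 / (C + 1)))).
    by apply: ler_wpM2l => //; rewrite /x ge_min lexx orbT.
  by rewrite mulrA ler_pdivrMr//; lra.
have [p tp hp] := tapprox_truncated M de de0 _ e3.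
exists p => // l tl.
have h1 : `|gain l * folded l - gain l * \sum_(k <- box M) fold_term k l| <= e / 3.
  rewrite -mulrBr normrM (ger0_norm (gain_ge0 l)).
  apply: (le_trans (ler_pM (gain_ge0 l) (normr_ge0 _) (gain_le16 l) (hM _ tl))).
  by rewrite le_eqVlt; apply/orP; left; apply/eqP; field.
have h2 := truncated_dist M de l tl de0 de1.
have h3 := hp _ tl.
have := ler_normD (gain l * folded l - gain l * \sum_(k <- box M) fold_term k l)
  ((gain l * \sum_(k <- box M) fold_term k l - truncated M de l) + (truncated M de l - p l)).
have := ler_normD (gain l * \sum_(k <- box M) fold_term k l - truncated M de l)
   (truncated M de l - p l).
rewrite (_ : gain l * folded l - _ + _ = gain l * folded l - p l); last by ring.
lra.
Qed.

End SpectralDensity.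

Lemma tapprox_fD {R : realType} (phi1 phi2 c : R) : 0 < phi1 -> 0 < phi2 -> phi2 < 1 -> 0 < c ->
  tapprox (fD phi1 phi2 c).
Proof.
move=> p1 p2 p21 c0; have C0 : 0 <= c * phi1 by rewrite mulr_ge0// ltW.
have ta := tapprox_folded phi2 (c * phi1) p2 p21 C0.
have e l : torus l -> fD phi1 phi2 c l = gain l * folded phi2 (c * phi1) l.
  move=> tl; rewrite /fD /fX /folded.
  congr (_ * _).
    rewrite /g1 !mul1r complex.ComplexField.Normc.normcM exprMn /gain.
    have n2 (x : R) : (1 - cos x) ^+ 2 + (0 - sin x) ^+ 2 = 2 - 2 * cos x.
      by have := cos2Dsin2 x; rewrite sub0r sqrrN sqrrB; lra.
    by congr (_ * _); rewrite /expi /= sqr_sqrtr ?n2// addr_ge0 ?sqr_ge0.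
  rewrite -(esum_lattice _ _ (fun k => fold_term_ge0 phi2 _ C0 k l)
     (fun M => sum_fold_term phi2 _ p2 p21 C0 M l tl)).
  congr fine; apply: eq_esum => k _; congr (_ * _)%:E.
  rewrite /enorm /= -/(sqdist k l) /decay.
  rewrite -powR12_sqrt ?sqdist_ge0// -powRrM; congr (_ `^ _).
  by field.
by move=> e' /ta[p tp hp]; exists p => // l tl; rewrite e//; exact: hp.
Qed.

(** * Moments of the normalized variations *)

Section StencilVariations.
Context {R : realType} {d : measure_display} {T : measurableType d}.
Variable P : probability T R.
(* the Gaussian space of the observations *)
Variable LL : set (T -> R).
Hypothesis LLlin : forall a f g, LL f -> LL g -> LL (fun x => f x + a * g x).
Hypothesis LLm : forall f, LL f -> has_moments P f.
Hypothesis LLg : forall f, LL f -> forall j : nat,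
  Ex P (fun x => f x ^+ j.+1) = j%:R * Ex P (fun x => f x ^+ 2) * Ex P (fun x => f x ^+ j.-1).
Variable Z : int * int -> T -> R.
Hypothesis LLZ : forall t, LL (Z t).
Variable f : R * R -> R.
Hypothesis af : tapprox f.
Hypothesis covZ : forall t s, Ex P (fun o => Z t o * Z s o) = coefw f (s - t).

Definition stencil_sum (r : nat) (t : int * int) (o : T) : R :=
  \sum_(a <- stencil r) Z (t + a) o.

Lemma LL_sum (I : Type) (s : seq I) (g : I -> T -> R) : (forall i, LL (g i)) ->
  LL (fun o => \sum_(i <- s) g i o).
Proof.
move=> Lg; elim: s => [|i s ih].
  have := LLlin (-1) _ _ (LLZ 0) (LLZ 0).
  congr LL; apply/funext => o; rewrite big_nil; ring.
have := LLlin 1 _ _ (Lg i) ih; congr LL; apply/funext => o.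
by rewrite big_cons mul1r.
Qed.

Lemma LL_stencil_sum r t : LL (stencil_sum r t).
Proof. exact: LL_sum. Qed.

Lemma cov_stencil_sum r s t t' :
  Ex P (fun o => stencil_sum r t o * stencil_sum s t' o) = stencil_coefw f r s (t' - t).
Proof.
have mZ t0 := LLm _ (LLZ t0).
transitivity (Ex P (fun o => \sum_(a <- stencil r) \sum_(b <- stencil s) Z (t + a) o * Z (t' + b) o)).
  apply: Ex_ext => o; rewrite /stencil_sum mulr_suml; apply: eq_bigr => a _.
  by rewrite mulr_sumr.
rewrite Exp_sum; last by move=> a; apply: has_moments_sum => b; exact: has_momentsM.
apply: eq_bigr => a _; rewrite Exp_sum; last by move=> b; exact: has_momentsM.
by apply: eq_bigr => b _; rewrite (covZ (t + a)) opprD addrA (addrAC t' b (- t)).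
Qed.

(** The sites of both variations; the summands identify the step. *)
Definition sites (n : nat) : finType := (Lambda (n - 2) + Lambda (n - 4))%type.

Definition kind n (i : sites n) : nat := if i is inl _ then 1%N else 2.

Definition place n (i : sites n) : int * int :=
  match i with inl t => (Posz t.1, Posz t.2) | inr t => (Posz t.1, Posz t.2) end.

Definition obs n (i : sites n) : T -> R := stencil_sum (kind n i) (place n i).

(** The factor n / |Lambda_(n - 2 r)| by which each centred square enters the
    normalized variation. *)
Definition rate (n r : nat) : R := n%:R / (n - 2 * r)%:R ^+ 2.

Definition wt (u : nat -> R) n (i : sites n) : R := u (kind n i) * rate n (kind n i).

Let covo n i j : cov P (sites n) (obs n) i j =
  stencil_coefw f (kind n i) (kind n j) (place n j - place n i).
Proof. exact: cov_stencil_sum. Qed.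

Lemma sum_sites n (F : nat -> int * int -> R) :
  \sum_(i : sites n) F (kind n i) (place n i) =
  \sum_(t <- cube (n - 2)) F 1%N t + \sum_(t <- cube (n - 4)) F 2 t.
Proof.
rewrite big_sumType /=; congr (_ + _).
  exact: (sum_Lambda (n - 2) (F 1%N)).
exact: (sum_Lambda (n - 4) (F 2)).
Qed.

Definition variation (r n : nat) (o : T) : R :=
  \sum_(t <- cube (n - 2 * r)) (stencil_sum r t o ^+ 2 - Ex P (fun o => stencil_sum r t o ^+ 2)).

(** A combination of the two variations is a single quadratic form. *)
Lemma quad_variation u n o : quad P (sites n) (obs n) (wt u n) o =
  u 1%N * rate n 1 * variation 1 n o + u 2 * rate n 2 * variation 2 n o.
Proof.
rewrite /quad (sum_sites n (fun r t => u r * rate n r *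
  (stencil_sum r t o ^+ 2 - Ex P (fun o => stencil_sum r t o * stencil_sum r t o)))).
by rewrite -!mulr_sumr.
Qed.

Let S r s := lattice_sum (fun h => stencil_coefw f r s h ^+ 2).

Let B n r s : R := \sum_(t <- cube (n - 2 * r)) \sum_(t' <- cube (n - 2 * s))
  stencil_coefw f r s (t' - t) ^+ 2.

Let sum_pairs n (c : nat -> nat -> R) :
  \sum_(i : sites n) \sum_(j : sites n) c (kind n i) (kind n j) *
     cov P (sites n) (obs n) i j ^+ 2 =
  c 1%N 1%N * B n 1 1 + c 1%N 2 * B n 1 2 + (c 2 1%N * B n 2 1 + c 2 2 * B n 2 2).
Proof.
pose G r t := \sum_(t' <- cube (n - 2)) c r 1%N * stencil_coefw f r 1 (t' - t) ^+ 2 +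
   \sum_(t' <- cube (n - 4)) c r 2 * stencil_coefw f r 2 (t' - t) ^+ 2.
transitivity (\sum_(i : sites n) G (kind n i) (place n i)).
  apply: eq_bigr => i _.
  rewrite /G -(sum_sites n (fun s t' => c (kind n i) s * stencil_coefw f (kind n i) s (t' - place n i) ^+ 2)).
  by apply: eq_bigr => j _; rewrite covo.
rewrite (sum_sites n G) !big_split /=.
by congr (_ + _ + (_ + _)); rewrite /B mulr_sumr; apply: eq_bigr => t _; rewrite mulr_sumr.
Qed.

Let cvg_B r s : (n%:R ^+ 2)^-1 * B n r s @[n --> \oo] --> S r s.
Proof.
apply: (cesaro_lattice _ (torus_int (fun l => stencil_weight r l * stencil_weight s l * f l ^+ 2))).
  by move=> h; exact: sqr_ge0.
exact: stencil_coefw_bound.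
Qed.

Let cvg_rate r : n%:R * rate n r @[n --> \oo] --> (1 : R).
Proof.
have h : ((n - 2 * r)%:R / n%:R) ^-1 @[n --> \oo] --> (1 : R).
  by rewrite -[X in _ --> X]invr1; apply: cvgV; [exact: oner_neq0|exact: cvg_ratio].
have -> : (fun n => n%:R * rate n r) =
    (fun n => ((n - 2 * r)%:R / n%:R)^-1 * ((n - 2 * r)%:R / n%:R)^-1).
  by apply/funext => n; rewrite /rate invf_div expr2 invfM; ring.
by rewrite -[X in _ --> X](mulr1 1); exact: cvgM.
Qed.

Let B0 r s : B 0 r s = 0.
Proof. by rewrite /B sub0n /cube /= big_nil. Qed.

Let cvg_block r s : rate n r * rate n s * B n r s @[n --> \oo] --> S r s.
Proof.
have -> : (fun n => rate n r * rate n s * B n r s) =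
    (fun n => (n%:R * rate n r) * (n%:R * rate n s) * ((n%:R ^+ 2)^-1 * B n r s)).
  apply/funext => n; have [->|n0] := eqVneq n 0%N; first by rewrite B0 !mulr0.
  by field; rewrite pnatr_eq0.
rewrite (_ : S r s = 1 * 1 * S r s); last by rewrite !mul1r.
by apply: cvgM => //; exact: cvgM.
Qed.

(** The trace is a double sum over pairs of sites of squared covariances, which
    depend on differences of sites only. *)
Lemma cvg_gtrace1 u : gtrace P (sites n) (obs n) (wt u n) 1 @[n --> \oo] -->
  u 1%N * u 1%N * S 1 1 + u 1%N * u 2 * S 1 2 + (u 2 * u 1%N * S 2 1 + u 2 * u 2 * S 2 2).
Proof.
have e n : gtrace P (sites n) (obs n) (wt u n) 1 =
   u 1%N * u 1%N * (rate n 1 * rate n 1 * B n 1 1) +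
   u 1%N * u 2 * (rate n 1 * rate n 2 * B n 1 2) +
   (u 2 * u 1%N * (rate n 2 * rate n 1 * B n 2 1) +
    u 2 * u 2 * (rate n 2 * rate n 2 * B n 2 2)).
  rewrite gtrace1E.
  rewrite (sum_pairs n (fun r s => (u r * rate n r) * (u s * rate n s))); ring.
under eq_fun do rewrite e.
by apply: (@cvgD _ R^o); apply: (@cvgD _ R^o); apply: cvgM; try exact: cvg_cst; exact: cvg_block.
Qed.

Let al (u : nat -> R) n := `|u 1%N| * rate n 1 + `|u 2| * rate n 2.

Let rate_ge0 n r : 0 <= rate n r.
Proof. by rewrite /rate divr_ge0// sqr_ge0. Qed.

Let wt_le u n i : `|wt u n i| <= al u n.
Proof.
rewrite /wt /al normrM (ger0_norm (rate_ge0 _ _)).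
by case: i => t /=; rewrite ?lerDl ?lerDr mulr_ge0.
Qed.

Let cvg_al u : n%:R * al u n @[n --> \oo] --> `|u 1%N| + `|u 2|.
Proof.
have -> : (fun n => n%:R * al u n) =
    (fun n => `|u 1%N| * (n%:R * rate n 1) + `|u 2| * (n%:R * rate n 2)).
  by apply/funext => n; rewrite /al; ring.
rewrite -[X in _ --> X + _]mulr1 -[X in _ --> _ + X]mulr1.
by apply: (@cvgD _ R^o); apply: cvgM => //; exact: cvg_cst.
Qed.

Let kinds : seq (nat * nat) := [:: (1, 1); (1, 2); (2, 1); (2, 2)]%N.

(* a common majorant of the covariances between observations *)
Let kap (h : int * int) : R := \sum_(q <- kinds) `|stencil_coefw f q.1 q.2 (- h)|.

Let kap_ge0 h : 0 <= kap h.
Proof. by apply: sumr_ge0. Qed.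

Let cov_le n i j : `|cov P (sites n) (obs n) i j| <= kap (place n i - place n j).
Proof.
rewrite covo /kap /kinds !big_cons big_nil opprB addr0 /=; move: (place n j - _) => h.
have := normr_ge0 (stencil_coefw f 1 1 h); have := normr_ge0 (stencil_coefw f 1 2 h).
have := normr_ge0 (stencil_coefw f 2 1 h); have := normr_ge0 (stencil_coefw f 2 2 h).
by case: i => ?; case: j => ? /=; lra.
Qed.

Let kap_sqr : exists K, forall M, \sum_(h <- box M) kap h ^+ 2 <= K.
Proof.
exists (\sum_(q <- kinds) 4 * torus_int (fun l => stencil_weight q.1 l * stencil_weight q.2 l * f l ^+ 2)).
move=> M; apply: (@le_trans _ _ (\sum_(h <- box M) \sum_(q <- kinds)
   4 * stencil_coefw f q.1 q.2 (- h) ^+ 2)).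
  apply: ler_sum => h _.
  have := cauchy_schwarz_sum _ kinds (fun=> 1) (fun q => `|stencil_coefw f q.1 q.2 (- h)|).
  rewrite /kap; under eq_bigr do rewrite mul1r.
  move/le_trans; apply; rewrite -mulr_sumr; apply: ler_pM => //.
  - exact: sum_sqr_ge0.
  - exact: sum_sqr_ge0.
  - by rewrite /kinds !big_cons big_nil /= expr1n; lra.
  - by apply: ler_sum => q _; rewrite real_normK ?num_real.
rewrite exchange_big /=; apply: ler_sum => q _; rewrite -mulr_sumr ler_wpM2l//.
rewrite (sum_boxN M (fun h => stencil_coefw f q.1 q.2 h ^+ 2)).
exact: stencil_coefw_bound.
Qed.

Let sum_sites_le n (F : int * int -> R) : (forall t, 0 <= F t) ->
  \sum_(i : sites n) F (place n i) <= 2 * \sum_(t <- cube n) F t.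
Proof.
move=> F0; rewrite (sum_sites n (fun=> F)).
have sub k : \sum_(t <- cube (n - k)) F t <= \sum_(t <- cube n) F t.
  apply: sum_subset => //; first exact: uniq_cube.
  move=> h; rewrite !mem_cube => /and4P[h1 h2 h3 h4].
  have kn : ((n - k)%N%:Z <= n%:Z)%R by rewrite lez_nat leq_subr.
  by rewrite h1 h3 (lt_le_trans h2 kn) (lt_le_trans h4 kn).
by have := sub 2%N; have := sub 4%N; lra.
Qed.

Let cross n : R := \sum_(p <- cube n) \sum_(q <- cube n)
  (\sum_(t <- cube n) kap (t - p) * kap (t - q)) ^+ 2.

Let sum_cross n : \sum_(j : sites n) \sum_(l : sites n)
   (\sum_(i : sites n) `|cov P (sites n) (obs n) i j| * `|cov P (sites n) (obs n) i l|) ^+ 2 <=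
  16 * cross n.
Proof.
pose G p q := (2 * \sum_(t <- cube n) kap (t - p) * kap (t - q)) ^+ 2.
have G0 p q : 0 <= G p q by exact: sqr_ge0.
apply: (@le_trans _ _ (\sum_(j : sites n) \sum_(l : sites n) G (place n j) (place n l))).
  apply: ler_sum => j _; apply: ler_sum => l _.
  have s0 : 0 <= \sum_(i : sites n) kap (place n i - place n j) * kap (place n i - place n l).
    by apply: sumr_ge0 => i _; exact: mulr_ge0.
  have k0 : 0 <= \sum_(t <- cube n) kap (t - place n j) * kap (t - place n l).
    by apply: sumr_ge0 => i _; exact: mulr_ge0.
  rewrite /G ler_sqr ?nnegrE; [|by apply: sumr_ge0 => i _; exact: mulr_ge0|exact: mulr_ge0].
  apply: le_trans (sum_sites_le n (fun t => kap (t - place n j) * kap (t - place n l)) _).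
    by apply: ler_sum => i _; apply: ler_pM.
  by move=> t; exact: mulr_ge0.
apply: (@le_trans _ _ (\sum_(j : sites n) 2 * \sum_(q <- cube n) G (place n j) q)).
  by apply: ler_sum => j _; exact: sum_sites_le.
apply: (le_trans (sum_sites_le n (fun p => 2 * \sum_(q <- cube n) G p q) _)).
  by move=> p; rewrite mulr_ge0// sumr_ge0.
rewrite le_eqVlt; apply/orP; left; apply/eqP; rewrite /cross /G !mulr_sumr.
apply: eq_bigr => p _; rewrite !mulr_sumr; apply: eq_bigr => q _; ring.
Qed.

Let cvg_expn (x : nat -> R) (l : R) k : x @ \oo --> l ->
  (fun n => x n ^+ k) @ \oo --> l ^+ k.
Proof.
move=> xl; elim: k => [|k ih]; first by under eq_fun do rewrite expr0; exact: cvg_cst.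
by rewrite exprS; under eq_fun do rewrite exprS; exact: cvgM.
Qed.

(** In [gtrace_bound] with al of order 1 / n, the first factor is bounded by the
    convergence of the sums of squared covariances, and the second one tends to
    0 by [cvg_trace_lattice]. *)
Lemma cvg_gtrace2 u m : gtrace P (sites n) (obs n) (wt u n) m.+2 @[n --> \oo] --> (0 : R).
Proof.
pose F1 n := al u n ^+ 2 * (B n 1 1 + B n 1 2 + (B n 2 1 + B n 2 2)).
pose F2 n := (n%:R * al u n) ^+ 4 * 16 * ((n%:R ^+ 4)^-1 * cross n).
have bnd n : gtrace P (sites n) (obs n) (wt u n) m.+2 ^+ 2 <= F1 n ^+ m.+1 * F2 n.
  apply: (le_trans (gtrace_bound P _ _ _ (al u n) (wt_le u n) m)).
  have e1 : \sum_(i : sites n) \sum_(j : sites n) cov P (sites n) (obs n) i j ^+ 2 =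
      B n 1 1 + B n 1 2 + (B n 2 1 + B n 2 2).
    rewrite -[B n 1 1]mul1r -[B n 1 2]mul1r -[B n 2 1]mul1r -[B n 2 2]mul1r.
    rewrite -(sum_pairs n (fun _ _ => 1)).
    by apply: eq_bigr => i _; apply: eq_bigr => j _; rewrite mul1r.
  rewrite e1 -/(F1 n); apply: ler_wpM2l.
    apply: exprn_ge0; rewrite /F1 -e1; apply: mulr_ge0; first exact: sqr_ge0.
    by apply: sumr_ge0 => i _; exact: sum_sqr_ge0.
  have -> : F2 n = al u n ^+ 4 * (16 * cross n).
    rewrite /F2; have [->|n0] := eqVneq n 0%N; first by rewrite /cross /cube /= big_nil !mulr0.
    by field; rewrite pnatr_eq0.
  apply: ler_wpM2l; last exact: sum_cross.
  by rewrite -[4%N]/(2 * 2)%N exprM sqr_ge0.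
have c1 : exists l : R, F1 @ \oo --> l.
  exists ((`|u 1%N| + `|u 2|) * (`|u 1%N| + `|u 2|) * (S 1 1 + S 1 2 + (S 2 1 + S 2 2))).
  have -> : F1 = (fun n => (n%:R * al u n) * (n%:R * al u n) *
      ((n%:R ^+ 2)^-1 * B n 1 1 + (n%:R ^+ 2)^-1 * B n 1 2 +
      ((n%:R ^+ 2)^-1 * B n 2 1 + (n%:R ^+ 2)^-1 * B n 2 2))).
    apply/funext => n; rewrite /F1; have [->|n0] := eqVneq n 0%N.
      by rewrite !B0 !(mulr0, addr0, mul0r).
    by field; rewrite pnatr_eq0.
  apply: cvgM; first exact: cvgM.
  by apply: (@cvgD _ R^o); apply: (@cvgD _ R^o).
have c2 : F2 @ \oo --> (0 : R).
  have [K hK] := kap_sqr.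
  rewrite -(mulr0 ((`|u 1%N| + `|u 2|) ^+ 4 * 16)); apply: cvgM; last first.
    exact: (cvg_trace_lattice kap K kap_ge0 hK).
  by apply: cvgM; [exact: cvg_expn|exact: cvg_cst].
have [l cl] := c1.
have c : (fun n => F1 n ^+ m.+1 * F2 n) @ \oo --> (0 : R).
  by rewrite -(mulr0 (l ^+ m.+1)); apply: cvgM => //; exact: cvg_expn.
apply: cvg_eps => e e0.
have e20 : 0 < e ^+ 2 by rewrite exprn_gt0.
have /cvgrPdist_le/(_ _ e20) := c; apply: filterS => n; rewrite !sub0r !normrN => h.
rewrite -ler_sqr ?nnegrE ?(ltW e0)// real_normK ?num_real//.
exact: le_trans (bnd n) (le_trans (ler_norm _) h).
Qed.

Lemma cvg_variation_moments u k :
  Ex P (fun o => (u 1%N * (rate n 1 * variation 1 n o) + u 2 * (rate n 2 * variation 2 n o)) ^+ k)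
    @[n --> \oo] -->
  nmoment (2 * (u 1%N * u 1%N * S 1 1 + u 1%N * u 2 * S 1 2 + (u 2 * u 1%N * S 2 1 + u 2 * u 2 * S 2 2))) k.
Proof.
set v := 2 * _.
have LLo n i : LL (obs n i) by exact: LL_stencil_sum.
have e n k' : Ex P (fun o => (u 1%N * (rate n 1 * variation 1 n o) +
    u 2 * (rate n 2 * variation 2 n o)) ^+ k') =
    Ex P (fun o => quad P (sites n) (obs n) (wt u n) o ^+ k').
  by apply: Ex_ext => o; rewrite quad_variation !mulrA.
under eq_fun do rewrite e.
apply: (cvg_moments v (fun n k => Ex P (fun o => quad P (sites n) (obs n) (wt u n) o ^+ k))
  (fun n => gmom P (sites n) (obs n) (wt u n))
  (fun n => gtrace P (sites n) (obs n) (wt u n))).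
- by move=> n m; apply: (gmom0 P LL).
- by move=> n m k'; apply: (gmomS P LL).
- by move=> n; exact: Ex_quad0.
- by move=> n k'; exact: Ex_quadS.
- by rewrite /v (mulrC 2) mulfK//; exact: cvg_gtrace1.
- by move=> m; exact: cvg_gtrace2.
Qed.

End StencilVariations.

(** * Increments of the field *)

Section Increments.
Context {R : realType} {d : measure_display} {T : measurableType d}.
Variables (P : probability T R) (phi1 phi2 : R) (X : R * R -> {RV P >-> R}).
Hypothesis X_irf : gaussian_power_law_irf0 phi1 phi2 X.
Local Notation K := (power_law phi1 phi2).

Lemma expectation_Ex (g : T -> R) : has_moments P g -> ('E_P[g] = (Ex P g)%:E)%E.
Proof.
move=> mg; rewrite unlock /Rintegral fineK//.
by apply: integrable_fin_num => //; exact: has_moments_integrable.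
Qed.

Definition combination (s : seq (R * (R * R))) (o : T) : R := \sum_(e <- s) e.1 * X e.2 o.

(** The combinations with weights of total mass zero: the variables whose law is
    prescribed. *)
Definition increment : set (T -> R) :=
  [set g | exists2 s, \sum_(e <- s) e.1 = 0 & g = combination s].

Let nth_sum {V : nmodType} (s : seq (R * (R * R))) (F : R -> R * R -> V) :
  \sum_(i < size s) F (nth 0 s i).1 (nth 0 s i).2 = \sum_(e <- s) F e.1 e.2.
Proof. by rewrite (big_nth 0) big_mkord. Qed.

Lemma increment_lin (a : R) g h : increment g -> increment h -> increment (fun o => g o + a * h o).
Proof.
move=> [s s0 ->] [t t0 ->]; exists (s ++ [seq (a * e.1, e.2) | e <- t]).
  by rewrite big_cat big_map /= -mulr_sumr s0 t0 mulr0 addr0.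
apply/funext => o; rewrite /combination big_cat big_map /= mulr_sumr; congr (_ + _).
by apply: eq_bigr => e _; rewrite mulrA.
Qed.

Let irf s t : \sum_(e <- s) e.1 = 0 -> \sum_(e <- t) e.1 = 0 ->
  jointly_centered_gaussian P (combination s) (combination t) /\
  covariance P (combination s) (combination t) =
   (\sum_(e <- s) \sum_(e' <- t) e.1 * e'.1 * K (e.2 - e'.2))%:E.
Proof.
move=> s0 t0.
have := X_irf (size s) (size t) (fun i => (nth 0 s i).1) (fun i => (nth 0 s i).2)
  (fun i => (nth 0 t i).1) (fun i => (nth 0 t i).2).
rewrite (nth_sum s (fun a _ => a)) (nth_sum t (fun a _ => a)) => /(_ s0 t0) /=.
have eU u : (fun o => \sum_(i < size u) (nth 0 u i).1 * X (nth 0 u i).2 o) = combination u.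
  by apply/funext => o; rewrite (nth_sum u (fun a x => a * X x o)).
rewrite !eU => -[jg ->]; split => //; congr EFin.
under eq_bigr => i _ do rewrite (nth_sum t (fun a x => (nth 0 s i).1 * a * K ((nth 0 s i).2 - x))).
by rewrite (nth_sum s (fun b y => \sum_(e' <- t) b * e'.1 * K (y - e'.2))).
Qed.

Let measurable_combination s : measurable_fun setT (combination s).
Proof. by apply: measurable_sum => e; apply: measurable_funM. Qed.

Let increment_gauss g : increment g -> exists2 v : R, 0 <= v &
  forall A : set (measurableTypeR R), measurable A -> P [set w | A (g w)] = normal_law v A.
Proof.
move=> [s s0 ->]; have [/(_ 1 0)[v v0 h] _] := irf s s s0 s0.
exists v => // A mA; rewrite -h//; congr (P _); apply/seteqP.
by split=> o /=; rewrite mul1r mul0r addr0.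
Qed.

Let increment_moments g : increment g -> exists2 v : R, 0 <= v &
  [/\ forall A : set (measurableTypeR R), measurable A -> P [set w | A (g w)] = normal_law v A,
   has_moments P g & forall j, Ex P (fun o => g o ^+ j.+1) = j%:R * v * Ex P (fun o => g o ^+ j.-1)].
Proof.
move=> ig; have [v v0 h] := increment_gauss g ig.
have mg : measurable_fun setT g by case: ig => s _ ->.
by have [m e] := gaussian_moments P g v mg v0 h; exists v.
Qed.

Let Ex1 (g : T -> R) : Ex P (fun o => g o ^+ 0) = 1.
Proof. by rewrite -[RHS](Exp_cst P 1); apply: Ex_ext => o; rewrite expr0. Qed.

Lemma increment_has_moments g : increment g -> has_moments P g.
Proof. by case/increment_moments => v _ []. Qed.

Lemma increment_stein g : increment g -> forall j : nat,
  Ex P (fun x => g x ^+ j.+1) = j%:R * Ex P (fun x => g x ^+ 2) * Ex P (fun x => g x ^+ j.-1).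
Proof.
case/increment_moments => v _ [_ _ e] j.
by rewrite [in RHS](e 1%N) mul1r /= Ex1 mulr1.
Qed.

(** The variance is recovered from the moment recursion at j = 1. *)
Lemma increment_law g : increment g -> forall A : set (measurableTypeR R), measurable A ->
  P [set w | A (g w)] = normal_law (Ex P (fun x => g x ^+ 2)) A.
Proof.
case/increment_moments => v _ [h _ e] A mA.
by rewrite (e 1%N) mul1r /= Ex1 mulr1; exact: h.
Qed.

Lemma increment_nmoment g k : increment g ->
  Ex P (fun o => g o ^+ k) = nmoment (Ex P (fun x => g x ^+ 2)) k.
Proof.
move=> ig; elim/ltn_ind: k => -[|k] ih; first exact: Ex1.
by rewrite (increment_stein _ ig) nmomentS (ih k.-1)// ltnS leq_pred.
Qed.

Let increment_centered g : increment g -> Ex P g = 0.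
Proof.
move=> ig; have := increment_stein _ ig 0; rewrite !mul0r => <-.
by apply: Ex_ext => o; rewrite expr1.
Qed.

Lemma covariance_increment g h : increment g -> increment h ->
  (covariance P g h = (Ex P (fun o => g o * h o))%:E)%E.
Proof.
move=> ig ih; have mg := increment_has_moments _ ig; have mh := increment_has_moments _ ih.
rewrite unlock (expectation_Ex g)// (expectation_Ex h)// (increment_centered g)// (increment_centered h)//.
have -> : ((g \- cst (fine (0 : R)%:E)) * (h \- cst (fine (0 : R)%:E)))%R = (fun o => g o * h o).
  by apply/funext => o; rewrite -[LHS]/((g o - 0) * (h o - 0)) !subr0.
by rewrite expectation_Ex//; exact: has_momentsM.
Qed.

Lemma Ex_combination s t : \sum_(e <- s) e.1 = 0 -> \sum_(e <- t) e.1 = 0 ->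
  Ex P (fun o => combination s o * combination t o) =
  \sum_(e <- s) \sum_(e' <- t) e.1 * e'.1 * K (e.2 - e'.2).
Proof.
move=> s0 t0; have [_] := irf s t s0 t0.
by rewrite covariance_increment; [case|exists s|exists t].
Qed.

Lemma increment_D1 t : increment (D1 1 X t).
Proof.
exists [:: (1, site t); (-1, site (t + e1 *+ 1)); (-1, site (t + e2 *+ 1));
   (1, site (t + e1 *+ 1 + e2 *+ 1))].
  by rewrite !big_cons big_nil /=; ring.
by apply/funext => o; rewrite /combination /D1 !big_cons big_nil /=; ring.
Qed.

(** 1 - x ^ 2 = (1 + x) (1 - x) along each axis. *)
Lemma D1_stencil r t o : (0 < r <= 2)%N -> D1 r X t o = stencil_sum (D1 1 X) r t o.
Proof.
case: r => [|[|[|]]]//= _; rewrite /stencil_sum /stencil /=.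
  by rewrite big_seq1 addr0.
rewrite !big_cons big_nil /D1 /= !mulr1n !mulr2n.
have -> : (1, 0) = e1 by []. have -> : (0, 1) = e2 by []. have -> : (1, 1) = e1 + e2 by [].
rewrite !addr0 !addrA.
rewrite (addrAC t e2 e1) (addrAC (t + e1) e2 e1) (addrAC (t + e1 + e1) e2 e2) .
ring.
Qed.

End Increments.

(** * The limit vector *)

Section LimitVector.
Context {R : realType}.

(** A Cholesky factor, also for a singular form. *)
Lemma cholesky2 (A B D : R) : (forall x y, 0 <= x ^+ 2 * A + 2 * x * y * B + y ^+ 2 * D) ->
  exists a b c : R, [/\ a ^+ 2 = A, a * b = B & b ^+ 2 + c ^+ 2 = D].
Proof.
move=> psd.
have A0 : 0 <= A by have := psd 1 0; rewrite expr1n expr0n /=; lra.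
have D0 : 0 <= D by have := psd 0 1; rewrite expr1n expr0n /=; lra.
have [A0'|A0'] := eqVneq A 0.
  have B0 : B = 0.
    apply/eqP/negPn/negP => Bn; have := psd (- (D + 1)) B.
    rewrite A0' mulr0 add0r => h.
    have B2 : 0 < B ^+ 2 by rewrite exprn_even_gt0.
    have D2 : 0 < (D + 2) * B ^+ 2 by apply: mulr_gt0 => //; lra.
    by lra.
  exists 0, 0, (Num.sqrt D); split; rewrite ?A0' ?B0 ?expr0n ?mul0r ?add0r ?sqr_sqrtr//.
have Ap : 0 < A by rewrite lt_neqAle eq_sym A0'.
pose a := Num.sqrt A; have a2 : a ^+ 2 = A by rewrite sqr_sqrtr.
have an : a != 0 by rewrite gt_eqF// sqrtr_gt0.
exists a, (B / a), (Num.sqrt (D - B ^+ 2 / A)); split=> //; first by rewrite mulrC divfK.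
rewrite sqr_sqrtr ?expr_div_n ?a2; first by rewrite addrC subrK.
have := psd (- B / A) 1.
rewrite (_ : _ + _ + _ = D - B ^+ 2 / A)//; by field.
Qed.

End LimitVector.

Section OrthonormalIncrements.
Context {R : realType} {d : measure_display} {T : measurableType d}.
Variables (P : probability T R) (phi1 phi2 : R) (X : R * R -> {RV P >-> R}).
Hypothesis X_irf : gaussian_power_law_irf0 phi1 phi2 X.
Hypothesis phi2_gt0 : 0 < phi2.
Local Notation K := (power_law phi1 phi2).
Local Notation inc := (increment P X).

Lemma incrementZ a g : inc g -> inc (fun o => a * g o).
Proof.
move=> ig; have := increment_lin _ _ (a - 1) _ _ ig ig.
by congr inc; apply/funext => o; ring.
Qed.

Let Keq (h h' : R * R) : h.1 ^+ 2 + h.2 ^+ 2 = h'.1 ^+ 2 + h'.2 ^+ 2 -> K h = K h'.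
Proof. by move=> e; rewrite /power_law /enorm e. Qed.

Let K0 (h : R * R) : h.1 ^+ 2 + h.2 ^+ 2 = 0 -> K h = 0.
Proof.
by move=> e; rewrite /power_law /enorm e sqrtr0 powR0 ?mulr0// gt_eqF// mulr_gt0.
Qed.

Let step x y := combination P X [:: (1, x); (-1, y)].

Let step_wt (x y : R * R) : \sum_(e <- [:: (1, x); (-1, y)]) e.1 = 0 :> R.
Proof. by rewrite !big_cons big_nil /= addr0 subrr. Qed.

Let Ex_step x y x' y' : Ex P (fun o => step x y o * step x' y' o) =
  K (x - x') - K (x - y') - K (y - x') + K (y - y').
Proof.
rewrite (Ex_combination P phi1 phi2 X X_irf _ _ (step_wt _ _) (step_wt _ _)).
move: K => k.
transitivity (1 * 1 * k (x - x') + 1 * -1 * k (x - y') + (-1 * 1 * k (y - x') + -1 * -1 * k (y - y'))).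
  by rewrite !big_cons !big_nil !addr0.
ring.
Qed.

(* by symmetry of the norm, the increments X(1,0) - X(-1,0) and X(0,1) - X(0,-1)
   are uncorrelated and have the same variance *)
Let U := step (1, 0) (-1, 0).
Let W := step (0, 1) (0, -1).
Let s2 := -2 * K (2, 0).

Let UU : Ex P (fun o => U o * U o) = s2.
Proof.
rewrite Ex_step (K0 ((1, 0) - (1, 0))) ?(K0 ((-1, 0) - (-1, 0))) /=; [|ring|ring].
rewrite (Keq ((1, 0) - (-1, 0)) (2, 0)) ?(Keq ((-1, 0) - (1, 0)) (2, 0)) /=; [|ring|ring].
rewrite /s2; move: (K _) => k; ring.
Qed.

Let WW : Ex P (fun o => W o * W o) = s2.
Proof.
rewrite Ex_step (K0 ((0, 1) - (0, 1))) ?(K0 ((0, -1) - (0, -1))) /=; [|ring|ring].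
rewrite (Keq ((0, 1) - (0, -1)) (2, 0)) ?(Keq ((0, -1) - (0, 1)) (2, 0)) /=; [|ring|ring].
rewrite /s2; move: (K _) => k; ring.
Qed.

Let UW : Ex P (fun o => U o * W o) = 0.
Proof.
rewrite Ex_step.
rewrite (Keq ((1, 0) - (0, -1)) ((1, 0) - (0, 1))) /=; last by ring.
rewrite (Keq ((-1, 0) - (0, 1)) ((1, 0) - (0, 1))) /=; last by ring.
rewrite (Keq ((-1, 0) - (0, -1)) ((1, 0) - (0, 1))) /=; last by ring.
move: (K _) => k; ring.
Qed.

(** The common variance of the two increments is a nonzero multiple of
    phi1 Gamma(- phi2); when this constant is 0, all covariances vanish. Arguing by
    cases on it avoids computing its sign. *)
Lemma orthonormal_increments :
  (exists G H, [/\ inc G, inc H, Ex P (fun o => G o * G o) = 1,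
     Ex P (fun o => H o * H o) = 1 & Ex P (fun o => G o * H o) = 0]) \/
  (forall g h, inc g -> inc h -> Ex P (fun o => g o * h o) = 0).
Proof.
have iU : inc U by exists [:: (1, (1, 0)); (-1, (-1, 0))].
have iW : inc W by exists [:: (1, (0, 1)); (-1, (0, -1))].
have [k0|k0] := eqVneq (phi1 * Gamma (- phi2)) 0.
  right=> g h [s s0 ->] [t t0 ->]; rewrite (Ex_combination P phi1 phi2 X X_irf)//.
  by rewrite big1// => e _; rewrite big1// => e' _; rewrite /power_law k0 mul0r mulr0.
left.
have s20 : 0 < s2.
  rewrite lt_neqAle eq_sym; apply/andP; split.
    apply: mulf_neq0; first by rewrite oppr_eq0.
    rewrite /power_law; apply: mulf_neq0 => //.
    by rewrite gt_eqF//; apply: powR_gt0; rewrite sqrtr_gt0 expr0n addr0 exprn_gt0.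
  rewrite -UU -[leLHS](Exp_cst P 0).
  have mU := increment_has_moments P phi1 phi2 X X_irf _ iU.
  apply: le_Rintegral => //.
  - by apply: has_moments_integrable; exact: has_moments_cst.
  - by apply: has_moments_integrable; exact: has_momentsM.
  - by move=> o _; rewrite -expr2 sqr_ge0.
pose z := (Num.sqrt s2)^-1.
have z2 : z * z * s2 = 1.
  by rewrite -expr2 exprVn sqr_sqrtr ?(ltW s20)// mulVf// gt_eqF.
exists (fun o => z * U o), (fun o => z * W o).
have ez g h : inc g -> inc h -> Ex P (fun o => z * g o * (z * h o)) = z * z * Ex P (fun o => g o * h o).
  move=> ig ih; rewrite -ExpZ; first by apply: Ex_ext => o; ring.
  by apply: has_momentsM; apply: (increment_has_moments P phi1 phi2 X X_irf).
split; [exact: incrementZ|exact: incrementZ| | |].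
- by rewrite ez// UU.
- by rewrite ez// WW.
- by rewrite ez// UW mulr0.
Qed.

(** The limit law is realized on the same probability space, by two increments of
    the field itself; hence all its linear forms are normal. *)
Lemma limit_vector (A B D : R) :
  (forall x y, 0 <= x ^+ 2 * A + 2 * x * y * B + y ^+ 2 * D) ->
  ((forall g h, inc g -> inc h -> Ex P (fun o => g o * h o) = 0) -> [/\ A = 0, B = 0 & D = 0]) ->
  exists V1 V2, [/\ inc V1, inc V2 & forall x y,
    Ex P (fun o => (x * V1 o + y * V2 o) ^+ 2) = x ^+ 2 * A + 2 * x * y * B + y ^+ 2 * D].
Proof.
move=> psd deg; have [[G [H [iG iH GG HH GH]]]|z] := orthonormal_increments; last first.
  have [-> -> ->] := deg z.
  have i0 := increment_D1 P X 0.
  exists (D1 1 X 0), (D1 1 X 0); split=> // x y.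
  have ixy : inc (fun o => x * D1 1 X 0 o + y * D1 1 X 0 o).
    by apply: increment_lin => //; exact: incrementZ.
  by rewrite !mulr0 !addr0 -[RHS](z _ _ ixy ixy); apply: Ex_ext => o; rewrite expr2.
have [a [b [e [aA abB bD]]]] := cholesky2 A B D psd.
exists (fun o => a * G o), (fun o => b * G o + e * H o); split.
- exact: incrementZ.
- by apply: increment_lin => //; exact: incrementZ.
move=> x y.
have mG := increment_has_moments P phi1 phi2 X X_irf _ iG.
have mH := increment_has_moments P phi1 phi2 X X_irf _ iH.
have mGG := has_momentsM P _ _ mG mG; have mHH := has_momentsM P _ _ mH mH.
have mGH := has_momentsM P _ _ mG mH.
pose p := x * a + y * b; pose q := y * e.
transitivity (Ex P (fun o => p ^+ 2 * (G o * G o) + 2 * p * q * (G o * H o) + q ^+ 2 * (H o * H o))).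
  by apply: Ex_ext => o; rewrite /p /q; ring.
rewrite !ExpD ?ExpZ ?GG ?HH ?GH //; try (by apply: has_momentsZ); last first.
  by apply: has_momentsD; exact: has_momentsZ.
by rewrite /p /q -aA -abB -bD; ring.
Qed.

End OrthonormalIncrements.

(** * The central limit theorem *)

Section Assembly.
Context {R : realType} {d : measure_display} {T : measurableType d}.
Variable P : probability T R.

Lemma mfun_pair (V1 V2 : T -> R) : measurable_fun setT V1 -> measurable_fun setT V2 ->
  exists V : {RV P >-> (measurableTypeR R * measurableTypeR R)%type}, forall o, V o = (V1 o, V2 o).
Proof.
move=> m1 m2.
pose V o : (measurableTypeR R * measurableTypeR R)%type := (V1 o, V2 o).
have mV : measurable_fun setT V by exact: measurable_fun_pair.
pose mixV := isMeasurableFun.Build _ _ _ _ V mV.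
by exists (HB.pack_for {RV P >-> (measurableTypeR R * measurableTypeR R)%type} V mixV).
Qed.

Lemma Q1_variation phi1 phi2 (X : R * R -> {RV P >-> R}) r n o : gaussian_power_law_irf0 phi1 phi2 X -> (0 < r <= 2)%N ->
  Num.sqrt (n ^ 2)%:R * (Q1 r n X o - fine ('E_P[Q1 r n X])%E) =
  rate n r * variation P (D1 1 X) r n o.
Proof.
move=> X_irf r12.
pose L : R := #|Lambda (n - 2 * r)|%:R^-1.
have mS t : has_moments P (stencil_sum (D1 1 X) r t).
  apply: (increment_has_moments P phi1 phi2 X X_irf); apply: LL_stencil_sum.
  - exact: increment_lin.
  - exact: increment_D1.
have mS2 t : has_moments P (fun o => stencil_sum (D1 1 X) r t o ^+ 2) by exact: has_momentsX.
have eQ : Q1 r n X = fun o => L * \sum_(t <- cube (n - 2 * r)) stencil_sum (D1 1 X) r t o ^+ 2.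
  apply/funext => o'; rewrite -(sum_Lambda _ (fun t => stencil_sum (D1 1 X) r t o' ^+ 2)) /Q1 -/L.
  by congr (_ * _); apply: eq_bigr => t _; rewrite D1_stencil.
have mQ : has_moments P (Q1 r n X).
  by rewrite eQ; apply: has_momentsZ; exact: has_moments_sum.
rewrite expectation_Ex// eQ /= ExpZ; last exact: has_moments_sum.
rewrite Exp_sum// /variation sumrB -mulrBr mulrA; congr (_ * _).
rewrite /rate /L /Lambda card_prod !card_ord natrX sqrtr_sqr ger0_norm//.
by rewrite natrM expr2.
Qed.

End Assembly.

Theorem theorem4p3 (R : realType) (d : measure_display) (T : measurableType d)
    (P : probability T R) (phi1 phi2 c : R) (X : R * R -> {RV P >-> R})
    (phi1_gt0 : 0 < phi1) (phi2_gt0 : 0 < phi2) (phi2_lt1 : phi2 < 1)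
    (X_irf : gaussian_power_law_irf0 phi1 phi2 X)
    (c_gt0 : 0 < c)
    (c_spec : is_spectral_density P (D1 1 X) (fD phi1 phi2 c)) :
  let q (r n : nat) : R := fine 'E_P[Q1 r n X]%E in
  exists2 nu : probability (measurableTypeR R * measurableTypeR R)%type R,
    is_normal2 (Sigma phi1 phi2 c) nu &
    cvg_in_law2 P
      (fun (n : nat) (o : T) =>
         (Num.sqrt (n ^ 2)%:R * (Q1 1 n X o - q 1%N n),
          Num.sqrt (n ^ 2)%:R * (Q1 2 n X o - q 2%N n)))
      nu.
Proof.
move=> q; pose f := fD phi1 phi2 c; pose Z := D1 1 X.
have af : tapprox f by exact: tapprox_fD.
pose LL := increment P X.
have LLlin a g h : LL g -> LL h -> LL (fun o => g o + a * h o) by exact: increment_lin.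
have LLm g : LL g -> has_moments P g by exact: (increment_has_moments P phi1 phi2 X X_irf).
have LLg := increment_stein P phi1 phi2 X X_irf.
have LLZ t : LL (Z t) by exact: increment_D1.
have covZ t s : Ex P (fun o => Z t o * Z s o) = coefw f (s - t).
  have := congr1 (@complex.Re R) (c_spec t (s - t)).
  rewrite (_ : t + (s - t) = s); last by rewrite addrC subrK.
  rewrite (covariance_increment P phi1 phi2 X X_irf _ _ (LLZ t) (LLZ s)) /= => ->.
  by apply: eq_TI => l _ /=; rewrite mulr0 subr0 mulrC.
pose S r s := lattice_sum (fun h => stencil_coefw f r s h ^+ 2).
have SC : S 2 1 = S 1 2.
  by rewrite /S !lattice_sum_stencil//; apply: eq_TI => l _; rewrite (mulrC (stencil_weight 2 l)).
have mom x y := cvg_variation_moments P LL LLlin LLm LLg Z LLZ f af covZ (fun r => if r == 1%N then x else y).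
pose A := 2 * S 1 1; pose B := 2 * S 1 2; pose D := 2 * S 2 2.
have vE x y : 2 * (x * x * S 1 1 + x * y * S 1 2 + (y * x * S 2 1 + y * y * S 2 2)) =
    x ^+ 2 * A + 2 * x * y * B + y ^+ 2 * D.
  by rewrite SC /A /B /D; ring.
have mZ r t : LL (stencil_sum Z r t) by exact: LL_stencil_sum.
have mvar r n : has_moments P (fun o => rate n r * variation P Z r n o).
  apply: has_momentsZ; apply: has_moments_sum => t; apply: has_momentsB.
    by apply: has_momentsX; exact: LLm.
  exact: has_moments_cst.
(* a limit of second moments *)
have psd x y : 0 <= x ^+ 2 * A + 2 * x * y * B + y ^+ 2 * D.
  rewrite -vE; have := mom x y 2; rewrite /= mul1r mulr1 => cm.
  rewrite -(cvg_lim (@Rhausdorff R) cm); apply: limr_ge; first exact: cvgP cm.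
  apply: nearW => n; rewrite -[leLHS](Exp_cst P 0); apply: le_Rintegral => //.
  - by apply: has_moments_integrable; exact: has_moments_cst.
  - apply: has_moments_integrable; apply: has_momentsX.
    by apply: has_momentsD; exact: has_momentsZ.
  - by move=> o _; exact: sqr_ge0.
have [|V1 [V2 [i1 i2 vV]]] := limit_vector P phi1 phi2 X X_irf phi2_gt0 A B D psd.
  move=> z.
  (* in the degenerate case all covariances vanish, hence so does Sigma *)
  have S0 r s : S r s = 0.
    rewrite /S (_ : (fun h => _) = fun=> 0).
      rewrite /lattice_sum (_ : (fun M => _) = fun=> 0) ?lim_cst//.
      by apply/funext => M; rewrite big1.
    apply/funext => h; rewrite -[h]subr0.
    by rewrite -(cov_stencil_sum P LL LLm Z LLZ f covZ) (z _ _ (mZ r 0) (mZ s h)) expr0n.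
  by rewrite /A /B /D !S0 mulr0.
have iV x y : LL (fun o => x * V1 o + y * V2 o).
  by apply: LLlin => //; exact: incrementZ.
have m1 := LLm _ i1; have m2 := LLm _ i2.
have [V eV] := mfun_pair P V1 V2 m1.1 m2.1.
exists (distribution P V).
  move=> u E mE.
  transitivity (P [set w | E (u 0 0 * V1 w + u 0 1 * V2 w)]).
    by rewrite /distribution /pushforward; congr (P _); apply/seteqP; split=> w /=; rewrite eV.
  have SE i j : Sigma phi1 phi2 c i j = 2 * S i.+1 j.+1.
    by rewrite mxE /S lattice_sum_stencil//; congr (_ * _).
  have -> : (u *m Sigma phi1 phi2 c *m u^T) 0 0 =
      u 0 0 ^+ 2 * A + 2 * u 0 0 * u 0 1 * B + u 0 1 ^+ 2 * D.
    have o1 : lift ord0 ord0 = 1 :> 'I_2 by exact: val_inj.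
    rewrite -vE mxE !big_ord_recl big_ord0 !mxE !big_ord_recl !big_ord0 !SE o1 /=.
    rewrite (_ : ord0 = 0 :> 'I_2)// (_ : (1 %% 2)%N = 1%N)//.
    by move: (S 1 1) (S 1 2) (S 2 1) (S 2 2) => s11 s12 s21 s22; ring.
  rewrite -(vV (u 0 0) (u 0 1)).
  exact: (increment_law P phi1 phi2 X X_irf _ (iV (u 0 0) (u 0 1)) E mE).
pose Y n o := (rate n 1 * variation P Z 1 n o, rate n 2 * variation P Z 2 n o).
have -> : (fun (n : nat) (o : T) =>
         (Num.sqrt (n ^ 2)%:R * (Q1 1 n X o - q 1%N n),
          Num.sqrt (n ^ 2)%:R * (Q1 2 n X o - q 2%N n))) = Y.
  by apply/funext => n; apply/funext => o; rewrite /Y -!(Q1_variation P phi1 phi2).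
move=> h ch [M hM].
pose V' o := (V1 o, V2 o).
have cl : Ex P (fun o => h (Y n o)) @[n --> \oo] --> Ex P (fun o => h (V' o)).
  apply: (cvg_Ex_continuous P Y V' _ _ _ _ _ _ h M) => //.
  - by move=> n; exact: mvar.
  - by move=> n; exact: mvar.
  - move=> a b k; rewrite [X in _ --> X](increment_nmoment P phi1 phi2 X X_irf _ k (iV a b)).
    by rewrite vV -vE; exact: mom.
  - by move=> a b; eexists => k; exact: (increment_nmoment P phi1 phi2 X X_irf _ k (iV a b)).
have mhY n : has_moments P (h \o Y n).
  apply: (has_moments_bounded _ _ M); last by move=> o; exact: hM.
  by apply: measurable_continuous2 => //; [exact: (mvar 1%N n).1|exact: (mvar 2%N n).1].
have mhV : has_moments P (fun o => h (V o)).
  apply: (has_moments_bounded _ _ M); last by move=> o; exact: hM.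
  rewrite (_ : (fun o => _) = h \o V'); last by apply/funext => o; rewrite eV.
  by apply: measurable_continuous2 => //; [exact: m1.1|exact: m2.1].
have -> : (\int[distribution P V]_z (h z)%:E = (Ex P (fun o => h (V' o)))%:E)%E.
  rewrite integral_distribution; first last.
  - exact: has_moments_integrable.
  - apply/measurable_EFinP.
    apply: (@measurable_continuous2 R _ (measurableTypeR R * measurableTypeR R)%type h id ch).
    + exact: measurable_fst.
    + exact: measurable_snd.
  transitivity ('E_P[fun o => h (V o)])%E; first by rewrite unlock.
  by rewrite expectation_Ex//; congr EFin; apply: eq_Rintegral => o _; rewrite eV.
apply: cvg_EFin; first by apply: nearW => n; rewrite expectation_Ex.
apply: cvg_trans cl; apply: near_eq_cvg; apply: nearW => n.
by rewrite /= expectation_Ex.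
Qed.
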